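(* The moduli space of orthogonal multiplications of type $[3,4,8]$, up to domain and range equivalence, consists of two components: (i) the $5$-dimensional grand moduli $\mathcal{G}_{(3,4,8)}$, with the constraints $\alpha=\gamma$, $\mu=-\nu$, $F_{11,22}=F_{14,23}$ and $$\beta^2=(1-\mu^2)(1-\alpha^2)-(F_{11,22}+\alpha\mu)^2-F_{14,21}^2-F_{14,22}^2;$$ and (ii) the $3$-dimensional degenerate moduli $\mathcal{X}_{(3,4,8)}$, consisting of those with $\beta=F_{14,21}=F_{14,22}=0$; writing $\alpha=\cos\phi$, $\gamma=\cos\psi$, $\mu=\cos\theta$, $\nu=\cos\eta$ with $0\le\phi,\psi,\theta,\eta\le\pi$, it is given by $$F_{11,22}-\alpha\nu=\pm\sin\eta\sin\phi,\quad -F_{11,22}-\gamma\mu=\pm\sin\theta\sin\psi,\quad -F_{14,23}-\alpha\mu=\pm\sin\theta\sin\phi,\quad F_{14,23}-\gamma\nu=\pm\sin\eta\sin\psi,$$ with the constraint $$F_{11,22}=\cos(\phi\pm\eta)=-\cos(\psi\pm\theta),\qquad F_{14,23}=\cos(\psi\pm\eta)=-\cos(\phi\pm\theta).$$ The two components intersect at the points where $\cos\phi=\cos\psi$ and $\cos\theta=-\cos\eta$.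
   Context: An orthogonal multiplication of type $[3,4,8]$ is a bilinear map $F:\mathbb{R}^3\times\mathbb{R}^4\to\mathbb{R}^8$ with $|F(x,y)|=|x||y|$. Domain and range equivalence means equivalence under orthogonal changes of the domain factors ($SO(3)$, $SO(4)$) and of the range. Let $e_1,e_2,e_3$ and $f_1,\dots,f_4$ be orthonormal bases of $\mathbb{R}^3$ and $\mathbb{R}^4$, and let $F_{ij,kl}=\langle F(e_i,f_j),F(e_k,f_l)\rangle$. Up to domain equivalence the bases may be, and are, chosen so that $F$ is normalized, meaning $$F_{31,12}=F_{33,14}=0,\ F_{31,22}=F_{33,24}=0,\ F_{31,23}=F_{34,22}=0,$$ $$F_{11,23}+F_{14,22}=F_{11,24}+F_{12,23}=F_{31,14}+F_{32,13}=0.$$ Set $\alpha=F_{31,13}$, $\beta=F_{31,14}$, $\gamma=F_{32,14}$, $\mu=F_{24,31}$, $\nu=F_{23,32}$. Together with $F_{14,21},F_{14,22},F_{11,22},F_{14,23}$, these determine all $F_{ij,kl}$ of a normalized $F$, and hence $F$ up to range equivalence. The grand moduli $\mathcal{G}_{(3,4,8)}$ is the moduli represented by normalized orthogonal multiplications of type $[3,4,8]$ with $\alpha=\gamma$ and $\mu=-\nu$. The signs $\pm$ depend on the multiplication and are not asserted to be equal to one another.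
   Formalization: On G, F_{11,22}=F_{14,23} is false in general; it is proved except where F_{14,21}=F_{14,22}=0 and F_{14,23}+αμ=-(F_{11,22}+αμ). Dimensions 5 and 3, and the intersection, are those of the parameter sets of normalized representatives, not of equivalence classes. *)

(* Defs.v *)
From HB Require Import structures.
From mathcomp Require Import all_boot all_order all_algebra.
From mathcomp Require Import all_classical all_reals all_analysis.

Set Implicit Arguments.
Unset Strict Implicit.
Unset Printing Implicit Defensive.

Import Order.TTheory GRing.Theory Num.Theory.
Import numFieldNormedType.Exports.

Local Open Scope classical_set_scope.
Local Open Scope ring_scope.

Section Euclidean.
Variable R : realType.

Definition dot n (u v : 'rV[R]_n) : R := \sum_(i < n) u 0 i * v 0 i.

(* The canonical norm `|u| on 'rV[R]_n is the sup norm, hence this one. *)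
Definition enorm n (u : 'rV[R]_n) : R := Num.sqrt (dot u u).

(* The standard basis, numbered from 1. *)
Definition bvec n (i : nat) : 'rV[R]_n := \row_(j < n) (j.+1 == i)%:R.

Definition orthogonal_mx n (A : 'M[R]_n) : Prop := A *m A^T = 1%:M.

Definition special_orthogonal_mx n (A : 'M[R]_n) : Prop :=
  orthogonal_mx A /\ \det A = 1.

(* Dimension of S as the largest k such that the projection of S onto some k
   distinct coordinates has nonempty interior; for semialgebraic S this is the
   usual dimension. *)
Definition has_dim n (S : set 'rV[R]_n) (k : nat) : Prop :=
  (exists2 f : 'I_k -> 'I_n,
     injective f & interior (colsub f @` S) !=set0) /\
  (forall m (f : 'I_m -> 'I_n),
     injective f -> interior (colsub f @` S) !=set0 -> (m <= k)%N).

End Euclidean.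

Notation bilinear_map R a b n :=
  {bilinear 'rV[R]_a -> 'rV[R]_b -> 'rV[R]_n}.

Section OrthogonalMultiplication.
Variables (R : realType) (a b n : nat).
Implicit Types F G : bilinear_map R a b n.

Definition orthogonal_multiplication F : Prop :=
  forall x y, enorm (F x y) = enorm x * enorm y.

(* Domain changes are taken in SO(a) and SO(b), range changes in O(n). *)
Definition equivalent F G : Prop :=
  exists (g : 'M[R]_a) (h : 'M[R]_b) (k : 'M[R]_n),
    [/\ special_orthogonal_mx g, special_orthogonal_mx h, orthogonal_mx k &
        forall x y, G x y = F (x *m g) (y *m h) *m k].

(* coef F i j k l is F_{ij,kl}, with indices numbered from 1. *)
Definition coef F (i j k l : nat) : R :=
  dot (F (bvec R a i) (bvec R b j)) (F (bvec R a k) (bvec R b l)).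

End OrthogonalMultiplication.

Section Type348.
Variable R : realType.
Implicit Type F : bilinear_map R 3 4 8.

Definition normalized F : Prop :=
  [/\ coef F 3 1 1 2 = 0 /\ coef F 3 3 1 4 = 0,
      coef F 3 1 2 2 = 0 /\ coef F 3 3 2 4 = 0,
      coef F 3 1 2 3 = 0 /\ coef F 3 4 2 2 = 0 &
      [/\ coef F 1 1 2 3 + coef F 1 4 2 2 = 0,
          coef F 1 1 2 4 + coef F 1 2 2 3 = 0 &
          coef F 3 1 1 4 + coef F 3 2 1 3 = 0]].

Definition alpha F : R := coef F 3 1 1 3.
Definition beta F : R := coef F 3 1 1 4.
Definition gamma F : R := coef F 3 2 1 4.
Definition mu F : R := coef F 2 4 3 1.
Definition nu F : R := coef F 2 3 3 2.
Definition F1421 F : R := coef F 1 4 2 1.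
Definition F1422 F : R := coef F 1 4 2 2.
Definition F1122 F : R := coef F 1 1 2 2.
Definition F1423 F : R := coef F 1 4 2 3.

(* The nine parameters determining a normalized orthogonal multiplication up
   to range equivalence. *)
Definition coords F : 'rV[R]_9 :=
  \row_(i < 9) nth 0 [:: alpha F; beta F; gamma F; mu F; nu F;
                         F1421 F; F1422 F; F1122 F; F1423 F] i.

Definition grand F : Prop :=
  [/\ orthogonal_multiplication F, normalized F,
      alpha F = gamma F & mu F = - nu F].

Definition grand_equation F : Prop :=
  beta F ^+ 2 = (1 - mu F ^+ 2) * (1 - alpha F ^+ 2)
                - (F1122 F + alpha F * mu F) ^+ 2
                - F1421 F ^+ 2 - F1422 F ^+ 2.

Definition degenerate F : Prop :=
  [/\ orthogonal_multiplication F, normalized F &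
      [/\ beta F = 0, F1421 F = 0 & F1422 F = 0]].

Definition angle (x : R) : Prop := 0 <= x <= pi.

Definition angles F (phi psi theta eta : R) : Prop :=
  [/\ angle phi, angle psi, angle theta & angle eta] /\
  [/\ alpha F = cos phi, gamma F = cos psi,
      mu F = cos theta & nu F = cos eta].

(* Each sign below is chosen independently of the others. *)
Definition is_pm (x y : R) : Prop := x = y \/ x = - y.
Definition is_cos_pm (z x y : R) : Prop := z = cos (x + y) \/ z = cos (x - y).

(* In the next two definitions p and q stand for F_{11,22} and F_{14,23}. *)
Definition degenerate_equations (phi psi theta eta p q : R) : Prop :=
  [/\ is_pm (p - cos phi * cos eta) (sin eta * sin phi),
      is_pm (- p - cos psi * cos theta) (sin theta * sin psi),
      is_pm (- q - cos phi * cos theta) (sin theta * sin phi) &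
      is_pm (q - cos psi * cos eta) (sin eta * sin psi)].

Definition degenerate_constraint (phi psi theta eta p q : R) : Prop :=
  [/\ is_cos_pm p phi eta, is_cos_pm (- p) psi theta,
      is_cos_pm q psi eta & is_cos_pm (- q) phi theta].

End Type348.

(* Main.v *)
Require Import Defs.
From HB Require Import structures.
From mathcomp Require Import all_boot all_order all_algebra.
From mathcomp Require Import all_classical all_reals all_analysis.
From mathcomp Require Import ring lra.
From mathcomp Require polyrcf.

Set Implicit Arguments.
Unset Strict Implicit.
Unset Printing Implicit Defensive.

Import Order.TTheory GRing.Theory Num.Theory.
Import numFieldNormedType.Exports.

Local Open Scope classical_set_scope.
Local Open Scope ring_scope.

(** An orthogonal multiplication F is a triple of isometries y |-> F(e_i, y) whose
    4 x 8 matrices T_i (acting on row vectors) satisfy T_i T_j^T + T_j T_i^T = 2 delta_ij.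
    Up to the choice of a basis of the target it is therefore given by the three skew
    matrices W_0 = T_1 T_2^T, W_1 = T_2 T_0^T, W_2 = T_0 T_1^T.  Splitting the skew 4 x 4
    matrices into self-dual and anti-self-dual ones turns (W_0, W_1, W_2) into two 3 x 3
    matrices P and Q, one column for each W_k.  A rotation of the first factor multiplies
    both P and Q on the right; since SO(4) covers SO(3) x SO(3), rotations of the second
    factor multiply P and Q on the left by two independent rotations.  F is degenerate when
    both P and Q are in the antidiagonal pattern of the normalization, and it lies in the
    diagonal part p = q of the grand moduli when P = 0.

    The dimension 8 of the target enters through its complement: the images of T_0 and T_1
    projected away from the 4-dimensional image of T_2 live in a 4-dimensional space, so a
    certain 8 x 8 Gram matrix has rank at most 4 (schur_rank).  When P is diagonal, the
    resulting matrix equation can be written in quaternionic coordinates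
    (crossed_columns_system) and solved (crossed_columns_scalar).  It says that two columns
    of Q can fail to be orthogonal only if the corresponding columns of P have the same
    length (gram_offdiag).  Consequently P^T P and Q^T Q are diagonal in a common orthonormal
    basis of the first factor (simultaneous_diag3), and then P and Q are made diagonal by
    rotations on their left (orth_cols_diag, diagonal_form).  This makes every
    orthogonal multiplication equivalent to a degenerate one (equivalent_degenerate), which
    settles the first assertion: the point of the grand moduli with P = 0 represented by Q
    is also represented by a diagonal Q.

    For the individual components the same rank condition is read off in coordinates.  On
    the grand moduli it says that a 4 x 4 matrix N, the Gram matrix of the two projected
    images, satisfies N^T N = (1 - alpha^2 - beta^2)(1 - mu^2), which is the grand equation
    together with the alternative on p and q; on the degenerate moduli N is monomial and its
    four entries are the four sine products.  Conversely, square matrices C and D with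
    C C^T = 1 + W_1^2, D D^T = 1 + W_0^2 and C D^T = W_2 - W_1 W_0 produce a multiplication
    (realize_wedges), and such C and D are explicit in both families.

    The dimensions are bounded below by the explicit families near the origin.  For the
    upper bounds, a set of coordinates which can be varied independently inside the moduli
    cannot satisfy a relation that is monic in one of them: finite differences of the
    relation would vanish, while they are non-zero multiples of powers of the step
    (movable_quadratic, movable_quartic).  Counting the coordinates left by these
    exclusions gives 5 and 3. *)

(** * Elimination for two non-orthogonal columns *)

Section Elim.
Variable R : realFieldType.

Lemma cross_eq0_parallel (v1 v2 v3 u1 u2 u3 : R) :
  v2 * u3 - v3 * u2 = 0 -> v3 * u1 - v1 * u3 = 0 -> v1 * u2 - v2 * u1 = 0 ->
  let V := v1 ^+ 2 + v2 ^+ 2 + v3 ^+ 2 in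
  let S := v1 * u1 + v2 * u2 + v3 * u3 in
  [/\ V * u1 = S * v1, V * u2 = S * v2 & V * u3 = S * v3].
Proof.
move=> h1 h2 h3 V S; rewrite /V /S; split; apply/eqP; rewrite -subr_eq0; apply/eqP.
- transitivity (v3 * (v3 * u1 - v1 * u3) - v2 * (v1 * u2 - v2 * u1)); first by ring.
  by rewrite h2 h3; ring.
- transitivity (v1 * (v1 * u2 - v2 * u1) - v3 * (v2 * u3 - v3 * u2)); first by ring.
  by rewrite h1 h3; ring.
- transitivity (v2 * (v2 * u3 - v3 * u2) - v1 * (v3 * u1 - v1 * u3)); first by ring.
  by rewrite h1 h2; ring.
Qed.

(** The rank condition for P = diag(p1, p2, p3), when the columns u and v of Q have
    inner product S <> 0 (w is the third column). The three systems are its components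
    along L_3 R_b, L_1 R_b and L_2 R_b, in this order, with m = w + u x v.

    The inner product of the second system with v gives xi p1 = p2 p3 (xi + 2 V), so p1
    = 0 if p2 = 0, and then the second system becomes kappa (v x w) = 0. If kappa = 0,
    two linear relations between p1 and p3 force p1^2 = p3^2. Otherwise w is parallel to
    v, and the third system makes u parallel to v as well, so that only scalar equations
    along v are left. They give p1^2 = p3^2 when w <> 0; when w = 0 they give p1^2 >
    p3^2, unless p1 = p3 = 0, and this contradicts 4 p2^2 V <= xi^2. *)
Lemma crossed_columns_scalar (p1 p2 p3 u1 u2 u3 v1 v2 v3 w1 w2 w3 : R)
  (V U S xi r kappa tau rho c1 c2 c3 m1 m2 m3 : R) :
  V = v1 ^+ 2 + v2 ^+ 2 + v3 ^+ 2 -> U = u1 ^+ 2 + u2 ^+ 2 + u3 ^+ 2 ->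
  S = u1 * v1 + u2 * v2 + u3 * v3 ->
  xi = 1 - p2 ^+ 2 - V -> r = p3 - p1 * p2 -> kappa = xi * p1 - 2 * p2 * r ->
  tau = - xi ^+ 2 * p1 + xi * r * p2 + 2 * p2 ^+ 2 * p1 * V ->
  rho = p2 * r ^+ 2 - xi * r * p1 + p2 * p1 ^+ 2 * V ->
  c1 = u2 * v3 - u3 * v2 -> c2 = u3 * v1 - u1 * v3 -> c3 = u1 * v2 - u2 * v1 ->
  m1 = w1 + c1 -> m2 = w2 + c2 -> m3 = w3 + c3 ->
  0 < xi -> 4 * p2 ^+ 2 * V <= xi ^+ 2 -> S != 0 ->
  [/\ (2 * p1 * p2 * V - xi * r) * m1 + p2 * kappa * c1 = 0,
      (2 * p1 * p2 * V - xi * r) * m2 + p2 * kappa * c2 = 0 &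
      (2 * p1 * p2 * V - xi * r) * m3 + p2 * kappa * c3 = 0] ->
  [/\ tau * u1 - kappa * (S * v1 + (v2 * m3 - v3 * m2)) = 0,
      tau * u2 - kappa * (S * v2 + (v3 * m1 - v1 * m3)) = 0 &
      tau * u3 - kappa * (S * v3 + (v1 * m2 - v2 * m1)) = 0] ->
  let s := v1 * w1 + v2 * w2 + v3 * w3 in
  let W := w1 ^+ 2 + w2 ^+ 2 + w3 ^+ 2 in
  [/\ p2 * (U * v1 - 2 * S * u1 - (xi + 2 * V) * (u2 * w3 - u3 * w2)
            + (W * v1 - 2 * s * w1)) + rho * v1 = 0,
      p2 * (U * v2 - 2 * S * u2 - (xi + 2 * V) * (u3 * w1 - u1 * w3)
            + (W * v2 - 2 * s * w2)) + rho * v2 = 0 &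
      p2 * (U * v3 - 2 * S * u3 - (xi + 2 * V) * (u1 * w2 - u2 * w1)
            + (W * v3 - 2 * s * w3)) + rho * v3 = 0] ->
  (p1 = 0 /\ p2 = 0) \/ p1 ^+ 2 = p3 ^+ 2.
Proof.
move=> dV dU dS dxi dr dk dt drho dc1 dc2 dc3 dm1 dm2 dm3 xi0 Dge0 S0.
move=> [T1 T2 T3] [I1 I2 I3] s W [R1 R2 R3].
have V0 : 0 < V.
  rewrite lt_neqAle dV !addr_ge0 ?sqr_ge0 // andbT eq_sym.
  apply: contra S0; rewrite !paddr_eq0 ?addr_ge0 ?sqr_ge0 // !sqrf_eq0.
  by case/andP => /andP[/eqP a1 /eqP a2] /eqP a3; rewrite dS a1 a2 a3 !mulr0 !addr0.
(* Scalar product of the second system with v; S <> 0 is cancelled. *)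
have hB : xi * p1 = p2 * p3 * (xi + 2 * V).
  have : S * (tau - kappa * V) = 0.
    have -> : S * (tau - kappa * V) =
      v1 * (tau * u1 - kappa * (S * v1 + (v2 * m3 - v3 * m2))) +
      v2 * (tau * u2 - kappa * (S * v2 + (v3 * m1 - v1 * m3))) +
      v3 * (tau * u3 - kappa * (S * v3 + (v1 * m2 - v2 * m1))).
      by rewrite dV dS; ring.
    by rewrite I1 I2 I3; ring.
  move/eqP; rewrite mulf_eq0 (negbTE S0) /= => /eqP.
  have -> : tau - kappa * V = - xi * p1 * (xi + p2 ^+ 2 + V) + p2 * p3 * (xi + 2 * V).
    by rewrite dt dk dr; ring.
  have -> : xi + p2 ^+ 2 + V = 1 by rewrite dxi; ring.
  by move=> h; lra.
have htau : tau = kappa * V.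
  have -> : tau = kappa * V - xi * p1 * (xi + p2 ^+ 2 + V) + p2 * p3 * (xi + 2 * V).
    by rewrite dt dk dr; ring.
  have -> : xi + p2 ^+ 2 + V = 1 by rewrite dxi; ring.
  by rewrite -hB; ring.
have [p20|p20] := eqVneq p2 0.
  left; split=> //; apply/eqP; move: hB; rewrite p20 !mul0r => /eqP.
  by rewrite mulf_eq0 (gt_eqF xi0).
right.
have [k0|k0] := eqVneq kappa 0.
  have e1 : p1 * (xi + 2 * p2 ^+ 2) = 2 * p2 * p3.
    have -> : p1 * (xi + 2 * p2 ^+ 2) = kappa + 2 * p2 * p3 by rewrite dk dr; ring.
    by rewrite k0 add0r.
  have e2 : 2 * p1 * p2 = p3 * (xi + 2 * p2 ^+ 2).
    apply: (mulfI p20).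
    have -> : p2 * (2 * p1 * p2) = p1 * (xi + 2 * p2 ^+ 2) - xi * p1 by ring.
    by rewrite e1 hB dxi; ring.
  have t0 : xi + 2 * p2 ^+ 2 != 0.
    by rewrite gt_eqF // ltr_wpDr // mulr_ge0 // sqr_ge0.
  apply: (mulfI t0); apply: (mulfI p20).
  have -> : p2 * ((xi + 2 * p2 ^+ 2) * p1 ^+ 2) = p2 * p1 * (p1 * (xi + 2 * p2 ^+ 2)) by ring.
  have -> : p2 * ((xi + 2 * p2 ^+ 2) * p3 ^+ 2) = p2 * p3 * (p3 * (xi + 2 * p2 ^+ 2)) by ring.
  by rewrite e1 -e2; ring.
have x1 : v2 * w3 - v3 * w2 = 0.
  apply: (mulfI k0); rewrite mulr0 -[RHS]oppr0 -I1 htau ?dm1 ?dm2 ?dm3 ?dc1 ?dc2 ?dc3 dS dV; ring.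
have x2 : v3 * w1 - v1 * w3 = 0.
  apply: (mulfI k0); rewrite mulr0 -[RHS]oppr0 -I2 htau ?dm1 ?dm2 ?dm3 ?dc1 ?dc2 ?dc3 dS dV; ring.
have x3 : v1 * w2 - v2 * w1 = 0.
  apply: (mulfI k0); rewrite mulr0 -[RHS]oppr0 -I3 htau ?dm1 ?dm2 ?dm3 ?dc1 ?dc2 ?dc3 dS dV; ring.
have Vn0 : V != 0 by rewrite gt_eqF.
set r1 := (X in X = 0) in R1; set r2 := (X in X = 0) in R2.
set r3 := (X in X = 0) in R3.
(* Scalar product of the third system with the component of u orthogonal to v. *)
have key : c1 ^+ 2 + c2 ^+ 2 + c3 ^+ 2 = 0.
  have p2S : 2 * p2 * S != 0 by rewrite !mulf_neq0 ?pnatr_eq0.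
  apply: (mulfI p2S); rewrite mulr0.
  have -> : 2 * p2 * S * (c1 ^+ 2 + c2 ^+ 2 + c3 ^+ 2) =
    S * (v1 * r1 + v2 * r2 + v3 * r3) - V * (u1 * r1 + u2 * r2 + u3 * r3)
    + p2 * ((v2 * w3 - v3 * w2) * ((2 * s) * c1 - S * (xi + 2 * V) * u1)
          + (v3 * w1 - v1 * w3) * ((2 * s) * c2 - S * (xi + 2 * V) * u2)
          + (v1 * w2 - v2 * w1) * ((2 * s) * c3 - S * (xi + 2 * V) * u3)).
    rewrite /r1 /r2 /r3 /s /W dc1 dc2 dc3 dS dV dU; ring.
  by rewrite R1 R2 R3 x1 x2 x3; ring.
have [c10 [c20 c30]] : c1 = 0 /\ c2 = 0 /\ c3 = 0.
  move/eqP: key; rewrite !paddr_eq0 ?addr_ge0 ?sqr_ge0 // !sqrf_eq0.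
  by case/andP => /andP[/eqP a1 /eqP a2] /eqP a3.
have [hu1 hu2 hu3] : [/\ V * u1 = S * v1, V * u2 = S * v2 & V * u3 = S * v3].
  have -> : S = v1 * u1 + v2 * u2 + v3 * u3 by rewrite dS; ring.
  rewrite dV; apply: cross_eq0_parallel.
  - by rewrite -[RHS]oppr0 -c10 dc1; ring.
  - by rewrite -[RHS]oppr0 -c20 dc2; ring.
  - by rewrite -[RHS]oppr0 -c30 dc3; ring.
have [hw1 hw2 hw3] : [/\ V * w1 = s * v1, V * w2 = s * v2 & V * w3 = s * v3].
  by rewrite dV /s; apply: cross_eq0_parallel.
pose t := S / V; pose l := s / V.
have hu : [/\ u1 = t * v1, u2 = t * v2 & u3 = t * v3].
  by split; apply: (mulfI Vn0); rewrite ?hu1 ?hu2 ?hu3 /t; field.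
have hw : [/\ w1 = l * v1, w2 = l * v2 & w3 = l * v3].
  by split; apply: (mulfI Vn0); rewrite ?hw1 ?hw2 ?hw3 /l; field.
case: hu => eu1 eu2 eu3; case: hw => ew1 ew2 ew3.
have t0 : t != 0 by rewrite mulf_neq0 ?invr_eq0.
have eR : p2 * (t ^+ 2 * V + l ^+ 2 * V) = rho.
  apply: (mulfI Vn0); apply/eqP; rewrite eq_sym -subr_eq0; apply/eqP.
  transitivity (v1 * r1 + v2 * r2 + v3 * r3); last by rewrite R1 R2 R3; ring.
  rewrite /r1 /r2 /r3 /s /W eu1 eu2 eu3 ew1 ew2 ew3 dU dS eu1 eu2 eu3 dV; ring.
have eT : (2 * p1 * p2 * V - xi * r) * l = 0.
  apply: (mulfI Vn0); rewrite mulr0.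
  set t1 := (X in X = 0) in T1; set t2 := (X in X = 0) in T2.
  set t3 := (X in X = 0) in T3.
  transitivity (v1 * t1 + v2 * t2 + v3 * t3); last by rewrite T1 T2 T3; ring.
  rewrite /t1 /t2 /t3 dm1 dm2 dm3 c10 c20 c30 ew1 ew2 ew3 dV; ring.
move/eqP: eT; rewrite mulf_eq0 => /orP[/eqP eT|/eqP l0].
  have e3 : xi * p3 = p1 * p2 * (xi + 2 * V).
    by apply/eqP; rewrite -subr_eq0 -oppr_eq0 -eT dr; apply/eqP; ring.
  apply: (mulfI (lt0r_neq0 xi0)).
  have -> : xi * p1 ^+ 2 = xi * p1 * p1 by ring.
  by rewrite hB expr2 mulrA e3; ring.
have p2lt : 1 - p2 ^+ 2 = xi + V by rewrite dxi; ring.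
(* From here on w = 0. *)
have hV : V * (p1 + p2 * p3) = (1 - p2 ^+ 2) * (p1 - p2 * p3).
  apply/eqP; rewrite -subr_eq0; apply/eqP.
  transitivity (p2 * p3 * (xi + 2 * V) - xi * p1); last by rewrite hB subrr.
  by rewrite p2lt; ring.
have [e|ne] := eqVneq p1 (p2 * p3).
  have : V * (p1 + p2 * p3) = 0 by rewrite hV e subrr mulr0.
  move/eqP; rewrite mulf_eq0 (negbTE Vn0) /= -e -mulr2n -mulr_natl mulf_eq0 pnatr_eq0 /=.
  move=> /eqP p10; move/esym/eqP: e; rewrite p10 mulf_eq0 (negbTE p20) /=.
  by move/eqP => ->.
have sV : 0 < 1 - p2 ^+ 2 by rewrite p2lt addr_gt0.
have hU : t ^+ 2 * V * (p1 + p2 * p3) = (p1 - p2 * p3) * (p1 ^+ 2 - p3 ^+ 2).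
  apply: (mulfI p20).
  have -> : p2 * (t ^+ 2 * V * (p1 + p2 * p3)) =
            p2 * (t ^+ 2 * V + l ^+ 2 * V) * (p1 + p2 * p3) by rewrite l0; ring.
  rewrite eR drho.
  have -> : p2 * r ^+ 2 - xi * r * p1 + p2 * p1 ^+ 2 * V
     = p2 * r ^+ 2 - r * (xi * p1) + p2 * p1 ^+ 2 * V by ring.
  rewrite hB.
  transitivity (p2 * (r ^+ 2 - r * p3 * (xi + 2 * V)) * (p1 + p2 * p3) +
     p2 * p1 ^+ 2 * (V * (p1 + p2 * p3))); first by ring.
  have -> : xi + 2 * V = 1 - p2 ^+ 2 + V by rewrite dxi; ring.
  transitivity (p2 * (r ^+ 2 - r * p3 * (1 - p2 ^+ 2)) * (p1 + p2 * p3) +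
     p2 * (p1 ^+ 2 - r * p3) * (V * (p1 + p2 * p3))); first by ring.
  by rewrite hV dr; ring.
have h12 : t ^+ 2 * V * (1 - p2 ^+ 2) = V * (p1 ^+ 2 - p3 ^+ 2).
  have n0 : p1 - p2 * p3 != 0 by rewrite subr_eq0.
  apply: (mulfI n0).
  transitivity (t ^+ 2 * V * (V * (p1 + p2 * p3))); first by rewrite hV; ring.
  have -> : t ^+ 2 * V * (V * (p1 + p2 * p3)) = V * (t ^+ 2 * V * (p1 + p2 * p3)) by ring.
  by rewrite hU; ring.
have lt31 : p3 ^+ 2 < p1 ^+ 2.
  rewrite -subr_gt0 -(pmulr_rgt0 _ V0) -h12 (pmulr_lgt0 _ sV) (pmulr_lgt0 _ V0).
  by rewrite exprn_even_gt0.
have p3p : p2 ^+ 2 * p3 ^+ 2 <= p3 ^+ 2.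
  by apply: ler_piMl; rewrite ?sqr_ge0 // ltW // -subr_gt0.
have hsq : xi ^+ 2 * (p1 ^+ 2 - p2 ^+ 2 * p3 ^+ 2) =
           4 * p2 ^+ 2 * V * (p3 ^+ 2 * (1 - p2 ^+ 2)).
  have -> : xi ^+ 2 * (p1 ^+ 2 - p2 ^+ 2 * p3 ^+ 2) =
            (xi * p1) ^+ 2 - xi ^+ 2 * p2 ^+ 2 * p3 ^+ 2 by ring.
  by rewrite hB p2lt; ring.
have d0 : 0 < p1 ^+ 2 - p2 ^+ 2 * p3 ^+ 2.
  by rewrite subr_gt0 (le_lt_trans p3p).
have c0 : 0 < 4 * p2 ^+ 2 * V.
  by rewrite (pmulr_lgt0 _ V0) pmulr_rgt0 // exprn_even_gt0.
have : p1 ^+ 2 - p2 ^+ 2 * p3 ^+ 2 <= p3 ^+ 2 * (1 - p2 ^+ 2).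
  by rewrite -(ler_pM2l c0) -hsq ler_pM2r.
by move=> h; exfalso; lra.
Qed.
End Elim.

(** * Small index types *)

Definition i3_0 : 'I_3 := @Ordinal 3 0 isT.
Definition i3_1 : 'I_3 := @Ordinal 3 1 isT.
Definition i3_2 : 'I_3 := @Ordinal 3 2 isT.
Definition i4_0 : 'I_4 := @Ordinal 4 0 isT.
Definition i4_1 : 'I_4 := @Ordinal 4 1 isT.
Definition i4_2 : 'I_4 := @Ordinal 4 2 isT.
Definition i4_3 : 'I_4 := @Ordinal 4 3 isT.

Lemma all_ord3 (P : 'I_3 -> Prop) : P i3_0 -> P i3_1 -> P i3_2 -> forall i, P i.
Proof.
move=> h0 h1 h2 [[|[|[|i]]] hi] //.
- by rewrite (_ : Ordinal hi = i3_0) //; exact: val_inj.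
- by rewrite (_ : Ordinal hi = i3_1) //; exact: val_inj.
- by rewrite (_ : Ordinal hi = i3_2) //; exact: val_inj.
Qed.

Lemma all_ord4 (P : 'I_4 -> Prop) :
  P i4_0 -> P i4_1 -> P i4_2 -> P i4_3 -> forall i, P i.
Proof.
move=> h0 h1 h2 h3 [[|[|[|[|i]]]] hi] //.
- by rewrite (_ : Ordinal hi = i4_0) //; exact: val_inj.
- by rewrite (_ : Ordinal hi = i4_1) //; exact: val_inj.
- by rewrite (_ : Ordinal hi = i4_2) //; exact: val_inj.
- by rewrite (_ : Ordinal hi = i4_3) //; exact: val_inj.
Qed.

Lemma sum_ord3 (V : nmodType) (F : 'I_3 -> V) :
  \sum_(i < 3) F i = F i3_0 + F i3_1 + F i3_2.
Proof.
rewrite 3!big_ord_recl big_ord0 addr0 addrA.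
by congr (F _ + F _ + F _); apply: val_inj.
Qed.

Lemma sum_ord4 (V : nmodType) (F : 'I_4 -> V) :
  \sum_(i < 4) F i = F i4_0 + F i4_1 + F i4_2 + F i4_3.
Proof.
rewrite 4!big_ord_recl big_ord0 addr0 !addrA.
by congr (F _ + F _ + F _ + F _); apply: val_inj.
Qed.

(** * Rotations of three-space *)

Section Rot.
Variable R : rcfType.
Implicit Types a b c d s : R.

Definition mx3 (a00 a01 a02 a10 a11 a12 a20 a21 a22 : R) : 'M[R]_3 :=
  \matrix_(i, j) nth 0 (nth [::] [:: [:: a00; a01; a02]; [:: a10; a11; a12];
                                     [:: a20; a21; a22]] i) j.

Lemma mx3E a00 a01 a02 a10 a11 a12 a20 a21 a22 i j :
  mx3 a00 a01 a02 a10 a11 a12 a20 a21 a22 i j =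
  nth 0 (nth [::] [:: [:: a00; a01; a02]; [:: a10; a11; a12]; [:: a20; a21; a22]] i) j.
Proof. by rewrite mxE. Qed.

(** The rotation v |-> q v q^-1 of the imaginary quaternions, for q = a + b i + c j + d
    k. *)
Definition rot a b c d : 'M[R]_3 :=
  mx3 (a^+2 + b^+2 - c^+2 - d^+2) (2 * (b * c - a * d)) (2 * (b * d + a * c))
      (2 * (b * c + a * d)) (a^+2 - b^+2 + c^+2 - d^+2) (2 * (c * d - a * b))
      (2 * (b * d - a * c)) (2 * (c * d + a * b)) (a^+2 - b^+2 - c^+2 + d^+2).

(** Rotations are given by unit quaternions, because their lift to SO(4) is then given
    by quaternion multiplications. *)
Definition is_rot (U : 'M[R]_3) : Prop :=
  exists a b c d, a^+2 + b^+2 + c^+2 + d^+2 = 1 /\ U = rot a b c d.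

Lemma is_rotM U V : is_rot U -> is_rot V -> is_rot (U *m V).
Proof.
move=> [a [b [c [d [h ->]]]]] [a' [b' [c' [d' [h' ->]]]]].
exists (a * a' - b * b' - c * c' - d * d'), (a * b' + b * a' + c * d' - d * c'),
  (a * c' - b * d' + c * a' + d * b'), (a * d' + b * c' - c * b' + d * a').
split.
  transitivity ((a^+2 + b^+2 + c^+2 + d^+2) * (a'^+2 + b'^+2 + c'^+2 + d'^+2)).
    by ring.
  by rewrite h h' mulr1.
by apply/matrixP; apply: all_ord3; apply: all_ord3;
  rewrite !mxE sum_ord3 !mxE /=; ring.
Qed.

Lemma is_rotT U : is_rot U -> is_rot U^T.
Proof.
move=> [a [b [c [d [h ->]]]]]; exists a, (- b), (- c), (- d).
split; first by rewrite !sqrrN.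
by apply/matrixP; apply: all_ord3; apply: all_ord3; rewrite !mxE /=; ring.
Qed.

Lemma rot_mulT U : is_rot U -> U *m U^T = 1%:M.
Proof.
move=> [a [b [c [d [h ->]]]]].
have -> : 1%:M = ((a^+2 + b^+2 + c^+2 + d^+2) ^+ 2)%:M :> 'M[R]_3.
  by rewrite h expr1n.
by apply/matrixP; apply: all_ord3; apply: all_ord3;
  rewrite !mxE sum_ord3 !mxE /=; ring.
Qed.

Lemma rot_Tmul U : is_rot U -> U^T *m U = 1%:M.
Proof. by move=> /rot_mulT/mulmx1C. Qed.

Lemma is_rot1 : is_rot 1%:M.
Proof.
exists 1, 0, 0, 0; split; first by ring.
by apply/matrixP; apply: all_ord3; apply: all_ord3; rewrite !mxE /=; ring.
Qed.

(** A unit quaternion q <> -1 has the square root (1 + q) / |1 + q|, and -1 = i^2. Being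
    a square is what gives determinant 1 to the matrices attached to unit quaternions,
    by special_sqr. *)
Lemma quaternion_sqrt a b c d : a^+2 + b^+2 + c^+2 + d^+2 = 1 ->
  exists a' b' c' d', a'^+2 + b'^+2 + c'^+2 + d'^+2 = 1 /\
   [/\ a = a'^+2 - b'^+2 - c'^+2 - d'^+2, b = 2 * a' * b',
       c = 2 * a' * c' & d = 2 * a' * d'].
Proof.
move=> h.
have [a1|a1] := eqVneq a (-1).
  exists 0, 1, 0, 0; split; first by ring.
  move: h; rewrite a1 sqrrN expr1n -!addrA => /(canRL (addKr _)).
  rewrite addNr => /eqP; rewrite !paddr_eq0 ?addr_ge0 ?sqr_ge0 // !sqrf_eq0.
  by case/and3P => /eqP -> /eqP -> /eqP ->; split; ring.
have h1 : 0 < (1 + a) / 2.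
  have : a^+2 <= 1 by rewrite -h -!addrA lerDl !addr_ge0 ?sqr_ge0.
  move=> a2; have : -1 <= a by nra.
  by rewrite le_eqVlt eq_sym (negbTE a1) /= => ?; lra.
pose t := Num.sqrt ((1 + a) / 2).
have t2 : t ^+ 2 = (1 + a) / 2 by rewrite sqr_sqrtr // ltW.
have t0 : t != 0 by rewrite gt_eqF // sqrtr_gt0.
have s2 : (b / (2 * t)) ^+ 2 + (c / (2 * t)) ^+ 2 + (d / (2 * t)) ^+ 2 = (1 - a) / 2.
  have -> : (b / (2 * t)) ^+ 2 + (c / (2 * t)) ^+ 2 + (d / (2 * t)) ^+ 2
    = (b ^+ 2 + c ^+ 2 + d ^+ 2) / (4 * t ^+ 2) by field.
  have -> : b ^+ 2 + c ^+ 2 + d ^+ 2 = (1 - a) * (1 + a).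
    by transitivity (1 - a ^+ 2); [rewrite -[X in X - _]h|]; ring.
  by rewrite t2; field; move: h1; apply: contraTneq => h1; rewrite -leNgt; lra.
exists t, (b / (2 * t)), (c / (2 * t)), (d / (2 * t)).
split; first by rewrite -2!addrA [X in _ + X]addrA s2 t2; field.
split; [|by field|by field|by field].
by rewrite -2!addrA -!opprD addrA s2 t2; field.
Qed.

Lemma half_angle c s : c^+2 + s^+2 = 1 ->
  exists a b, [/\ a^+2 + b^+2 = 1, a^+2 - b^+2 = c & 2 * a * b = s].
Proof.
move=> h.
have hq : c ^+ 2 + s ^+ 2 + 0 ^+ 2 + 0 ^+ 2 = 1 by rewrite -h; ring.
have [a [b [c' [d' [e [e1 e2 /esym/eqP e3 /esym/eqP e4]]]]]] := quaternion_sqrt hq.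
have [a0|a0] := eqVneq a 0.
  exists 0, 1; split; [by ring| |by rewrite e2 a0; ring].
  by move: e; rewrite e1 a0 => e; lra.
move: e3 e4; rewrite !mulf_eq0 pnatr_eq0 (negbTE a0) /= => /eqP c0 /eqP d0.
by move: e e1; rewrite c0 d0 e2 => e e1; exists a, b; split=> //; lra.
Qed.

Definition rot_x c s := mx3 1 0 0  0 c (- s)  0 s c.
Definition rot_z c s := mx3 c (- s) 0  s c 0  0 0 1.
(** Cyclic permutations of the axes reduce statements about pairs of axes to one pair. *)
Definition cyc_rot := mx3 0 0 1  1 0 0  0 1 0.

Lemma is_rot_x c s : c^+2 + s^+2 = 1 -> is_rot (rot_x c s).
Proof.
move=> /half_angle [a [b [h <- <-]]]; exists a, b, 0, 0; split; first by rewrite -h; ring.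
apply/matrixP; apply: all_ord3; apply: all_ord3; rewrite !mxE /=; rewrite -?h; ring.
Qed.

Lemma is_rot_z c s : c^+2 + s^+2 = 1 -> is_rot (rot_z c s).
Proof.
move=> /half_angle [a [b [h <- <-]]]; exists a, 0, 0, b; split; first by rewrite -h; ring.
apply/matrixP; apply: all_ord3; apply: all_ord3; rewrite !mxE /=; rewrite -?h; ring.
Qed.

Lemma is_rot_cyc_rot : is_rot cyc_rot.
Proof.
exists (1/2), (1/2), (1/2), (1/2); split; first by field.
by apply/matrixP; apply: all_ord3; apply: all_ord3; rewrite !mxE /=; field.
Qed.

Lemma plane_rot_kill y z : exists c s, c^+2 + s^+2 = 1 /\ s * y + c * z = 0.
Proof.
have [e|ne] := eqVneq (y ^+ 2 + z ^+ 2) 0.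
  move/eqP: e; rewrite paddr_eq0 ?sqr_ge0 // !sqrf_eq0 => /andP[/eqP -> /eqP ->].
  by exists 1, 0; split; ring.
have n0 : 0 <= y ^+ 2 + z ^+ 2 by rewrite addr_ge0 ?sqr_ge0.
have r0 : Num.sqrt (y ^+ 2 + z ^+ 2) != 0 by rewrite sqrtr_eq0 -ltNge lt_neqAle eq_sym ne.
exists (y / Num.sqrt (y ^+ 2 + z ^+ 2)), (- z / Num.sqrt (y ^+ 2 + z ^+ 2)).
by split; [rewrite !expr_div_n sqr_sqrtr //; field|field].
Qed.

Lemma diag3P (A : 'M[R]_3) :
  [/\ A i3_0 i3_1 = 0, A i3_0 i3_2 = 0 & A i3_1 i3_2 = 0] ->
  [/\ A i3_1 i3_0 = 0, A i3_2 i3_0 = 0 & A i3_2 i3_1 = 0] -> is_diag_mx A.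
Proof.
move=> [h1 h2 h3] [h4 h5 h6]; apply/is_diag_mxP.
by apply: all_ord3; apply: all_ord3.
Qed.

Lemma sym_diag3P (A : 'M[R]_3) : A^T = A ->
  A i3_0 i3_1 = 0 -> A i3_0 i3_2 = 0 -> A i3_1 i3_2 = 0 -> is_diag_mx A.
Proof.
move=> sA h1 h2 h3; apply: diag3P; split=> //; rewrite -sA mxE //.
Qed.

Lemma conj_sym n (U A : 'M[R]_n) : A^T = A -> (U *m A *m U^T)^T = U *m A *m U^T.
Proof. by move=> sA; rewrite !trmx_mul trmxK sA mulmxA. Qed.

(** Two plane rotations in turn cancel the third and the second coordinate. *)
Lemma rot_to_axis (v : 'cV[R]_3) :
  exists U, [/\ is_rot U, (U *m v) i3_1 0 = 0 & (U *m v) i3_2 0 = 0].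
Proof.
have [c [s [h1 e1]]] := plane_rot_kill (v i3_1 0) (v i3_2 0).
have [c' [s' [h2 e2]]] := plane_rot_kill (v i3_0 0) (c * v i3_1 0 - s * v i3_2 0).
exists (rot_z c' s' *m rot_x c s).
split; first by apply: is_rotM; [exact: is_rot_z|exact: is_rot_x].
- by rewrite -mulmxA !mxE !sum_ord3 !mxE !sum_ord3 !mxE /= -[RHS]e2; ring.
- by rewrite -mulmxA !mxE !sum_ord3 !mxE !sum_ord3 !mxE /= -[RHS]e1; ring.
Qed.

(** The off-diagonal entry of the rotated 2 x 2 block is a linear form in the cosine and
    the sine of twice the angle. *)
Lemma sym_block_diag (A : 'M[R]_3) : A^T = A -> A i3_0 i3_1 = 0 -> A i3_0 i3_2 = 0 ->
  exists c s, c^+2 + s^+2 = 1 /\ is_diag_mx (rot_x c s *m A *m (rot_x c s)^T).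
Proof.
move=> sA h1 h2.
have [C [S [h e]]] := plane_rot_kill ((A i3_1 i3_1 - A i3_2 i3_2) / 2) (A i3_1 i3_2).
have [c [s [h' eC eS]]] := half_angle h.
exists c, s; split=> //; have h21 : A i3_2 i3_1 = A i3_1 i3_2 by rewrite -{1}sA mxE.
apply: sym_diag3P; first exact: conj_sym;
  rewrite !mxE !sum_ord3 !mxE !sum_ord3 !mxE /= ?h1 ?h2 ?h21; first by ring.
  by ring.
by rewrite -[RHS]e -eC -eS; field.
Qed.

(** A real eigenvalue exists because the characteristic polynomial has odd degree;
    turning its eigenvector to the first axis leaves a symmetric 2 x 2 block. *)
Lemma spectral3 (A : 'M[R]_3) : A^T = A ->
  exists2 U, is_rot U & is_diag_mx (U *m A *m U^T).
Proof.
move=> sA.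
have [l] : {x | root (char_poly A) x}.
  by apply: polyrcf.odd_poly_root; rewrite size_char_poly.
rewrite -eigenvalue_root_char => /eigenvalueP[v vA v0].
have [U [rU U1 U2]] := rot_to_axis v^T.
set w := U *m v^T in U1 U2.
have wA : w^T *m (U *m A *m U^T) = l *: w^T.
  rewrite /w trmx_mul trmxK -!mulmxA (mulmxA U^T) (rot_Tmul rU) mul1mx.
  by rewrite mulmxA vA scalemxAl.
have w0 : w i3_0 0 != 0.
  apply: contra v0 => /eqP w0; have : w = 0.
    by apply/matrixP => i j; rewrite ord1 [RHS]mxE; move: i; apply: all_ord3.
  move=> w00; have : v^T = 0.
    by rewrite -[v^T]mul1mx -(rot_Tmul rU) -mulmxA -/w w00 mulmx0.
  by move=> /(congr1 trmx); rewrite trmxK trmx0 => ->.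
have sA' := conj_sym U sA.
set A' := U *m A *m U^T in wA sA'.
have ent j : w i3_0 0 * A' i3_0 j = l * w j 0.
  have := congr1 (fun M : 'rV[R]_3 => M 0 j) wA.
  by rewrite [LHS]mxE sum_ord3 [RHS]mxE ![w^T _ _]mxE U1 U2 !mul0r !addr0.
have h1 : A' i3_0 i3_1 = 0 by apply: (mulfI w0); rewrite ent U1 !mulr0.
have h2 : A' i3_0 i3_2 = 0 by apply: (mulfI w0); rewrite ent U2 !mulr0.
have [c [s [h d]]] := sym_block_diag sA' h1 h2.
exists (rot_x c s *m U); first by apply: is_rotM => //; exact: is_rot_x.
by rewrite trmx_mul !mulmxA -(mulmxA (rot_x c s) U) -(mulmxA (rot_x c s)).
Qed.

Lemma cyc_conjE (A : 'M[R]_3) : 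
  cyc_rot *m A *m cyc_rot^T = mx3 (A i3_2 i3_2) (A i3_2 i3_0) (A i3_2 i3_1)
    (A i3_0 i3_2) (A i3_0 i3_0) (A i3_0 i3_1) (A i3_1 i3_2) (A i3_1 i3_0) (A i3_1 i3_1).
Proof.
by apply/matrixP; apply: all_ord3; apply: all_ord3;
  rewrite !mxE !sum_ord3 !mxE !sum_ord3 !mxE /=; ring.
Qed.

Lemma cyc_conj_diag (A : 'M[R]_3) : 
  is_diag_mx (cyc_rot *m A *m cyc_rot^T) = is_diag_mx A.
Proof.
rewrite cyc_conjE; apply/is_diag_mxP/is_diag_mxP => h.
- apply: all_ord3; apply: all_ord3 => //= _.
  + by have := h i3_1 i3_2 isT; rewrite mxE.
  + by have := h i3_1 i3_0 isT; rewrite mxE.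
  + by have := h i3_2 i3_1 isT; rewrite mxE.
  + by have := h i3_2 i3_0 isT; rewrite mxE.
  + by have := h i3_0 i3_1 isT; rewrite mxE.
  + by have := h i3_0 i3_2 isT; rewrite mxE.
- by apply: all_ord3; apply: all_ord3 => //= _; rewrite mxE /= h.
Qed.

Definition row_diagonalizable (M : 'M[R]_3) :=
  exists2 U, is_rot U & is_diag_mx (U *m M).

Lemma cyc_row_diagonalizable M :
  row_diagonalizable (cyc_rot *m M *m cyc_rot^T) -> row_diagonalizable M.
Proof.
move=> [U rU dU]; have rC := is_rot_cyc_rot.
exists (cyc_rot^T *m U *m cyc_rot).
  by apply: is_rotM => //; apply: is_rotM => //; exact: is_rotT.
by move: dU; rewrite -[in X in _ -> X]cyc_conj_diag !mulmxA (rot_mulT rC) mul1mx.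
Qed.

Lemma rot_gram U (M : 'M[R]_3) : is_rot U -> (U *m M)^T *m (U *m M) = M^T *m M.
Proof.
by move=> rU; rewrite trmx_mul -mulmxA (mulmxA U^T) (rot_Tmul rU) mul1mx.
Qed.

(** Once the first column is on the first axis, orthogonality of the columns clears the
    rest of the first row. *)
Lemma orth_cols_block (M : 'M[R]_3) : is_diag_mx (M^T *m M) ->
  M i3_0 i3_0 != 0 -> M i3_1 i3_0 = 0 -> M i3_2 i3_0 = 0 -> row_diagonalizable M.
Proof.
move=> /is_diag_mxP d m0 m1 m2.
have m01 : M i3_0 i3_1 = 0.
  apply: (mulfI m0); rewrite mulr0 -(d i3_0 i3_1 isT) !mxE sum_ord3 !mxE m1 m2.
  by ring.
have m02 : M i3_0 i3_2 = 0.
  apply: (mulfI m0); rewrite mulr0 -(d i3_0 i3_2 isT) !mxE sum_ord3 !mxE m1 m2.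
  by ring.
have := d i3_1 i3_2 isT; rewrite !mxE sum_ord3 !mxE m01 m02 mul0r add0r => m12.
have [e|ne] := eqVneq (M i3_1 i3_1 ^+ 2 + M i3_2 i3_1 ^+ 2) 0.
  move/eqP: e; rewrite paddr_eq0 ?sqr_ge0 // !sqrf_eq0 => /andP[/eqP e1 /eqP e2].
  have [c [s [h e]]] := plane_rot_kill (- M i3_2 i3_2) (M i3_1 i3_2).
  exists (rot_x c s); first exact: is_rot_x.
  apply: diag3P; split; rewrite !mxE sum_ord3 !mxE /= ?m01 ?m02 ?m1 ?m2 ?e1 ?e2;
    try ring.
  by rewrite -[RHS]e; ring.
have [c [s [h e]]] := plane_rot_kill (M i3_1 i3_1) (M i3_2 i3_1).
exists (rot_x c s); first exact: is_rot_x.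
have n0 : c * M i3_1 i3_1 - s * M i3_2 i3_1 != 0.
  apply: contra ne => /eqP e'; apply/eqP.
  transitivity ((c * M i3_1 i3_1 - s * M i3_2 i3_1) ^+ 2 + (s * M i3_1 i3_1 + c * M i3_2 i3_1) ^+ 2).
    by rewrite -[LHS]mul1r -h; ring.
  by rewrite e e'; ring.
apply: diag3P; split; rewrite !mxE sum_ord3 !mxE /= ?m01 ?m02 ?m1 ?m2;
  try ring.
- apply: (mulfI n0); rewrite mulr0.
  transitivity ((c ^+ 2 + s ^+ 2) * (M i3_1 i3_1 * M i3_1 i3_2 + M i3_2 i3_1 * M i3_2 i3_2)
    - (s * M i3_1 i3_1 + c * M i3_2 i3_1) * (s * M i3_1 i3_2 + c * M i3_2 i3_2)); first by ring.
  by rewrite m12 e; ring.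
- by rewrite -[RHS]e; ring.
Qed.

Lemma orth_cols_first (M : 'M[R]_3) : is_diag_mx (M^T *m M) ->
  col i3_0 M != 0 -> row_diagonalizable M.
Proof.
move=> d m0; have [U [rU U1 U2]] := rot_to_axis (col i3_0 M).
have cE : U *m col i3_0 M = col i3_0 (U *m M) by rewrite !colE mulmxA.
rewrite cE ![col _ _ _ _]mxE in U1 U2.
have [||||V rV dV] := @orth_cols_block (U *m M).
- by rewrite rot_gram.
- apply: contra m0 => /eqP U0; apply/eqP.
  rewrite -[col _ _]mul1mx -(rot_Tmul rU) -mulmxA cE.
  rewrite (_ : col _ _ = 0) ?mulmx0 //; apply/matrixP => i j.
  by rewrite [LHS]mxE [RHS]mxE; move: i; apply: all_ord3.
- by [].
- by [].
exists (V *m U); first exact: is_rotM.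
by rewrite -mulmxA.
Qed.

(** Only a non-zero column can be used as a pivot, hence the cyclic conjugations. *)
Lemma orth_cols_diag (M : 'M[R]_3) : is_diag_mx (M^T *m M) -> row_diagonalizable M.
Proof.
have conj_gram N : (cyc_rot *m N *m cyc_rot^T)^T *m (cyc_rot *m N *m cyc_rot^T) =
    cyc_rot *m (N^T *m N) *m cyc_rot^T.
  rewrite !trmx_mul trmxK -!mulmxA (mulmxA cyc_rot^T) (rot_Tmul is_rot_cyc_rot) mul1mx.
  by [].
have conj_diag N : is_diag_mx (N^T *m N) ->
    is_diag_mx ((cyc_rot *m N *m cyc_rot^T)^T *m (cyc_rot *m N *m cyc_rot^T)).
  by rewrite conj_gram cyc_conj_diag.
move=> d.
have [e0|n0] := eqVneq (col i3_0 M) 0; last exact: orth_cols_first.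
have [e2|n2] := eqVneq (col i3_2 M) 0; last first.
  apply: cyc_row_diagonalizable; apply: orth_cols_first; first exact: conj_diag.
  apply: contra n2; rewrite cyc_conjE => /eqP/matrixP h; apply/eqP/matrixP => i j.
  have := (h i3_0 0, h i3_1 0, h i3_2 0); rewrite !mxE /= => -[[h0 h1] h2].
  by move: i; apply: all_ord3.
have [e1|n1] := eqVneq (col i3_1 M) 0; last first.
  apply: cyc_row_diagonalizable; apply: cyc_row_diagonalizable.
  apply: orth_cols_first; first exact: (conj_diag _ (conj_diag _ d)).
  apply: contra n1; rewrite !cyc_conjE => /eqP/matrixP h; apply/eqP/matrixP => i j.
  have := (h i3_0 0, h i3_1 0, h i3_2 0); rewrite !mxE /= => -[[h0 h1] h2].
  by move: i; apply: all_ord3.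
exists 1%:M; first exact: is_rot1.
rewrite mul1mx (_ : M = 0) ?mx0_is_diag //; apply/matrixP => i j.
rewrite [RHS]mxE.
move: e0 e1 e2 => /matrixP e0 /matrixP e1 /matrixP e2.
have := (e0 i 0, e1 i 0, e2 i 0); rewrite !mxE => -[[h0 h1] h2].
by move: j; apply: all_ord3.
Qed.

(** If T has no entry between different eigenspaces of S, whichever orthonormal
    eigenbasis of S is used, then T can be diagonalised inside the eigenspaces of S. *)
Lemma simultaneous_diag3 (S T : 'M[R]_3) : S^T = S -> T^T = T ->
  (forall U, is_rot U -> is_diag_mx (U *m S *m U^T) ->
     forall i j, (U *m S *m U^T) i i != (U *m S *m U^T) j j ->
       (U *m T *m U^T) i j = 0) ->
  exists U, [/\ is_rot U, is_diag_mx (U *m S *m U^T) & is_diag_mx (U *m T *m U^T)].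
Proof.
have conjM U V (A : 'M[R]_3) :
    U *m (V *m A *m V^T) *m U^T = (U *m V) *m A *m (U *m V)^T.
  by rewrite trmx_mul !mulmxA.
(* When the last two eigenvalues of S coincide, a rotation of that plane leaves S
   diagonal and is free to diagonalise T; if all three coincide, S is scalar. *)
have base S' T' : S'^T = S' -> T'^T = T' -> is_diag_mx S' ->
   (forall i j, S' i i != S' j j -> T' i j = 0) -> S' i3_1 i3_1 = S' i3_2 i3_2 ->
   exists U, [/\ is_rot U, is_diag_mx (U *m S' *m U^T) & is_diag_mx (U *m T' *m U^T)].
  move=> sS sT dS hT e12.
  have [e01|n01] := eqVneq (S' i3_0 i3_0) (S' i3_1 i3_1).
    have [U rU dU] := spectral3 sT; exists U; split=> //.
    have -> : S' = (S' i3_0 i3_0)%:M.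
      apply/matrixP => i j; rewrite [RHS]mxE; have /is_diag_mxP d := dS.
      have [<-|ne] := eqVneq i j; last by rewrite d.
      by rewrite mulr1n; move: i; apply: all_ord3; rewrite // -?e12 e01.
    by rewrite mul_mx_scalar -scalemxAl (rot_mulT rU) scalemx1 scalar_mx_is_diag.
  have n02 : S' i3_0 i3_0 != S' i3_2 i3_2 by rewrite -e12.
  have [c [s [h d]]] := sym_block_diag sT (hT _ _ n01) (hT _ _ n02).
  exists (rot_x c s); split=> //; first exact: is_rot_x.
  have /is_diag_mxP dd := dS.
  apply: sym_diag3P; first exact: conj_sym;
    rewrite !mxE !sum_ord3 !mxE !sum_ord3 !mxE /= ?(dd i3_0 i3_1) ?(dd i3_0 i3_2)
     ?(dd i3_1 i3_2) ?(dd i3_2 i3_1) ?e12 //; by ring.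
move=> sS sT H.
have [U rU dU] := spectral3 sS.
have hU := H U rU dU.
have step V : is_rot V -> is_diag_mx (V *m (U *m S *m U^T) *m V^T) ->
    (V *m (U *m S *m U^T) *m V^T) i3_1 i3_1 = (V *m (U *m S *m U^T) *m V^T) i3_2 i3_2 ->
    exists U, [/\ is_rot U, is_diag_mx (U *m S *m U^T) & is_diag_mx (U *m T *m U^T)].
  rewrite conjM => rV dV eV; have rVU := is_rotM rV rU.
  have [W [rW d1 d2]] := base _ _ (conj_sym _ sS) (conj_sym _ sT) dV (H _ rVU dV) eV.
  exists (W *m (V *m U)).
  by rewrite conjM in d1; rewrite conjM in d2; split=> //; exact: (is_rotM rW rVU).
have [e12|n12] := eqVneq ((U *m S *m U^T) i3_1 i3_1) ((U *m S *m U^T) i3_2 i3_2).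
  by apply: (step 1%:M); rewrite ?trmx1 ?mul1mx ?mulmx1 //; exact: is_rot1.
have [e01|n01] := eqVneq ((U *m S *m U^T) i3_0 i3_0) ((U *m S *m U^T) i3_1 i3_1).
  apply: (step cyc_rot); rewrite ?cyc_conj_diag //; first exact: is_rot_cyc_rot.
  by rewrite cyc_conjE [LHS]mxE [RHS]mxE.
have [e02|n02] := eqVneq ((U *m S *m U^T) i3_0 i3_0) ((U *m S *m U^T) i3_2 i3_2).
  apply: (step (cyc_rot *m cyc_rot)); rewrite -?conjM ?cyc_conj_diag ?cyc_conj_diag //.
    by apply: is_rotM; exact: is_rot_cyc_rot.
  by rewrite !cyc_conjE [LHS]mxE [RHS]mxE /= [LHS]mxE [RHS]mxE.
exists U; split=> //.
by apply: sym_diag3P; rewrite ?hU //; exact: conj_sym.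
Qed.

End Rot.

(** * The rank condition *)

Section Gram.
Variable R : rcfType.

Lemma gram_eq0 m n (X : 'M[R]_(m, n)) : X *m X^T = 0 -> X = 0.
Proof.
move=> h; apply/matrixP => i j; rewrite [RHS]mxE.
have := congr1 (fun M : 'M[R]_m => M i i) h; rewrite !mxE => /eqP.
rewrite psumr_eq0 => [/allP/(_ j)|k _]; last by rewrite !mxE -expr2 sqr_ge0.
by rewrite mem_index_enum !mxE -expr2 sqrf_eq0 => /(_ isT)/eqP.
Qed.

(** If the rows of U and V are orthogonal to those of A, they lie in a space of
    dimension n, so the 2n x 2n Gram matrix of U and V has rank at most n. With Z' in
    the role of D Z^-1, this is the vanishing of its Schur complement. In the singular
    case D = 0 the formula still holds because Z' U = 0. *)
Lemma schur_rank n (A U V : 'M[R]_(n, n + n)) (Z Z' : 'M[R]_n) D :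
  A *m A^T = 1%:M -> U *m A^T = 0 -> V *m A^T = 0 -> U *m U^T = Z ->
  Z'^T = Z' -> Z *m Z' = D%:M ->
  (V *m U^T) *m Z' *m (U *m V^T) = D *: (V *m V^T).
Proof.
move=> AA UA VA dZ sZ ZZ.
have AU : A *m U^T = 0 by rewrite -[A]trmxK -trmx_mul UA trmx0.
have [D0|D0] := eqVneq D 0.
  have : Z' *m U = 0.
    apply: gram_eq0; rewrite trmx_mul sZ -mulmxA (mulmxA U) dZ ZZ D0.
    by rewrite raddf0 mulmx0.
  move=> /(congr1 trmx); rewrite trmx_mul sZ trmx0 => h.
  by rewrite -!mulmxA (mulmxA U^T) h mul0mx mulmx0 D0 scale0r.
pose M := col_mx A U.
have MM : M *m (row_mx A^T (D^-1 *: (U^T *m Z'))) = 1%:M.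
  rewrite mul_col_row AA UA -!scalemxAr mulmxA AU mul0mx scaler0 mulmxA dZ ZZ.
  by rewrite scale_scalar_mx mulVf // -scalar_mx_block.
have M1 := mulmx1C MM.
have Ve : V = V *m (D^-1 *: (U^T *m Z')) *m U.
  rewrite -{1}[V]mulmx1 -M1 mul_row_col mulmxDr mulmxA VA mul0mx add0r.
  by rewrite mulmxA.
rewrite {3}Ve -!scalemxAr -!scalemxAl scalerA divff // scale1r.
by rewrite !mulmxA.
Qed.

End Gram.

(** * The double cover of SO(3) x SO(3) by SO(4) *)

Section Quat.
Variable R : rcfType.
Implicit Types a b c d : R.

Definition mx4 (rows : seq (seq R)) : 'M[R]_4 :=
  \matrix_(i, j) nth 0 (nth [::] rows i) j.

(** Left multiplication by a unit quaternion: it rotates the self-dual part only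
    (qL_skew). *)
Definition qL a b c d := mx4 [:: [:: a; -b; -c; -d]; [:: b; a; -d; c];
                                 [:: c; d; a; -b]; [:: d; -c; b; a]].
(** The counterpart of qL, rotating the anti-self-dual part only (qR_skew). *)
Definition qR a b c d := mx4 [:: [:: a; b; c; d]; [:: -b; a; -d; c];
                                 [:: -c; d; a; -b]; [:: -d; -c; b; a]].

(** Coordinates of the self-dual part of a skew matrix along L_1 = E12 + E34, L_2 = E13
    + E42, L_3 = E14 + E23, where Eij is the elementary skew matrix. *)
Definition sd (B : 'M[R]_4) : 'cV[R]_3 :=
  \col_i nth 0 [:: (B i4_0 i4_1 + B i4_2 i4_3) / 2; (B i4_0 i4_2 + B i4_3 i4_1) / 2;
                   (B i4_0 i4_3 + B i4_1 i4_2) / 2] i.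
(** Coordinates of the anti-self-dual part along R_1 = E12 - E34, R_2 = E13 - E42, R_3 =
    E14 - E23. The L_a commute with the R_b. *)
Definition asd (B : 'M[R]_4) : 'cV[R]_3 :=
  \col_i nth 0 [:: (B i4_0 i4_1 - B i4_2 i4_3) / 2; (B i4_0 i4_2 - B i4_3 i4_1) / 2;
                   (B i4_0 i4_3 - B i4_1 i4_2) / 2] i.

Definition skew (p q : 'cV[R]_3) : 'M[R]_4 :=
  let p0 := p i3_0 0 in let p1 := p i3_1 0 in let p2 := p i3_2 0 in
  let q0 := q i3_0 0 in let q1 := q i3_1 0 in let q2 := q i3_2 0 in
  mx4 [:: [:: 0; p0 + q0; p1 + q1; p2 + q2];
          [:: - (p0 + q0); 0; p2 - q2; q1 - p1];
          [:: - (p1 + q1); q2 - p2; 0; p0 - q0];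
          [:: - (p2 + q2); p1 - q1; q0 - p0; 0]].

Lemma skewE (B : 'M[R]_4) : B^T = - B -> B = skew (sd B) (asd B).
Proof.
move=> h; have e i j : B j i = - B i j.
  by have := congr1 (fun M : 'M[R]_4 => M i j) h; rewrite !mxE.
have z i : B i i = 0 by have := e i i => ?; lra.
have := (e i4_0 i4_1, e i4_0 i4_2, e i4_0 i4_3, e i4_1 i4_2, e i4_1 i4_3, e i4_2 i4_3,
  z i4_0, z i4_1, z i4_2, z i4_3).
move=> [[[[[[[[[e1 e2] e3] e4] e5] e6] z1] z2] z3] z4].
by apply/matrixP; apply: all_ord4; apply: all_ord4; rewrite !mxE /=; 
  rewrite ?e1 ?e2 ?e3 ?e4 ?e5 ?e6 ?z1 ?z2 ?z3 ?z4; field.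
Qed.

Lemma qL_skew a b c d p q : qL a b c d *m skew p q *m (qL a b c d)^T =
  skew (rot a b c d *m p) ((a^+2 + b^+2 + c^+2 + d^+2) *: q).
Proof.
apply/matrixP; apply: all_ord4; apply: all_ord4;
by rewrite !mxE !sum_ord4 !mxE !sum_ord4 !mxE /= ?sum_ord3 ?mxE /=; ring.
Qed.

Lemma qR_skew a b c d p q : qR a b c d *m skew p q *m (qR a b c d)^T =
  skew ((a^+2 + b^+2 + c^+2 + d^+2) *: p) (rot a b c d *m q).
Proof.
apply/matrixP; apply: all_ord4; apply: all_ord4;
by rewrite !mxE !sum_ord4 !mxE !sum_ord4 !mxE /= ?sum_ord3 ?mxE /=; ring.
Qed.

Lemma sd_skew p q : sd (skew p q) = p.
Proof.
by apply/matrixP => i j; rewrite ord1; move: i; apply: all_ord3; rewrite !mxE /=; field.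
Qed.

Lemma asd_skew p q : asd (skew p q) = q.
Proof.
by apply/matrixP => i j; rewrite ord1; move: i; apply: all_ord3; rewrite !mxE /=; field.
Qed.

Definition special (n : nat) (h : 'M[R]_n) := h *m h^T = 1%:M /\ \det h = 1.

Lemma special_sqr n (h : 'M[R]_n) : h *m h^T = 1%:M -> special (h *m h).
Proof.
move=> hh; split; first by rewrite trmx_mul mulmxA -(mulmxA h h) hh mulmx1.
by rewrite det_mulmx -[X in _ * X]det_tr -det_mulmx hh det1.
Qed.

Lemma special_mul n (g h : 'M[R]_n) : special g -> special h -> special (g *m h).
Proof.
move=> [g1 g2] [h1 h2]; split; last by rewrite det_mulmx g2 h2 mulr1.
by rewrite trmx_mul mulmxA -(mulmxA g h) h1 mulmx1.
Qed.

Lemma special_rot U : is_rot U -> special U.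
Proof.
move=> rU; split; first exact: rot_mulT.
case: rU => a [b [c [d [h ->]]]].
have [a' [b' [c' [d' [h' [-> -> -> ->]]]]]] := quaternion_sqrt h.
have rV : is_rot (rot a' b' c' d') by exists a', b', c', d'.
rewrite (_ : rot _ _ _ _ = rot a' b' c' d' *m rot a' b' c' d').
  by have [] := special_sqr (rot_mulT rV).
by apply/matrixP; apply: all_ord3; apply: all_ord3;
  rewrite !mxE sum_ord3 !mxE /=; ring.
Qed.

Lemma special_qL a b c d : a^+2 + b^+2 + c^+2 + d^+2 = 1 -> special (qL a b c d).
Proof.
move=> h; have [a' [b' [c' [d' [h' [-> -> -> ->]]]]]] := quaternion_sqrt h.
rewrite (_ : qL _ _ _ _ = qL a' b' c' d' *m qL a' b' c' d').
  apply: special_sqr; rewrite -h'.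
  by apply/matrixP; apply: all_ord4; apply: all_ord4;
    rewrite !mxE sum_ord4 !mxE /=; ring.
by apply/matrixP; apply: all_ord4; apply: all_ord4;
  rewrite !mxE sum_ord4 !mxE /=; ring.
Qed.

Lemma special_qR a b c d : a^+2 + b^+2 + c^+2 + d^+2 = 1 -> special (qR a b c d).
Proof.
move=> h; have [a' [b' [c' [d' [h' [-> -> -> ->]]]]]] := quaternion_sqrt h.
rewrite (_ : qR _ _ _ _ = qR a' b' c' d' *m qR a' b' c' d').
  apply: special_sqr; rewrite -h'.
  by apply/matrixP; apply: all_ord4; apply: all_ord4;
    rewrite !mxE sum_ord4 !mxE /=; ring.
by apply/matrixP; apply: all_ord4; apply: all_ord4;
  rewrite !mxE sum_ord4 !mxE /=; ring.
Qed.

(** Surjectivity of SO(4) -> SO(3) x SO(3), on the rotations given by quaternions. *)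
Lemma rot_pair_lift U V : is_rot U -> is_rot V ->
  exists2 h, special h & forall B : 'M[R]_4, B^T = - B ->
    sd (h *m B *m h^T) = U *m sd B /\ asd (h *m B *m h^T) = V *m asd B.
Proof.
move=> [a [b [c [d [h ->]]]]] [a' [b' [c' [d' [h' ->]]]]].
exists (qL a b c d *m qR a' b' c' d').
  by apply: special_mul; [exact: special_qL|exact: special_qR].
move=> B /skewE eB.
have -> : qL a b c d *m qR a' b' c' d' *m B *m (qL a b c d *m qR a' b' c' d')^T =
  skew (rot a b c d *m sd B) (rot a' b' c' d' *m asd B).
  rewrite trmx_mul !mulmxA -(mulmxA _ _ B) -(mulmxA (qL _ _ _ _)) {1}eB.
  by rewrite qR_skew h' scale1r qL_skew h scale1r.
by rewrite sd_skew asd_skew.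
Qed.
End Quat.

(** * Orthogonal triples *)

Section Triples.
Variable R : rcfType.
Notation triple := ('I_3 -> 'M[R]_(4, 8)).
Implicit Type T : triple.

Definition orthogonal_triple T :=
  forall i j, T i *m (T j)^T + T j *m (T i)^T = ((i == j)%:R *+ 2)%:M.

(** The index k stands for the axis e_k = e_i x e_j: with this cyclic convention the
    three matrices transform like a vector (wedge_source_change). *)
Definition wedge T (k : 'I_3) : 'M[R]_4 :=
  nth 0 [:: T i3_1 *m (T i3_2)^T; T i3_2 *m (T i3_0)^T; T i3_0 *m (T i3_1)^T] k.

(** The matrices P and Q. *)
Definition sd_mx T : 'M[R]_3 := \matrix_(m, k) sd (wedge T k) m 0.
Definition asd_mx T : 'M[R]_3 := \matrix_(m, k) asd (wedge T k) m 0.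

Definition source_change (U : 'M[R]_3) T : triple := fun i => \sum_j U i j *: T j.
Definition fibre_change (h : 'M[R]_4) T : triple := fun i => h *m T i.

Lemma triple_anti T i j : orthogonal_triple T -> i != j ->
  T j *m (T i)^T = - (T i *m (T j)^T).
Proof.
move=> oT /negbTE ij; have := oT i j; rewrite ij mul0rn raddf0 => /eqP.
by rewrite addrC addr_eq0 => /eqP.
Qed.

Lemma triple_unit T i : orthogonal_triple T -> T i *m (T i)^T = 1%:M.
Proof.
move=> oT; have := oT i i; rewrite eqxx /= => /matrixP h.
apply/matrixP => k l; have := h k l; rewrite [X in X = _]mxE [X in _ = X]mxE => e.
rewrite [RHS]mxE; move: e; rewrite -[(T i *m _) k l]/((_ : R)).
pose X :=  (T i *m (T i)^T) k l : R.
by case: (k == l); rewrite ?mulr1n ?mulr0n => e; lra.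
Qed.

Lemma wedge_skew T k : orthogonal_triple T -> (wedge T k)^T = - wedge T k.
Proof.
move=> oT; move: k; apply: all_ord3; rewrite /wedge /= trmx_mul trmxK;
  exact: triple_anti.
Qed.

Lemma orthogonal_fibre_change h T : special h -> orthogonal_triple T ->
  orthogonal_triple (fibre_change h T).
Proof.
move=> [hh _] oT i j; rewrite /fibre_change !trmx_mul !mulmxA -(mulmxA h (T i)) -(mulmxA h (T j)).
by rewrite -mulmxDl -mulmxDr oT mul_mx_scalar -scalemxAl hh scalemx1.
Qed.

Lemma wedge_fibre_change h T k : wedge (fibre_change h T) k = h *m wedge T k *m h^T.
Proof.
by move: k; apply: all_ord3; rewrite /wedge /fibre_change /= trmx_mul !mulmxA.
Qed.

Lemma rot_rows_orthonormal (U : 'M[R]_3) i j : is_rot U -> \sum_k U i k * U j k = (i == j)%:R.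
Proof.
move=> rU; have := congr1 (fun M : 'M[R]_3 => M i j) (rot_mulT rU).
by rewrite !mxE => <-; apply: eq_bigr => l _; rewrite mxE.
Qed.

Lemma source_change_gram U T i j : orthogonal_triple T ->
  source_change U T i *m (source_change U T j)^T =
   (\sum_k U i k * U j k)%:M
   + (U i i3_1 * U j i3_2 - U i i3_2 * U j i3_1) *: wedge T i3_0
   + (U i i3_2 * U j i3_0 - U i i3_0 * U j i3_2) *: wedge T i3_1
   + (U i i3_0 * U j i3_1 - U i i3_1 * U j i3_0) *: wedge T i3_2.
Proof.
move=> oT; rewrite /source_change !sum_ord3.
have trD (A B : 'M[R]_(4, 8)) : (A + B)^T = A^T + B^T by rewrite linearD.
have trZ c (A : 'M[R]_(4, 8)) : (c *: A)^T = c *: A^T by rewrite linearZ.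
rewrite !trD !trZ !mulmxDl !mulmxDr -!scalemxAr -!scalemxAl !(triple_unit _ oT).
rewrite (@triple_anti _ i3_0 i3_1) // (@triple_anti _ i3_1 i3_2) //.
rewrite (@triple_anti _ i3_2 i3_0) // /wedge /=.
set X := T i3_0 *m _; set Y := T i3_1 *m _; set Z := T i3_2 *m _.
apply/matrixP => x y; rewrite !mxE; case: (x == y);
  rewrite ?mulr1n ?mulr0n; ring.
Qed.

Lemma orthogonal_source_change U T : is_rot U -> orthogonal_triple T ->
  orthogonal_triple (source_change U T).
Proof.
move=> rU oT i j; rewrite !source_change_gram // !rot_rows_orthonormal // [j == i]eq_sym.
apply/matrixP => x y; rewrite !mxE; case: (x == y); case: (i == j);
  rewrite ?mulr1n ?mulr0n; ring.
Qed.

(** The 2 x 2 minors of the homogeneous quaternionic formula are |q|^2 times its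
    entries. *)
Lemma rot_cofactor (U : 'M[R]_3) : is_rot U -> forall i j, U i j =
  nth 0 (nth [::] [:: 
   [:: U i3_1 i3_1 * U i3_2 i3_2 - U i3_1 i3_2 * U i3_2 i3_1;
       U i3_1 i3_2 * U i3_2 i3_0 - U i3_1 i3_0 * U i3_2 i3_2;
       U i3_1 i3_0 * U i3_2 i3_1 - U i3_1 i3_1 * U i3_2 i3_0];
   [:: U i3_2 i3_1 * U i3_0 i3_2 - U i3_2 i3_2 * U i3_0 i3_1;
       U i3_2 i3_2 * U i3_0 i3_0 - U i3_2 i3_0 * U i3_0 i3_2;
       U i3_2 i3_0 * U i3_0 i3_1 - U i3_2 i3_1 * U i3_0 i3_0];
   [:: U i3_0 i3_1 * U i3_1 i3_2 - U i3_0 i3_2 * U i3_1 i3_1;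
       U i3_0 i3_2 * U i3_1 i3_0 - U i3_0 i3_0 * U i3_1 i3_2;
       U i3_0 i3_0 * U i3_1 i3_1 - U i3_0 i3_1 * U i3_1 i3_0]] i) j.
Proof.
move=> [a [b [c [d [h ->]]]]] i j.
rewrite -[LHS]mul1r -h; move: i j.
by apply: all_ord3; apply: all_ord3; rewrite !mxE /=; ring.
Qed.

(** Replacing the e_i by rotated vectors changes T_i T_j^T by 2 x 2 minors of U, which
    are entries of U by rot_cofactor. *)
Lemma wedge_source_change U T k : is_rot U -> orthogonal_triple T ->
  wedge (source_change U T) k = \sum_l U k l *: wedge T l.
Proof.
move=> rU oT.
have orth i j : i != j -> \sum_k U i k * U j k = 0.
  by move=> /negbTE ij; rewrite rot_rows_orthonormal // ij.
have cof := rot_cofactor rU.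
move: k; apply: all_ord3; rewrite {1}/wedge /= source_change_gram // orth // raddf0 add0r sum_ord3.
- by rewrite (cof i3_0 i3_0) (cof i3_0 i3_1) (cof i3_0 i3_2).
- by rewrite (cof i3_1 i3_0) (cof i3_1 i3_1) (cof i3_1 i3_2).
- by rewrite (cof i3_2 i3_0) (cof i3_2 i3_1) (cof i3_2 i3_2).
Qed.

Lemma sd_mx_fibre_change U V h T : orthogonal_triple T ->
  (forall B : 'M[R]_4, B^T = - B ->
    sd (h *m B *m h^T) = U *m sd B /\ asd (h *m B *m h^T) = V *m asd B) ->
  sd_mx (fibre_change h T) = U *m sd_mx T /\ asd_mx (fibre_change h T) = V *m asd_mx T.
Proof.
move=> oT H; split; apply/matrixP => m k; rewrite mxE wedge_fibre_change;
  have [e1 e2] := H _ (wedge_skew k oT); rewrite ?e1 ?e2 !mxE;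
  by apply: eq_bigr => l _; rewrite [in RHS]mxE.
Qed.

Lemma sd_mx_source_change U T : is_rot U -> orthogonal_triple T ->
  sd_mx (source_change U T) = sd_mx T *m U^T.
Proof.
move=> rU oT; apply/matrixP => m k; rewrite mxE wedge_source_change // !mxE !sum_ord3 !mxE.
by move: m; apply: all_ord3; rewrite /=; field.
Qed.

Lemma asd_mx_source_change U T : is_rot U -> orthogonal_triple T ->
  asd_mx (source_change U T) = asd_mx T *m U^T.
Proof.
move=> rU oT; apply/matrixP => m k; rewrite mxE wedge_source_change // !mxE !sum_ord3 !mxE.
by move: m; apply: all_ord3; rewrite /=; field.
Qed.

End Triples.

(** * Expansion of the rank condition *)

Section Half.
Variable R : rcfType.

Definition skew6 (p1 p2 p3 q1 q2 q3 : R) : 'M[R]_4 :=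
  mx4 [:: [:: 0; p1 + q1; p2 + q2; p3 + q3];
          [:: - (p1 + q1); 0; p3 - q3; q2 - p2];
          [:: - (p2 + q2); q3 - p3; 0; p1 - q1];
          [:: - (p3 + q3); p2 - q2; q1 - p1; 0]].

(** The product L_2 R(v), where R(v) is the anti-self-dual matrix with coordinates v: it
    is the traceless part of the square of p2 L_2 + R(v), up to the factor 2 p2. *)
Definition mixed (v1 v2 v3 : R) : 'M[R]_4 :=
  mx4 [:: [:: - v2; v3; 0; - v1]; [:: v3; v2; - v1; 0];
          [:: 0; - v1; - v2; - v3]; [:: - v1; 0; - v3; v2]].

Lemma skew6_sqr p2 v1 v2 v3 : let b := skew6 0 p2 0 v1 v2 v3 in
  let xi := 1 - p2 ^+ 2 - (v1 ^+ 2 + v2 ^+ 2 + v3 ^+ 2) in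
  1%:M + b *m b = xi%:M + (2 * p2) *: mixed v1 v2 v3.
Proof.
move=> b xi.
apply/matrixP; apply: all_ord4; apply: all_ord4;
  by rewrite !mxE sum_ord4 !mxE /= /xi; ring.
Qed.

(** The square of mixed v1 v2 v3 is the scalar |v|^2, so 1 + W^2 has an inverse which is
    linear in 1 + W^2, up to the factor xi^2 - 4 p2^2 |v|^2. *)
Lemma mixed_sqr xi p2 v1 v2 v3 :
  (xi%:M + (2 * p2) *: mixed v1 v2 v3) *m (xi%:M - (2 * p2) *: mixed v1 v2 v3) =
  (xi ^+ 2 - 4 * p2 ^+ 2 * (v1 ^+ 2 + v2 ^+ 2 + v3 ^+ 2))%:M.
Proof.
apply/matrixP; apply: all_ord4; apply: all_ord4;
  by rewrite !mxE sum_ord4 !mxE /=; ring.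
Qed.

Lemma congruence_entry (N Z : 'M[R]_4) i j : (N^T *m Z *m N) i j =
  N i4_0 i * (Z i4_0 i4_0 * N i4_0 j + Z i4_0 i4_1 * N i4_1 j
      + Z i4_0 i4_2 * N i4_2 j + Z i4_0 i4_3 * N i4_3 j)
 + N i4_1 i * (Z i4_1 i4_0 * N i4_0 j + Z i4_1 i4_1 * N i4_1 j
      + Z i4_1 i4_2 * N i4_2 j + Z i4_1 i4_3 * N i4_3 j)
 + N i4_2 i * (Z i4_2 i4_0 * N i4_0 j + Z i4_2 i4_1 * N i4_1 j
      + Z i4_2 i4_2 * N i4_2 j + Z i4_2 i4_3 * N i4_3 j)
 + N i4_3 i * (Z i4_3 i4_0 * N i4_0 j + Z i4_3 i4_1 * N i4_1 j
      + Z i4_3 i4_2 * N i4_2 j + Z i4_3 i4_3 * N i4_3 j).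
Proof. by rewrite -mulmxA mxE !sum_ord4 !mxE !sum_ord4. Qed.

Lemma mx4E (rows : seq (seq R)) i j : mx4 rows i j = nth 0 (nth [::] rows i) j.
Proof. by rewrite mxE. Qed.
(** The rank condition in the basis of the products L_a R_b of the 4 x 4 matrices. Each
    of these products is a signed permutation matrix, so a coefficient is a signed sum
    of four entries; the combinations of entries in the proof are these sums, in which
    equal entries of the symmetric matrix G have been merged. *)
Lemma crossed_columns_system (p1 p2 p3 u1 u2 u3 v1 v2 v3 w1 w2 w3 : R) :
  let V := v1 ^+ 2 + v2 ^+ 2 + v3 ^+ 2 in
  let U := u1 ^+ 2 + u2 ^+ 2 + u3 ^+ 2 in
  let S := u1 * v1 + u2 * v2 + u3 * v3 in
  let xi := 1 - p2 ^+ 2 - V in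
  let r := p3 - p1 * p2 in
  let kappa := xi * p1 - 2 * p2 * r in
  let tau := - xi ^+ 2 * p1 + xi * r * p2 + 2 * p2 ^+ 2 * p1 * V in
  let rho := p2 * r ^+ 2 - xi * r * p1 + p2 * p1 ^+ 2 * V in
  let c1 := u2 * v3 - u3 * v2 in let c2 := u3 * v1 - u1 * v3 in
  let c3 := u1 * v2 - u2 * v1 in
  let m1 := w1 + c1 in let m2 := w2 + c2 in let m3 := w3 + c3 in
  let b1 := skew6 p1 0 0 u1 u2 u3 in let b2 := skew6 0 p2 0 v1 v2 v3 in
  let b3 := skew6 0 0 p3 w1 w2 w3 in let N := b3 - b2 *m b1 in
  N^T *m (xi%:M - (2 * p2) *: mixed v1 v2 v3) *m N =
    (xi ^+ 2 - 4 * p2 ^+ 2 * V) *: (1%:M + b1 *m b1) ->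
  let s := v1 * w1 + v2 * w2 + v3 * w3 in
  let W := w1 ^+ 2 + w2 ^+ 2 + w3 ^+ 2 in
  [/\ [/\ (2 * p1 * p2 * V - xi * r) * m1 + p2 * kappa * c1 = 0,
      (2 * p1 * p2 * V - xi * r) * m2 + p2 * kappa * c2 = 0 &
      (2 * p1 * p2 * V - xi * r) * m3 + p2 * kappa * c3 = 0],
      [/\ tau * u1 - kappa * (S * v1 + (v2 * m3 - v3 * m2)) = 0,
      tau * u2 - kappa * (S * v2 + (v3 * m1 - v1 * m3)) = 0 &
      tau * u3 - kappa * (S * v3 + (v1 * m2 - v2 * m1)) = 0] &
      [/\ p2 * (U * v1 - 2 * S * u1 - (xi + 2 * V) * (u2 * w3 - u3 * w2)
            + (W * v1 - 2 * s * w1)) + rho * v1 = 0,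
      p2 * (U * v2 - 2 * S * u2 - (xi + 2 * V) * (u3 * w1 - u1 * w3)
            + (W * v2 - 2 * s * w2)) + rho * v2 = 0 &
      p2 * (U * v3 - 2 * S * u3 - (xi + 2 * V) * (u1 * w2 - u2 * w1)
            + (W * v3 - 2 * s * w3)) + rho * v3 = 0]].
Proof.
move=> V U S xi r kappa tau rho c1 c2 c3 m1 m2 m3 b1 b2 b3 N /matrixP E s W.
pose eta := 1 - p1 ^+ 2 - U.
pose n := [::
  [:: S + p1 * v1 + p2 * u2; m1 - p2 * u3; m2 + p1 * v3; r + m3 + p2 * u1 - p1 * v2];
  [:: - m1 - p2 * u3; S + p1 * v1 - p2 * u2; r - m3 + p2 * u1 + p1 * v2; m2 + p1 * v3];
  [:: - m2 + p1 * v3; - r + m3 + p2 * u1 + p1 * v2; S + p2 * u2 - p1 * v1; - m1 + p2 * u3];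
  [:: - r - m3 + p2 * u1 - p1 * v2; - m2 + p1 * v3; m1 + p2 * u3; S - p2 * u2 - p1 * v1]].
have Ne : N = mx4 n.
  rewrite /n.
  rewrite /N /m1 /m2 /m3 /c1 /c2 /c3 /S /r.
  apply/matrixP; apply: all_ord4; apply: all_ord4;
    by rewrite !mxE sum_ord4 !mxE /=; ring.
pose z := [::
  [:: xi + 2 * p2 * v2; - (2 * p2 * v3); 0; 2 * p2 * v1];
  [:: - (2 * p2 * v3); xi - 2 * p2 * v2; 2 * p2 * v1; 0];
  [:: 0; 2 * p2 * v1; xi + 2 * p2 * v2; 2 * p2 * v3];
  [:: 2 * p2 * v1; 0; 2 * p2 * v3; xi - 2 * p2 * v2]].
have Ze : xi%:M - (2 * p2) *: mixed v1 v2 v3 = mx4 z.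
  rewrite /z.
  by apply/matrixP; apply: all_ord4; apply: all_ord4; rewrite !mxE /=; ring.
pose y := [::
  [:: eta - 2 * p1 * u1; 0; - (2 * p1 * u3); 2 * p1 * u2];
  [:: 0; eta - 2 * p1 * u1; - (2 * p1 * u2); - (2 * p1 * u3)];
  [:: - (2 * p1 * u3); - (2 * p1 * u2); eta + 2 * p1 * u1; 0];
  [:: 2 * p1 * u2; - (2 * p1 * u3); 0; eta + 2 * p1 * u1]].
have Ye : 1%:M + b1 *m b1 = mx4 y.
  apply/matrixP; apply: all_ord4; apply: all_ord4;
    by rewrite !mxE sum_ord4 !mxE /y /= /eta /U; ring.
have E' i j : (N^T *m (xi%:M - (2 * p2) *: mixed v1 v2 v3) *m N) i j =
    (xi ^+ 2 - 4 * p2 ^+ 2 * V) * mx4 y i j by rewrite E mxE Ye.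
pose G i j := (N^T *m (xi%:M - (2 * p2) *: mixed v1 v2 v3) *m N) i j
   - (xi ^+ 2 - 4 * p2 ^+ 2 * V) * mx4 y i j.
have G0 i j : G i j = 0 by rewrite /G E' subrr.
have n8 : (8 : R) != 0 by rewrite pnatr_eq0.
split; split; apply: (mulfI n8); rewrite mulr0.
- transitivity (2 * G i4_0 i4_2 - 2 * G i4_1 i4_3); last by rewrite !G0; ring.
  rewrite /G Ne Ze !congruence_entry !mx4E /n /z /y /=.
  rewrite /rho /eta /tau /kappa /xi /m1 /m2 /m3 /c1 /c2 /c3 /r /S /s /W /U /V; ring.
- transitivity (- 2 * G i4_0 i4_1 - 2 * G i4_2 i4_3); last by rewrite !G0; ring.
  rewrite /G Ne Ze !congruence_entry !mx4E /n /z /y /=.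
  rewrite /rho /eta /tau /kappa /xi /m1 /m2 /m3 /c1 /c2 /c3 /r /S /s /W /U /V; ring.
- transitivity (- G i4_0 i4_0 + G i4_1 i4_1 + G i4_2 i4_2 - G i4_3 i4_3); last by rewrite !G0; ring.
  rewrite /G Ne Ze !congruence_entry !mx4E /n /z /y /=.
  rewrite /rho /eta /tau /kappa /xi /m1 /m2 /m3 /c1 /c2 /c3 /r /S /s /W /U /V; ring.
- transitivity (- G i4_0 i4_0 - G i4_1 i4_1 + G i4_2 i4_2 + G i4_3 i4_3); last by rewrite !G0; ring.
  rewrite /G Ne Ze !congruence_entry !mx4E /n /z /y /=.
  rewrite /rho /eta /tau /kappa /xi /m1 /m2 /m3 /c1 /c2 /c3 /r /S /s /W /U /V; ring.
- transitivity (2 * G i4_0 i4_3 - 2 * G i4_1 i4_2); last by rewrite !G0; ring.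
  rewrite /G Ne Ze !congruence_entry !mx4E /n /z /y /=.
  rewrite /rho /eta /tau /kappa /xi /m1 /m2 /m3 /c1 /c2 /c3 /r /S /s /W /U /V; ring.
- transitivity (- 2 * G i4_0 i4_2 - 2 * G i4_1 i4_3); last by rewrite !G0; ring.
  rewrite /G Ne Ze !congruence_entry !mx4E /n /z /y /=.
  rewrite /rho /eta /tau /kappa /xi /m1 /m2 /m3 /c1 /c2 /c3 /r /S /s /W /U /V; ring.
- transitivity (- 2 * G i4_0 i4_3 - 2 * G i4_1 i4_2); last by rewrite !G0; ring.
  rewrite /G Ne Ze !congruence_entry !mx4E /n /z /y /=.
  rewrite /rho /eta /tau /kappa /xi /m1 /m2 /m3 /c1 /c2 /c3 /r /S /s /W /U /V; ring.
- transitivity (- G i4_0 i4_0 + G i4_1 i4_1 - G i4_2 i4_2 + G i4_3 i4_3); last by rewrite !G0; ring.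
  rewrite /G Ne Ze !congruence_entry !mx4E /n /z /y /=.
  rewrite /rho /eta /tau /kappa /xi /m1 /m2 /m3 /c1 /c2 /c3 /r /S /s /W /U /V; ring.
- transitivity (2 * G i4_0 i4_1 - 2 * G i4_2 i4_3); last by rewrite !G0; ring.
  rewrite /G Ne Ze !congruence_entry !mx4E /n /z /y /=.
  rewrite /rho /eta /tau /kappa /xi /m1 /m2 /m3 /c1 /c2 /c3 /r /S /s /W /U /V; ring.
Qed.

End Half.

(** * Simultaneous diagonalisation *)

Section Normal.
Variable R : rcfType.
Notation triple := ('I_3 -> 'M[R]_(4, 8)).
Implicit Type T : triple.

Lemma trace_gram_ge0 m n (X : 'M[R]_(m, n)) : 0 <= \tr (X *m X^T).
Proof.
apply: sumr_ge0 => i _; rewrite mxE; apply: sumr_ge0 => j _.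
by rewrite mxE -expr2 sqr_ge0.
Qed.

Lemma trace_gram_eq0 m n (X : 'M[R]_(m, n)) : \tr (X *m X^T) = 0 -> X = 0.
Proof.
have nn i : 0 <= (X *m X^T) i i.
  by rewrite mxE sumr_ge0 // => j _; rewrite mxE -expr2 sqr_ge0.
move/eqP; rewrite psumr_eq0 // => /allP h; apply/matrixP => i j; rewrite [RHS]mxE.
have := h i (mem_index_enum _); rewrite mxE psumr_eq0 => [/allP/(_ j)|k _].
  by rewrite mem_index_enum mxE -expr2 sqrf_eq0 => /(_ isT)/eqP.
by rewrite mxE -expr2 sqr_ge0.
Qed.

(** U and V are the projections of T_0 and T_1 to the orthogonal complement of the rows
    of T_2; their Gram matrices only depend on the wedges. *)
Lemma triple_complement T : orthogonal_triple T ->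
  let U := T i3_0 + wedge T i3_1 *m T i3_2 in
  let V := T i3_1 - wedge T i3_0 *m T i3_2 in
  [/\ U *m (T i3_2)^T = 0, V *m (T i3_2)^T = 0,
      U *m U^T = 1%:M + wedge T i3_1 *m wedge T i3_1,
      V *m V^T = 1%:M + wedge T i3_0 *m wedge T i3_0 &
      U *m V^T = wedge T i3_2 - wedge T i3_1 *m wedge T i3_0].
Proof.
move=> oT U V.
have U2 : U *m (T i3_2)^T = 0.
  rewrite mulmxDl -mulmxA (triple_unit _ oT) mulmx1 /wedge /=.
  by rewrite (@triple_anti _ _ i3_0 i3_2 oT) // subrr.
have V2 : V *m (T i3_2)^T = 0.
  by rewrite mulmxBl -mulmxA (triple_unit _ oT) mulmx1 /wedge /= subrr.
have T2U : T i3_2 *m U^T = 0 by rewrite -[T i3_2]trmxK -trmx_mul U2 trmx0.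
have T2V : T i3_2 *m V^T = 0 by rewrite -[T i3_2]trmxK -trmx_mul V2 trmx0.
split=> //.
- rewrite {1}/U mulmxDl -mulmxA T2U mulmx0 addr0 /U linearD /= mulmxDr.
  rewrite (triple_unit _ oT) trmx_mul (wedge_skew _ oT) mulmxA mulmxN -mulNmx.
  by rewrite {3}/wedge /= (@triple_anti _ _ i3_2 i3_0 oT) // opprK.
- rewrite {1}/V mulmxBl -mulmxA T2V mulmx0 subr0 /V linearB /= mulmxBr.
  rewrite (triple_unit _ oT) trmx_mul (wedge_skew _ oT) mulmxA mulmxN opprK.
  by rewrite {3}/wedge.
- rewrite {1}/U mulmxDl -mulmxA T2V mulmx0 addr0 /V linearB /= mulmxBr.
  rewrite trmx_mul (wedge_skew _ oT) mulmxA mulmxN opprK.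
  by rewrite {3}/wedge /= (@triple_anti _ _ i3_2 i3_0 oT) // mulNmx.
Qed.

(** The two inequalities of crossed_columns_scalar are traces: that of U U^T is 4 xi,
    and that of (Z' U)(Z' U)^T is 4 xi times the discriminant. If xi = 0, then U = 0,
    and the inner product of the columns, a quarter of the trace of U V^T, would be
    zero. *)
Lemma crossed_columns_diag T : orthogonal_triple T -> is_diag_mx (sd_mx T) ->
  ((asd_mx T)^T *m asd_mx T) i3_0 i3_1 != 0 ->
  (sd_mx T i3_0 i3_0 = 0 /\ sd_mx T i3_1 i3_1 = 0) \/
  sd_mx T i3_0 i3_0 ^+ 2 = sd_mx T i3_2 i3_2 ^+ 2.
Proof.
move=> oT /is_diag_mxP d; rewrite mxE sum_ord3 ![(asd_mx T)^T _ _]mxE.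
have [U2 V2 UU VV UV] := triple_complement oT.
move: UU VV UV U2 V2; set U := T i3_0 + _; set V := T i3_1 - _ => UU VV UV U2 V2.
set p1 := sd_mx T i3_0 i3_0; set p2 := sd_mx T i3_1 i3_1; set p3 := sd_mx T i3_2 i3_2.
set u1 := asd_mx T i3_0 i3_0; set u2 := asd_mx T i3_1 i3_0; set u3 := asd_mx T i3_2 i3_0.
set v1 := asd_mx T i3_0 i3_1; set v2 := asd_mx T i3_1 i3_1; set v3 := asd_mx T i3_2 i3_1.
pose w1 := asd_mx T i3_0 i3_2; pose w2 := asd_mx T i3_1 i3_2; pose w3 := asd_mx T i3_2 i3_2.
have sdE k : wedge T k = skew6 (sd_mx T i3_0 k) (sd_mx T i3_1 k) (sd_mx T i3_2 k)
    (asd_mx T i3_0 k) (asd_mx T i3_1 k) (asd_mx T i3_2 k).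
  by rewrite {1}(skewE (wedge_skew k oT)) /skew /skew6 /sd_mx /asd_mx ![(\matrix_(_, _) _) _ _]mxE.
have e0 : wedge T i3_0 = skew6 p1 0 0 u1 u2 u3 by rewrite sdE (d i3_1 i3_0) // (d i3_2 i3_0).
have e1 : wedge T i3_1 = skew6 0 p2 0 v1 v2 v3 by rewrite sdE (d i3_0 i3_1) // (d i3_2 i3_1).
have e2 : wedge T i3_2 = skew6 0 0 p3 w1 w2 w3 by rewrite sdE (d i3_0 i3_2) // (d i3_1 i3_2).
rewrite e0 e1 e2 in UU VV UV.
move=> S0.
pose xi := 1 - p2 ^+ 2 - (v1 ^+ 2 + v2 ^+ 2 + v3 ^+ 2).
pose Z' := xi%:M - (2 * p2) *: mixed v1 v2 v3.
rewrite skew6_sqr -/xi in UU.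
have sZ' : Z'^T = Z'.
  by apply/matrixP; apply: all_ord4; apply: all_ord4; rewrite !mxE.
have E := schur_rank (triple_unit _ oT) U2 V2 UU sZ' (mixed_sqr xi p2 v1 v2 v3).
have VUe : V *m U^T = (U *m V^T)^T by rewrite trmx_mul trmxK.
rewrite VUe UV VV in E.
have tr4 : \tr (U *m U^T) = 4 * xi.
  by rewrite UU /mxtrace sum_ord4 !mxE /=; ring.
have xi_ge0 : 0 <= xi by have := trace_gram_ge0 U; rewrite tr4 pmulr_rge0.
have xi0 : 0 < xi.
  rewrite lt_neqAle xi_ge0 andbT eq_sym; apply: contra S0 => /eqP xi0.
  have U0 : U = 0 by apply: trace_gram_eq0; rewrite tr4 xi0 mulr0.
  have := congr1 (fun M : 'M[R]_4 => \tr M) UV.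
  rewrite U0 mul0mx mxtrace0 /mxtrace sum_ord4 !mxE !sum_ord4 !mxE /= => e.
  by apply/eqP; apply: (@mulfI _ 4); rewrite ?pnatr_eq0 // mulr0 {1}e; ring.
have disc : 0 <= xi ^+ 2 - 4 * p2 ^+ 2 * (v1 ^+ 2 + v2 ^+ 2 + v3 ^+ 2).
  have := trace_gram_ge0 (Z' *m U).
  rewrite trmx_mul sZ' mulmxA -(mulmxA _ U) UU -mulmxA mixed_sqr mul_mx_scalar.
  rewrite mxtraceZ /mxtrace sum_ord4 !mxE /=.
  rewrite (_ : _ + _ + _ + _ = 4 * xi); last by ring.
  by rewrite pmulr_lge0 // mulr_gt0.
have [hT hI hR] := crossed_columns_system E.
rewrite subr_ge0 in disc.
exact: (crossed_columns_scalar erefl erefl erefl erefl erefl erefl erefl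
  erefl erefl erefl erefl erefl erefl erefl xi0 disc S0 hT hI hR).
Qed.

(** A rotation of the rows makes P diagonal and changes neither P^T P nor Q^T Q. *)
Lemma crossed_columns T : orthogonal_triple T -> is_diag_mx ((sd_mx T)^T *m sd_mx T) ->
  ((asd_mx T)^T *m asd_mx T) i3_0 i3_1 != 0 ->
  let S := (sd_mx T)^T *m sd_mx T in
  (S i3_0 i3_0 = 0 /\ S i3_1 i3_1 = 0) \/ S i3_0 i3_0 = S i3_2 i3_2.
Proof.
move=> oT dS t01 S; have [U rU dU] := orth_cols_diag dS.
have [h sh hE] := rot_pair_lift rU (is_rot1 R).
have [e1 e2] := sd_mx_fibre_change oT hE.
rewrite mul1mx in e2.
have oT' := orthogonal_fibre_change sh oT.
rewrite -e1 in dU; have H := crossed_columns_diag oT' dU.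
rewrite e2 in H; have {H} H := H t01.
have Sd i : S i i = sd_mx (fibre_change h T) i i ^+ 2.
  rewrite /S -(rot_gram (sd_mx T) rU) -e1 mxE (bigD1 i) //= big1 ?addr0 ?mxE ?expr2 //.
  move=> j ji; move/is_diag_mxP: dU => -> //; rewrite ?mulr0 //.
by rewrite !Sd; case: H => [[-> ->]|->]; [left; rewrite expr0n|right].
Qed.

Lemma gram_source_change U T : is_rot U -> orthogonal_triple T ->
  (sd_mx (source_change U T))^T *m sd_mx (source_change U T) =
    U *m ((sd_mx T)^T *m sd_mx T) *m U^T /\
  (asd_mx (source_change U T))^T *m asd_mx (source_change U T) =
    U *m ((asd_mx T)^T *m asd_mx T) *m U^T.
Proof.
by move=> rU oT; rewrite sd_mx_source_change // asd_mx_source_change // !trmx_mul !trmxK !mulmxA.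
Qed.

(** The rotation exchanging the first two axes: crossed_columns is not symmetric in
    them, and its two forms together compare the lengths of the first two columns of P. *)
Definition swap12 : 'M[R]_3 := mx3 0 1 0 1 0 0 0 0 (-1).

Lemma is_rot_swap12 : is_rot swap12.
Proof.
have h2 : (2 : R) != 0 by rewrite pnatr_eq0.
have s2 : Num.sqrt 2 ^+ 2 = 2 :> R by rewrite sqr_sqrtr.
pose x : R := (Num.sqrt 2)^-1.
have x2 : 2 * x ^+ 2 = 1 by rewrite exprVn s2 divff.
exists 0, x, x, 0; split; first by lra.
by apply/matrixP; apply: all_ord3; apply: all_ord3; rewrite !mxE /=; lra.
Qed.

Lemma gram_entry01 T : orthogonal_triple T -> is_diag_mx ((sd_mx T)^T *m sd_mx T) ->
  let S := (sd_mx T)^T *m sd_mx T in S i3_0 i3_0 != S i3_1 i3_1 ->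
  ((asd_mx T)^T *m asd_mx T) i3_0 i3_1 = 0.
Proof.
move=> oT dS S; apply: contraNeq => t01.
have [[-> ->] //|e02] := crossed_columns oT dS t01.
have rs := is_rot_swap12; have [g1 g2] := gram_source_change rs oT.
have swapE (A : 'M[R]_3) : swap12 *m A *m swap12^T =
   mx3 (A i3_1 i3_1) (A i3_1 i3_0) (- A i3_1 i3_2) (A i3_0 i3_1) (A i3_0 i3_0) (- A i3_0 i3_2)
       (- A i3_2 i3_1) (- A i3_2 i3_0) (A i3_2 i3_2).
  by apply/matrixP; apply: all_ord3; apply: all_ord3;
    rewrite !mxE !sum_ord3 !mxE !sum_ord3 !mxE /=; ring.
have sT : ((asd_mx T)^T *m asd_mx T)^T = (asd_mx T)^T *m asd_mx T.
  by rewrite trmx_mul trmxK.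
have := crossed_columns (orthogonal_source_change rs oT).
rewrite g1 g2 !swapE /= !mx3E /= -/S.
case.
- have /is_diag_mxP d := dS.
  by apply: diag3P; split; rewrite mx3E /= ?d ?oppr0.
- by rewrite -sT mxE.
- by case=> -> ->.
- by move=> ->; rewrite -e02.
Qed.

(** The cyclic symmetry gives the three pairs of axes from the first one. *)
Lemma gram_offdiag T : orthogonal_triple T -> is_diag_mx ((sd_mx T)^T *m sd_mx T) ->
  forall i j, ((sd_mx T)^T *m sd_mx T) i i != ((sd_mx T)^T *m sd_mx T) j j ->
  ((asd_mx T)^T *m asd_mx T) i j = 0.
Proof.
move=> oT dS.
have sT : ((asd_mx T)^T *m asd_mx T)^T = (asd_mx T)^T *m asd_mx T.
  by rewrite trmx_mul trmxK.
have sy i j : ((asd_mx T)^T *m asd_mx T) i j = ((asd_mx T)^T *m asd_mx T) j i.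
  by rewrite -[in LHS]sT mxE.
have rc := is_rot_cyc_rot R.
have o1 := orthogonal_source_change rc oT; have o2 := orthogonal_source_change rc o1.
have [g1 g2] := gram_source_change rc oT; have [g3 g4] := gram_source_change rc o1.
rewrite g1 g2 in g3 g4.
have h1 := gram_entry01 oT dS.
have := gram_entry01 o1; rewrite g1 g2 cyc_conj_diag => /(_ dS).
rewrite !cyc_conjE /= !mx3E /= => h2.
have := gram_entry01 o2; rewrite g3 g4 !cyc_conj_diag => /(_ dS).
rewrite !cyc_conjE /= !mx3E /= => h3.
apply: all_ord3; apply: all_ord3; rewrite ?eqxx //.
- by move=> h; rewrite sy; apply: h2; rewrite eq_sym.
- by rewrite eq_sym => h; rewrite sy; exact: h1.
- by move=> h; rewrite sy; apply: h3; rewrite eq_sym.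
Qed.

(** The conclusion of gram_offdiag holds after every rotation of the first factor, as
    simultaneous_diag3 requires. *)
Lemma diagonal_form T : orthogonal_triple T ->
  exists U h, [/\ is_rot U, special h, is_diag_mx (sd_mx (fibre_change h (source_change U T))) &
                 is_diag_mx (asd_mx (fibre_change h (source_change U T)))].
Proof.
move=> oT.
have sS : ((sd_mx T)^T *m sd_mx T)^T = (sd_mx T)^T *m sd_mx T by rewrite trmx_mul trmxK.
have sT : ((asd_mx T)^T *m asd_mx T)^T = (asd_mx T)^T *m asd_mx T by rewrite trmx_mul trmxK.
have [U [rU d1 d2]] : exists U, [/\ is_rot U,
    is_diag_mx (U *m ((sd_mx T)^T *m sd_mx T) *m U^T) &
    is_diag_mx (U *m ((asd_mx T)^T *m asd_mx T) *m U^T)].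
  apply: simultaneous_diag3 => // U rU; have [<- <-] := gram_source_change rU oT.
  by apply: gram_offdiag; exact: orthogonal_source_change.
have [g1 g2] := gram_source_change rU oT; rewrite -g1 in d1; rewrite -g2 in d2.
have [V rV dV] := orth_cols_diag d1; have [W rW dW] := orth_cols_diag d2.
have [h sh hE] := rot_pair_lift rV rW.
have [e1 e2] := sd_mx_fibre_change (orthogonal_source_change rU oT) hE.
by exists U, h; rewrite e1 e2.
Qed.
End Normal.

(** * Bilinear maps and triples *)

Section Map.
Variable R : realType.
Notation triple := ('I_3 -> 'M[R]_(4, 8)).
Implicit Types (T : triple) (F : bilinear_map R 3 4 8).

Definition triple_fun T (x : 'rV[R]_3) (y : 'rV[R]_4) : 'rV[R]_8 :=
  \sum_i x 0 i *: (y *m T i).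

Lemma triple_fun_bilinear T : bilinear_for *:%R *:%R (triple_fun T).
Proof.
split=> [u' a u v|u a u' v']; rewrite /triple_fun /=.
- rewrite scaler_sumr -big_split; apply: eq_bigr => i _ /=.
  by rewrite !mxE scalerDl scalerA.
- rewrite scaler_sumr -big_split; apply: eq_bigr => i _ /=.
  by rewrite mulmxDl -scalemxAl scalerDr !scalerA mulrC.
Qed.

HB.instance Definition _ T := bilinear_isBilinear.Build R 'rV[R]_3 'rV[R]_4 'rV[R]_8
  *:%R *:%R (triple_fun T) (triple_fun_bilinear T).

(** The multiplication with given matrices; map_triple is the inverse construction. *)
Definition triple_map T : bilinear_map R 3 4 8 := triple_fun T.

Definition map_triple F : triple :=
  fun i => \matrix_(j, l) F (delta_mx 0 i) (delta_mx 0 j) 0 l.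

Lemma map_tripleE F x y : F x y = triple_fun (map_triple F) x y.
Proof.
rewrite {1}(row_sum_delta x) linear_sumlz; apply: eq_bigr => i _.
rewrite linearZl_LR; congr (_ *: _).
rewrite {1}(row_sum_delta y) linear_sumr; apply/rowP => l.
rewrite summxE mxE; apply: eq_bigr => j _.
by rewrite linearZr_LR !mxE.
Qed.

Lemma triple_mapK T : map_triple (triple_map T) =1 T.
Proof.
move=> i; apply/matrixP => j l; rewrite mxE /triple_map /= /triple_fun.
rewrite (bigD1 i) //= big1 => [|k ki].
  by rewrite addr0 -rowE !mxE !eqxx mul1r.
by rewrite mxE (negbTE ki) andbF scale0r.
Qed.

Lemma bvecE n (i : 'I_n) : bvec R n i.+1 = delta_mx 0 i.
Proof. by apply/rowP => j; rewrite !mxE eqSS eqxx. Qed.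

Lemma coefE F (i k : 'I_3) (j l : 'I_4) :
  coef F i.+1 j.+1 k.+1 l.+1 = (map_triple F i *m (map_triple F k)^T) j l.
Proof.
rewrite /coef /dot !bvecE mxE.
by apply: eq_bigr => t _; rewrite !mxE.
Qed.

Lemma dotE n (u v : 'rV[R]_n) : dot u v = (u *m v^T) 0 0.
Proof. by rewrite /dot mxE; apply: eq_bigr => i _; rewrite !mxE. Qed.

Lemma dot_ge0 n (u : 'rV[R]_n) : 0 <= dot u u.
Proof. by apply: sumr_ge0 => i _; rewrite -expr2 sqr_ge0. Qed.

Lemma orthogonal_multiplicationP F : orthogonal_multiplication F <->
  forall x y, dot (F x y) (F x y) = dot x x * dot y y.
Proof.
rewrite /orthogonal_multiplication /enorm; split=> h x y.
  have := congr1 (fun t => t ^+ 2) (h x y).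
  by rewrite exprMn !sqr_sqrtr ?dot_ge0.
by rewrite h sqrtrM ?dot_ge0.
Qed.

(** Polarization. *)
Lemma quad_form_eq0 n (M : 'M[R]_n) :
  (forall y : 'rV[R]_n, (y *m M *m y^T) 0 0 = 0) -> M + M^T = 0.
Proof.
move=> h; apply/matrixP => i j.
have ent k l : ((delta_mx 0 k : 'rV[R]_n) *m M *m (delta_mx 0 l : 'rV[R]_n)^T) 0 0 = M k l.
  by rewrite trmx_delta -rowE -colE !mxE.
have := h (delta_mx 0 i + delta_mx 0 j).
have addE (A B : 'M[R]_1) : (A + B) 0 0 = A 0 0 + B 0 0 by rewrite mxE.
rewrite mulmxDl linearD /= !mulmxDr !mulmxDl !addE.
have := (h (delta_mx 0 i), h (delta_mx 0 j)).
by rewrite !ent !mxE => -[-> ->]; rewrite add0r addr0 addrC.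
Qed.

Lemma dot_triple_fun T x y : orthogonal_triple T ->
  dot (triple_fun T x y) (triple_fun T x y) = dot x x * dot y y.
Proof.
move=> oT; rewrite !dotE /triple_fun sum_ord3.
have unit i : (y *m T i) *m (y *m T i)^T = y *m y^T.
  by rewrite trmx_mul mulmxA -(mulmxA y) triple_unit // mulmx1.
have anti i j : i != j -> (y *m T j) *m (y *m T i)^T = - ((y *m T i) *m (y *m T j)^T).
  move=> ij; rewrite !trmx_mul !mulmxA -!(mulmxA y) (@triple_anti _ T i j) //.
  by rewrite mulNmx mulmxN.
move: (unit i3_0) (unit i3_1) (unit i3_2) (anti i3_0 i3_1 isT) (anti i3_0 i3_2 isT)
  (anti i3_1 i3_2 isT).
set a := y *m T i3_0; set b := y *m T i3_1; set c := y *m T i3_2 => h1 h2 h3 h4 h5 h6.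
rewrite !linearD /= !mulmxDl ?mulmxDr !linearZ /= -?scalemxAr -!scalemxAl.
rewrite h1 h2 h3 h4 h5 h6 [(x *m x^T) _ _]mxE sum_ord3 ![x^T _ _]mxE.
set ab := a *m b^T; set ac := a *m c^T; set bc := b *m c^T; set yy := y *m y^T.
by rewrite !mxE; ring.
Qed.

Lemma orthogonal_triple_map T : orthogonal_triple T ->
  orthogonal_multiplication (triple_map T).
Proof. by move=> oT; apply/orthogonal_multiplicationP => x y; exact: dot_triple_fun. Qed.

Lemma source_sum_gram F (x : 'rV[R]_3) : orthogonal_multiplication F ->
  (\sum_i x 0 i *: map_triple F i) *m (\sum_i x 0 i *: map_triple F i)^T = (dot x x)%:M.
Proof.
move=> /orthogonal_multiplicationP oF; set S := \sum_i _.
have FS y : F x y = y *m S.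
  rewrite map_tripleE /triple_fun /S mulmx_sumr; apply: eq_bigr => i _.
  by rewrite -scalemxAr.
have sM : (S *m S^T - (dot x x)%:M)^T = S *m S^T - (dot x x)%:M.
  by rewrite linearB /= trmx_mul trmxK tr_scalar_mx.
have /quad_form_eq0 : forall y : 'rV[R]_4, (y *m (S *m S^T - (dot x x)%:M) *m y^T) 0 0 = 0.
  move=> y; have := oF x y; rewrite FS !dotE trmx_mul => e.
  rewrite mulmxBr mulmxBl mul_mx_scalar -scalemxAl.
  by rewrite mxE [X in _ + X]mxE [X in _ - X]mxE -e !mulmxA subrr.
rewrite sM -mulr2n => /eqP; rewrite -scaler_nat scaler_eq0 pnatr_eq0 /= subr_eq0.
by move=> /eqP.
Qed.

Lemma orthogonal_map_triple F : orthogonal_multiplication F ->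
  orthogonal_triple (map_triple F).
Proof.
move=> oF.
have sd i : \sum_k (delta_mx 0 i : 'rV[R]_3) 0 k *: map_triple F k = map_triple F i.
  rewrite (bigD1 i) //= mxE !eqxx scale1r big1 ?addr0 // => k ki.
  by rewrite mxE (negbTE ki) andbF scale0r.
have dd i j : dot (delta_mx 0 i : 'rV[R]_3) (delta_mx 0 j) = (i == j)%:R.
  rewrite /dot (bigD1 i) //= big1 ?addr0 => [|k ki].
    by rewrite !mxE !eqxx mul1r.
  by rewrite !mxE (negbTE ki) andbF mul0r.
have one i : map_triple F i *m (map_triple F i)^T = 1%:M.
  by have := source_sum_gram (delta_mx 0 i) oF; rewrite sd dd eqxx.
move=> i j; have [<-|ij] := eqVneq i j; first by rewrite one mulr2n raddfD.
have := source_sum_gram (delta_mx 0 i + delta_mx 0 j) oF.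
have -> : \sum_k (delta_mx 0 i + delta_mx 0 j : 'rV[R]_3) 0 k *: map_triple F k
   = map_triple F i + map_triple F j.
  rewrite -(sd i) -(sd j) -big_split; apply: eq_bigr => k _ /=.
  by rewrite mxE scalerDl.
have -> : dot (delta_mx 0 i + delta_mx 0 j : 'rV[R]_3) (delta_mx 0 i + delta_mx 0 j) = 2.
  have addE (A B : 'M[R]_1) : (A + B) 0 0 = A 0 0 + B 0 0 by rewrite mxE.
  rewrite dotE linearD /= !mulmxDl !mulmxDr !addE.
  rewrite -!dotE !dd !eqxx [j == i]eq_sym (negbTE ij) addr0 add0r.
  by [].
rewrite linearD /= !mulmxDl !mulmxDr !one.
move=> /matrixP h; apply/matrixP => k l.
have := h k l; rewrite mul0rn raddf0.
set A := map_triple F i *m _; set B := map_triple F j *m _ => {}h.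
have {h} : (k == l)%:R + A k l + (B k l + (k == l)%:R) = (2 *+ (k == l) : R).
  by move: h; rewrite !mxE.
rewrite !mxE; case: (k == l) => /=; rewrite ?mulr1n ?mulr0n; lra.
Qed.

End Map.

(** * Normalized multiplications *)

Section Moduli.
Variable R : realType.
Notation triple := ('I_3 -> 'M[R]_(4, 8)).
Implicit Types (T : triple) (F : bilinear_map R 3 4 8).

(** The wedges of a normalized multiplication, in terms of m = mu, n = nu, a = alpha, b
    = beta, g = gamma, d = F_{14,21}, e = F_{14,22}, p = F_{11,22} and q = F_{14,23}. In
    the bases L and R, the first is along the third axis, the second is along the second
    axis up to the beta term along R_3, and the third has self-dual part along the first
    axis. *)
Definition normal_wedge0 (m n : R) : 'M[R]_4 :=
  mx4 [:: [:: 0; 0; 0; - m]; [:: 0; 0; - n; 0]; [:: 0; n; 0; 0]; [:: m; 0; 0; 0]].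
Definition normal_wedge1 (a b g : R) : 'M[R]_4 :=
  mx4 [:: [:: 0; 0; a; b]; [:: 0; 0; - b; g]; [:: - a; b; 0; 0]; [:: - b; - g; 0; 0]].
Definition normal_wedge2 (d e p q : R) : 'M[R]_4 :=
  mx4 [:: [:: 0; p; - e; - d]; [:: - p; 0; d; - e]; [:: e; - d; 0; - q];
          [:: d; e; q; 0]].

Definition has_wedges T (w0 w1 w2 : 'M[R]_4) :=
  [/\ wedge T i3_0 = w0, wedge T i3_1 = w1 & wedge T i3_2 = w2].

Lemma normal_wedge0_skew m n : (normal_wedge0 m n)^T = - normal_wedge0 m n.
Proof. by apply/matrixP; apply: all_ord4; apply: all_ord4; rewrite !mxE /=; ring. Qed.
Lemma normal_wedge1_skew a b g : (normal_wedge1 a b g)^T = - normal_wedge1 a b g.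
Proof. by apply/matrixP; apply: all_ord4; apply: all_ord4; rewrite !mxE /=; ring. Qed.
Lemma normal_wedge2_skew d e p q : (normal_wedge2 d e p q)^T = - normal_wedge2 d e p q.
Proof. by apply/matrixP; apply: all_ord4; apply: all_ord4; rewrite !mxE /=; ring. Qed.

Lemma skew4P (A B : 'M[R]_4) : A^T = - A -> B^T = - B ->
  A i4_0 i4_1 = B i4_0 i4_1 -> A i4_0 i4_2 = B i4_0 i4_2 -> A i4_0 i4_3 = B i4_0 i4_3 ->
  A i4_1 i4_2 = B i4_1 i4_2 -> A i4_1 i4_3 = B i4_1 i4_3 -> A i4_2 i4_3 = B i4_2 i4_3 -> A = B.
Proof.
move=> sA sB h1 h2 h3 h4 h5 h6.
have anti (X : 'M[R]_4) : X^T = - X -> forall i j, X i j = - X j i.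
  by move=> sX i j; rewrite -[X in LHS]trmxK sX !mxE.
have z (X : 'M[R]_4) : X^T = - X -> forall i, X i i = 0.
  by move=> sX i; have := anti X sX i i; move: (X i i) => x h; lra.
by apply/matrixP; apply: all_ord4; apply: all_ord4; rewrite ?z //;
  rewrite (anti A) // [RHS](anti B) //; congr (- _).
Qed.

Lemma normalized_wedges F : orthogonal_multiplication F -> normalized F ->
  has_wedges (map_triple F)
    (normal_wedge0 (mu F) (nu F)) (normal_wedge1 (alpha F) (beta F) (gamma F))
    (normal_wedge2 (F1421 F) (F1422 F) (F1122 F) (F1423 F)).
Proof.
move=> oF [[n1 n2] [n3 n4] [n5 n6] [n7 n8 n9]].
have oT := orthogonal_map_triple oF.
have c20 j l : wedge (map_triple F) i3_1 j l = coef F 3 (j : 'I_4).+1 1 (l : 'I_4).+1.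
  by rewrite [RHS](coefE F i3_2 i3_0).
have c12 j l : wedge (map_triple F) i3_0 j l = coef F 2 (j : 'I_4).+1 3 (l : 'I_4).+1.
  by rewrite [RHS](coefE F i3_1 i3_2).
have c21 j l : wedge (map_triple F) i3_0 j l = - coef F 3 (j : 'I_4).+1 2 (l : 'I_4).+1.
  by rewrite [X in - X](coefE F i3_2 i3_1) (@triple_anti _ _ i3_1 i3_2 oT) // [X in - X]mxE opprK.
have c01 j l : wedge (map_triple F) i3_2 j l = coef F 1 (j : 'I_4).+1 2 (l : 'I_4).+1.
  by rewrite [RHS](coefE F i3_0 i3_1).
have anti k i j : wedge (map_triple F) k i j = - wedge (map_triple F) k j i.
  by rewrite -[in LHS](trmxK (wedge _ _)) (wedge_skew k oT) !mxE.
split; apply: skew4P; rewrite ?(wedge_skew _ oT) ?normal_wedge0_skew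
  ?normal_wedge1_skew ?normal_wedge2_skew //.
- by rewrite c21 mx4E /= [coef _ _ _ _ _]n3 oppr0.
- by rewrite c21 mx4E /= [coef _ _ _ _ _]n5 oppr0.
- by rewrite anti c12 mx4E.
- by rewrite anti c12 mx4E.
- by rewrite anti c21 mx4E /= [coef _ _ _ _ _]n6 !oppr0.
- by rewrite c21 mx4E /= [coef _ _ _ _ _]n4 oppr0.
- by rewrite c20 mx4E.
- by rewrite c20 mx4E.
- by rewrite c20 mx4E.
- by rewrite c20 mx4E /= /beta; apply/eqP; rewrite -addr_eq0 addrC; apply/eqP.
- by rewrite c20 mx4E.
- by rewrite c20 mx4E.
- by rewrite c01 mx4E.
- by rewrite c01 mx4E /= /F1422; apply/eqP; rewrite -addr_eq0; apply/eqP.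
- by rewrite anti c01 mx4E.
- rewrite c01 mx4E /=.
  transitivity (- coef F 1 1 2 4); first by apply/eqP; rewrite -addr_eq0 addrC; apply/eqP.
  by have := anti i3_2 i4_0 i4_3; rewrite !c01 => /= ->; rewrite opprK.
- by rewrite anti c01 mx4E.
- by rewrite anti c01 mx4E.
Qed.

Lemma wedges_normalized F a b g m n d e p q : orthogonal_multiplication F ->
  has_wedges (map_triple F) (normal_wedge0 m n) (normal_wedge1 a b g) (normal_wedge2 d e p q) ->
  normalized F /\
  [/\ [/\ alpha F = a, beta F = b & gamma F = g], mu F = m /\ nu F = n &
      [/\ F1421 F = d, F1422 F = e, F1122 F = p & F1423 F = q]].
Proof.
move=> oF [h0 h1 h2]; have oT := orthogonal_map_triple oF.
have c20 j l : coef F 3 (j : 'I_4).+1 1 (l : 'I_4).+1 = normal_wedge1 a b g j l.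
  by rewrite -h1; exact: (coefE F i3_2 i3_0).
have c12 j l : coef F 2 (j : 'I_4).+1 3 (l : 'I_4).+1 = normal_wedge0 m n j l.
  by rewrite -h0; exact: (coefE F i3_1 i3_2).
have c21 j l : coef F 3 (j : 'I_4).+1 2 (l : 'I_4).+1 = - normal_wedge0 m n j l.
  rewrite -h0 [LHS](coefE F i3_2 i3_1).
  by rewrite (@triple_anti _ _ i3_1 i3_2 oT) // mxE.
have c01 j l : coef F 1 (j : 'I_4).+1 2 (l : 'I_4).+1 = normal_wedge2 d e p q j l.
  by rewrite -h2; exact: (coefE F i3_0 i3_1).
have E := (c20, c12, c21, c01).
split.
  split; [split|split|split|split].
  - by rewrite (c20 i4_0 i4_1) mx4E.
  - by rewrite (c20 i4_2 i4_3) mx4E.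
  - by rewrite (c21 i4_0 i4_1) mx4E /= oppr0.
  - by rewrite (c21 i4_2 i4_3) mx4E /= oppr0.
  - by rewrite (c21 i4_0 i4_2) mx4E /= oppr0.
  - by rewrite (c21 i4_3 i4_1) mx4E /= oppr0.
  - by rewrite (c01 i4_0 i4_2) (c01 i4_3 i4_1) !mx4E /= addNr.
  - by rewrite (c01 i4_0 i4_3) (c01 i4_1 i4_2) !mx4E /= addNr.
  - by rewrite (c20 i4_0 i4_3) (c20 i4_1 i4_2) !mx4E /= addrN.
split; [split|split|split].
- by rewrite /alpha (c20 i4_0 i4_2) mx4E.
- by rewrite /beta (c20 i4_0 i4_3) mx4E.
- by rewrite /gamma (c20 i4_1 i4_3) mx4E.
- by rewrite /mu (c12 i4_3 i4_0) mx4E.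
- by rewrite /nu (c12 i4_2 i4_1) mx4E.
- by rewrite /F1421 (c01 i4_3 i4_0) mx4E.
- by rewrite /F1422 (c01 i4_3 i4_1) mx4E.
- by rewrite /F1122 (c01 i4_0 i4_1) mx4E.
- by rewrite /F1423 (c01 i4_3 i4_2) mx4E.
Qed.

(** With T_2 = (1 | 0), the left blocks of T_0 and T_1 are dictated by the wedges with
    T_2, and C and D are the right blocks. *)
Lemma realize_wedges (w0 w1 w2 C D : 'M[R]_4) :
  w0^T = - w0 -> w1^T = - w1 -> w2^T = - w2 ->
  C *m C^T = 1%:M + w1 *m w1 -> D *m D^T = 1%:M + w0 *m w0 ->
  C *m D^T = w2 - w1 *m w0 ->
  exists2 T, orthogonal_triple T & has_wedges T w0 w1 w2.
Proof.
move=> s0 s1 s2 hC hD hCD.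
pose T : triple := fun i => nth 0 [:: row_mx (- w1) C; row_mx w0 D; row_mx 1%:M 0] i.
have rm (A B A' B' : 'M[R]_4) : (row_mx A B : 'M[R]_(4, 8)) *m
    (row_mx A' B' : 'M[R]_(4, 8))^T = A *m A'^T + B *m B'^T.
  by rewrite -[RHS]mul_row_col -tr_row_mx.
have g00 : T i3_0 *m (T i3_0)^T = 1%:M.
  rewrite (rm _ _ _ _) linearN /= s1 opprK mulNmx hC.
  by rewrite addrCA addNr addr0.
have g11 : T i3_1 *m (T i3_1)^T = 1%:M.
  rewrite (rm _ _ _ _) s0 mulmxN hD.
  by rewrite addrCA addNr addr0.
have g22 : T i3_2 *m (T i3_2)^T = 1%:M.
  by rewrite (rm _ _ _ _) trmx1 mulmx1 mul0mx addr0.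
have g01 : T i3_0 *m (T i3_1)^T = w2.
  rewrite (rm _ _ _ _) s0 mulmxN mulNmx opprK hCD.
  by rewrite addrCA subrr addr0.
have g12 : T i3_1 *m (T i3_2)^T = w0.
  by rewrite (rm _ _ _ _) trmx1 mulmx1 trmx0 mulmx0 addr0.
have g20 : T i3_2 *m (T i3_0)^T = w1.
  by rewrite (rm _ _ _ _) mul1mx mul0mx addr0 linearN /= s1 opprK.
exists T; last by split.
have tr i j : T j *m (T i)^T = (T i *m (T j)^T)^T by rewrite trmx_mul trmxK.
have two : 1%:M + 1%:M = (true%:R *+ 2)%:M :> 'M[R]_4 by rewrite mulr2n raddfD.
have zero : 0 = (false%:R *+ 2)%:M :> 'M[R]_4 by rewrite mul0rn raddf0.
apply: all_ord3; apply: all_ord3; rewrite ?g00 ?g11 ?g22 ?two //.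
- by rewrite g01 tr g01 s2 subrr zero.
- by rewrite g20 tr g20 s1 addNr zero.
- by rewrite g01 tr g01 s2 addNr zero.
- by rewrite g12 tr g12 s0 subrr zero.
- by rewrite g20 tr g20 s1 subrr zero.
- by rewrite g12 tr g12 s0 addNr zero.
Qed.

Lemma realize_normalized a b g m n d e p q (C D : 'M[R]_4) :
  C *m C^T = 1%:M + normal_wedge1 a b g *m normal_wedge1 a b g ->
  D *m D^T = 1%:M + normal_wedge0 m n *m normal_wedge0 m n ->
  C *m D^T = normal_wedge2 d e p q - normal_wedge1 a b g *m normal_wedge0 m n ->
  exists F, [/\ orthogonal_multiplication F, normalized F &
  [/\ [/\ alpha F = a, beta F = b & gamma F = g], mu F = m /\ nu F = n &
      [/\ F1421 F = d, F1422 F = e, F1122 F = p & F1423 F = q]]].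
Proof.
move=> hC hD hCD.
have [T oT [h0 h1 h2]] := realize_wedges (normal_wedge0_skew _ _) (normal_wedge1_skew _ _ _)
  (normal_wedge2_skew _ _ _ _) hC hD hCD.
have oF := orthogonal_triple_map oT.
exists (triple_map T).
have [|nF eF] := @wedges_normalized (triple_map T) a b g m n d e p q oF.
  by split; rewrite -?h0 -?h1 -?h2 /wedge /= !triple_mapK.
by split.
Qed.

End Moduli.

(** * The grand and degenerate families *)

Section Moduli2.
Variable R : realType.
Implicit Types (F : bilinear_map R 3 4 8).

Lemma grand_wedge1_sqr (a b : R) :
  1%:M + normal_wedge1 a b a *m normal_wedge1 a b a = (1 - a ^+ 2 - b ^+ 2)%:M.
Proof.
by apply/matrixP; apply: all_ord4; apply: all_ord4; rewrite !mxE sum_ord4 !mxE /=; ring.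
Qed.

Lemma grand_wedge0_sqr (m : R) :
  1%:M + normal_wedge0 m (- m) *m normal_wedge0 m (- m) = (1 - m ^+ 2)%:M.
Proof.
by apply/matrixP; apply: all_ord4; apply: all_ord4; rewrite !mxE sum_ord4 !mxE /=; ring.
Qed.

(** The Gram matrix U V^T of triple_complement, for alpha = gamma and mu = - nu. *)
Definition grand_pairing (a b m d e p q : R) : 'M[R]_4 :=
  normal_wedge2 d e p q - normal_wedge1 a b a *m normal_wedge0 m (- m).

Lemma grand_pairingE a b m d e p q : grand_pairing a b m d e p q =
  mx4 [:: [:: - (b * m); p + a * m; - e; - d];
          [:: - p - a * m; - (b * m); d; - e];
          [:: e; - d; - (b * m); - q - a * m];
          [:: d; e; q + a * m; - (b * m)]].
Proof.
by apply/matrixP; apply: all_ord4; apply: all_ord4; rewrite !mxE sum_ord4 !mxE /=; ring.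
Qed.

(** The grand equation says that the pairing is sqrt(xi (1 - m^2)) times an orthogonal
    matrix; C is the scalar sqrt(xi) and D is determined by it, unless xi = 0. *)
Lemma grand_realize (a b m c d f : R) : -1 <= a <= 1 -> -1 <= m <= 1 ->
  b ^+ 2 = (1 - m ^+ 2) * (1 - a ^+ 2) - (f + a * m) ^+ 2 - c ^+ 2 - d ^+ 2 ->
  exists2 F : bilinear_map R 3 4 8, grand F &
    [/\ alpha F = a, beta F = b & mu F = m] /\
    [/\ F1421 F = c, F1422 F = d, F1122 F = f & F1423 F = f].
Proof.
move=> ha hm hb.
have bound (x : R) : -1 <= x <= 1 -> 0 <= 1 - x ^+ 2.
  move=> /andP[x1 x2]; have -> : 1 - x ^+ 2 = (1 - x) * (1 + x) by ring.
  by apply: mulr_ge0; lra.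
have a1 := bound a ha; have m1 := bound m hm.
pose xi := 1 - a ^+ 2 - b ^+ 2.
have xi0 : 0 <= xi.
  have : (1 - m ^+ 2) * (1 - a ^+ 2) <= 1 - a ^+ 2.
    by rewrite ler_piMl // gerBl sqr_ge0.
  rewrite /xi hb => h.
  have : 0 <= (f + a * m) ^+ 2 + c ^+ 2 + d ^+ 2 by rewrite !addr_ge0 ?sqr_ge0.
  by move=> h2; lra.
pose N := grand_pairing a b m c d f f.
have NN : N^T *m N = (xi * (1 - m ^+ 2))%:M.
  have -> : xi * (1 - m ^+ 2) = (b * m) ^+ 2 + (f + a * m) ^+ 2 + c ^+ 2 + d ^+ 2.
    by move: hb; rewrite /xi => hb; lra.
  rewrite /N grand_pairingE.
  by apply/matrixP; apply: all_ord4; apply: all_ord4; rewrite !mxE sum_ord4 !mxE /=; ring.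
have [C [D [hC hD hCD]]] : exists C D : 'M[R]_4, [/\ C *m C^T = xi%:M,
    D *m D^T = (1 - m ^+ 2)%:M & C *m D^T = N].
  have [e|ne] := eqVneq xi 0.
    exists 0, (Num.sqrt (1 - m ^+ 2))%:M; split.
    - by rewrite mul0mx e raddf0.
    - by rewrite tr_scalar_mx -scalar_mxM -expr2 sqr_sqrtr.
    - have N0 : N^T = 0.
        by apply: gram_eq0; rewrite trmxK NN e mul0r raddf0.
      by rewrite mul0mx -[N]trmxK N0 trmx0.
  have s0 : Num.sqrt xi != 0 by rewrite sqrtr_eq0 -ltNge lt_neqAle eq_sym ne.
  exists (Num.sqrt xi)%:M, ((Num.sqrt xi)^-1 *: N^T); split.
  - by rewrite tr_scalar_mx -scalar_mxM -expr2 sqr_sqrtr.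
  - rewrite linearZ /= trmxK -scalemxAl -scalemxAr NN scalerA scale_scalar_mx.
    by rewrite -expr2 exprVn sqr_sqrtr // mulrA mulVf // mul1r.
  - by rewrite linearZ /= trmxK mul_scalar_mx scalerA divff // scale1r.
have [|||F [oF nF [[e1 e2 e3] [e4 e5] e6]]] :=
    @realize_normalized R a b a m (- m) c d f f C D.
- by rewrite grand_wedge1_sqr.
- by rewrite grand_wedge0_sqr.
- by rewrite hCD.
by exists F; split=> //; rewrite ?e1 ?e3 ?e4 ?e5 ?opprK.
Qed.

(** The Gram matrices of U and V are scalar, so N^T N is the scalar xi (1 - mu^2). Its
    diagonal entries give the grand equation, and its off-diagonal entries are the
    products of p - q with F_{14,21} and F_{14,22}. *)
Lemma grand_constraint F : grand F ->
  grand_equation F /\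
  (F1122 F = F1423 F \/
   [/\ F1421 F = 0, F1422 F = 0 &
       F1423 F + alpha F * mu F = - (F1122 F + alpha F * mu F)]).
Proof.
move=> [oF nF ag mn]; have oT := orthogonal_map_triple oF.
have [h0 h1 h2] := normalized_wedges oF nF.
have nm : nu F = - mu F by rewrite mn opprK.
rewrite nm in h0; rewrite -ag in h1.
have [U2 V2 UU VV UV] := triple_complement oT.
rewrite h0 h1 h2 ?grand_wedge1_sqr ?grand_wedge0_sqr
  -/(grand_pairing _ _ _ _ _ _ _) in U2 V2 UU VV UV.
set a := alpha F in UU UV *; set b := beta F in UU UV *; set m := mu F in VV UV *.
set d := F1421 F in UV *; set e := F1422 F in UV *.
set p := F1122 F in UV *; set q := F1423 F in UV *.
pose xi := 1 - a ^+ 2 - b ^+ 2.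
have NN : (grand_pairing a b m d e p q)^T *m grand_pairing a b m d e p q =
    (xi * (1 - m ^+ 2))%:M.
  have [xi0|xi0] := eqVneq xi 0.
    have U0 := gram_eq0 (etrans UU (etrans (congr1 _ xi0) (raddf0 _))).
    by rewrite -UV U0 mul0mx trmx0 mul0mx xi0 mul0r raddf0.
  have := schur_rank (triple_unit _ oT) U2 V2 UU (tr_scalar_mx _ xi)
    (esym (scalar_mxM _ _ _)).
  have -> : forall X Y : 'M[R]_(4, 8), Y *m X^T = (X *m Y^T)^T.
    by move=> X Y; rewrite trmx_mul trmxK.
  rewrite VV UV mul_mx_scalar -scalemxAl scale_scalar_mx -mulrA => h.
  apply: (scalerI xi0); rewrite h scale_scalar_mx.
  by congr (_%:M); ring.
rewrite grand_pairingE in NN.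
have ent i j := congr1 (fun M : 'M[R]_4 => M i j) NN.
have := (ent i4_0 i4_2, ent i4_0 i4_3, ent i4_0 i4_0, ent i4_3 i4_3).
rewrite !mxE !sum_ord4 !mxE /= !mulr1n !mulr0n => -[[[e02 e03] e00] e33] {ent NN}.
have hd : d * (p - q) = 0 by rewrite -[RHS]oppr0 -e02; ring.
have he : e * (p - q) = 0 by rewrite -e03; ring.
have hxy : (p + a * m) ^+ 2 = (q + a * m) ^+ 2.
  apply/eqP; rewrite -subr_eq0; apply/eqP.
  by rewrite -[RHS](subrr (xi * (1 - m ^+ 2))) -{1}e00 -e33; ring.
split.
  rewrite /grand_equation -/a -/b -/m -/d -/e -/p.
  by move: e00; rewrite /xi => e00; lra.
have [pq|pq] := eqVneq p q; [by left|right].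
have pq0 : p - q != 0 by rewrite subr_eq0.
move/eqP: hd; rewrite mulf_eq0 (negbTE pq0) orbF => /eqP ->.
move/eqP: he; rewrite mulf_eq0 (negbTE pq0) orbF => /eqP ->.
split=> //.
move/eqP: hxy; rewrite eqf_sqr => /orP[/eqP /addIr /eqP h|/eqP ->]; last by rewrite opprK.
by rewrite h in pq.
Qed.

Definition degenerate_pairing (a g m n p q : R) : 'M[R]_4 :=
  normal_wedge2 0 0 p q - normal_wedge1 a 0 g *m normal_wedge0 m n.

Lemma degenerate_pairingE a g m n p q : degenerate_pairing a g m n p q =
  mx4 [:: [:: 0; p - a * n; 0; 0]; [:: - p - g * m; 0; 0; 0];
          [:: 0; 0; 0; - q - a * m]; [:: 0; 0; q - g * n; 0]].
Proof.
by apply/matrixP; apply: all_ord4; apply: all_ord4; rewrite !mxE sum_ord4 !mxE /=; ring.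
Qed.

Definition diag4 (a b c d : R) : 'M[R]_4 :=
  mx4 [:: [:: a; 0; 0; 0]; [:: 0; b; 0; 0]; [:: 0; 0; c; 0]; [:: 0; 0; 0; d]].

Lemma degenerate_wedge1_sqr a g : 1%:M + normal_wedge1 a 0 g *m normal_wedge1 a 0 g =
  diag4 (1 - a ^+ 2) (1 - g ^+ 2) (1 - a ^+ 2) (1 - g ^+ 2).
Proof.
by apply/matrixP; apply: all_ord4; apply: all_ord4; rewrite !mxE sum_ord4 !mxE /=; ring.
Qed.

Lemma degenerate_wedge0_sqr m n : 1%:M + normal_wedge0 m n *m normal_wedge0 m n =
  diag4 (1 - m ^+ 2) (1 - n ^+ 2) (1 - n ^+ 2) (1 - m ^+ 2).
Proof.
by apply/matrixP; apply: all_ord4; apply: all_ord4; rewrite !mxE sum_ord4 !mxE /=; ring.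
Qed.

Lemma is_pm_sqr (x y : R) : is_pm x y <-> x ^+ 2 = y ^+ 2.
Proof.
split; first by case=> ->; rewrite ?sqrrN.
by move/eqP; rewrite eqf_sqr => /orP[] /eqP ->; [left|right].
Qed.

Lemma is_pm_sign (x y : R) : is_pm x y -> exists2 s : R, s ^+ 2 = 1 & x = s * y.
Proof.
case=> ->; [exists 1|exists (-1)]; rewrite ?sqrrN ?expr1n ?mul1r ?mulN1r //.
Qed.

(** C is diagonal and D monomial, with sines as entries; the signs of the four equations
    go into D. *)
Lemma degenerate_realize phi psi theta eta p q :
  [/\ angle phi, angle psi, angle theta & angle eta] ->
  degenerate_equations phi psi theta eta p q ->
  exists F : bilinear_map R 3 4 8,
   [/\ degenerate F, angles F phi psi theta eta, F1122 F = p & F1423 F = q].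
Proof.
move=> hang [/is_pm_sign[s1 q1 E1] /is_pm_sign[s2 q2 E2] /is_pm_sign[s3 q3 E3]
  /is_pm_sign[s4 q4 E4]].
pose C := diag4 (sin phi) (sin psi) (sin phi) (sin psi).
pose D : 'M[R]_4 := mx4 [:: [:: 0; s2 * sin theta; 0; 0]; [:: s1 * sin eta; 0; 0; 0];
   [:: 0; 0; 0; s4 * sin eta]; [:: 0; 0; s3 * sin theta; 0]].
have [|||F [oF nF [[e1 e2 e3] [e4 e5] [e6 e7 e8 e9]]]] :=
  @realize_normalized R (cos phi) 0 (cos psi) (cos theta) (cos eta) 0 0 p q C D.
- rewrite degenerate_wedge1_sqr -!sin2cos2.
  by apply/matrixP; apply: all_ord4; apply: all_ord4; rewrite !mxE sum_ord4 !mxE /=; ring.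
- rewrite degenerate_wedge0_sqr -!sin2cos2.
  by apply/matrixP; apply: all_ord4; apply: all_ord4; rewrite !mxE sum_ord4 !mxE /=;
    rewrite ?mul0r ?mulr0 ?add0r ?addr0 -?expr2 ?exprMn ?q1 ?q2 ?q3 ?q4 ?mul1r.
- rewrite -/(degenerate_pairing _ _ _ _ _ _) degenerate_pairingE E1 E2 E3 E4.
  by apply/matrixP; apply: all_ord4; apply: all_ord4; rewrite !mxE sum_ord4 !mxE /=; ring.
by exists F; split=> //; split.
Qed.

Lemma degenerate_equations_constraint (phi psi theta eta p q : R) :
  degenerate_equations phi psi theta eta p q ->
  degenerate_constraint phi psi theta eta p q.
Proof.
have pm x y z : is_pm (z - cos x * cos y) (sin y * sin x) -> is_cos_pm z x y.
  rewrite /is_cos_pm cosD cosB => -[h|h]; [right|left].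
    by rewrite -[z](subrK (cos x * cos y)) h; ring.
  by rewrite -[z](subrK (cos x * cos y)) h; ring.
by move=> [h1 h2 h3 h4]; split; exact: pm.
Qed.

End Moduli2.

(** * Equations of the degenerate family *)

Section Degenerate.
Variable R : realType.
Implicit Types (F : bilinear_map R 3 4 8).

Lemma gram_diag_ge0 m n (U : 'M[R]_(m, n)) i : 0 <= (U *m U^T) i i.
Proof. by rewrite mxE sumr_ge0 // => j _; rewrite mxE -expr2 sqr_ge0. Qed.

Lemma gram_row_eq0 m n k (U : 'M[R]_(m, n)) (V : 'M[R]_(k, n)) i :
  (U *m U^T) i i = 0 -> forall j, (U *m V^T) i j = 0 /\ (V *m U^T) j i = 0.
Proof.
rewrite mxE => /eqP; rewrite psumr_eq0 => [/allP h j|l _]; last first.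
  by rewrite mxE -expr2 sqr_ge0.
have z l : U i l = 0.
  by have := h l (mem_index_enum _); rewrite mxE -expr2 sqrf_eq0 => /eqP.
by split; rewrite mxE big1 // => l _; rewrite !mxE z ?mul0r ?mulr0.
Qed.

(** The configuration in which neither Schur complement determines an entry: both
    factors that could be cancelled vanish and the three other entries of the pairing
    are zero. *)
Lemma unit_pair_relation (p a g m n : R) : 1 - g ^+ 2 = 0 -> 1 - m ^+ 2 = 0 ->
  p = - (g * m) -> a * m = - (g * n) ->
  (p - a * n) ^+ 2 = (1 - n ^+ 2) * (1 - a ^+ 2).
Proof.
move=> /subr0_eq g1 /subr0_eq m1 ep eam.
have a2 : a ^+ 2 = n ^+ 2.
  by rewrite -[a ^+ 2]mulr1 {1}m1 -exprMn eam sqrrN exprMn -g1 mul1r.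
have -> : a * n = p * n ^+ 2.
  by rewrite -[a * n]mulr1 m1 ep; transitivity (a * m * n * m); [ring|rewrite eam; ring].
have -> : p - p * n ^+ 2 = p * (1 - n ^+ 2) by ring.
by rewrite a2 exprMn ep sqrrN exprMn -g1 -m1; ring.
Qed.

(** Each entry x of the pairing satisfies the relation x^2 = y z multiplied by either of
    the two factors that do not occur in it; the case where both are zero is
    unit_pair_relation. *)
Lemma monomial_scalars (a g m n p q : R) :
  let za := 1 - a ^+ 2 in let zg := 1 - g ^+ 2 in
  let zm := 1 - m ^+ 2 in let zn := 1 - n ^+ 2 in
  let x1 := p - a * n in let x2 := - p - g * m in
  let x3 := - q - a * m in let x4 := q - g * n in
  [/\ x1 * zg * x1 = za * zg * zn, x2 * za * x2 = za * zg * zm,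
      x3 * zg * x3 = za * zg * zm & x4 * za * x4 = za * zg * zn] ->
  [/\ x1 * zm * x1 = zm * zn * za, x2 * zn * x2 = zm * zn * zg,
      x3 * zn * x3 = zm * zn * za & x4 * zm * x4 = zm * zn * zg] ->
  [/\ za = 0 -> x1 = 0 /\ x3 = 0, zg = 0 -> x2 = 0 /\ x4 = 0,
      zm = 0 -> x2 = 0 /\ x3 = 0 & zn = 0 -> x1 = 0 /\ x4 = 0] ->
  [/\ x1 ^+ 2 = zn * za, x2 ^+ 2 = zm * zg, x3 ^+ 2 = zm * za & x4 ^+ 2 = zn * zg].
Proof.
move=> za zg zm zn x1 x2 x3 x4 [a1 a2 a3 a4] [b1 b2 b3 b4] [ha hg hm hn].
have cancel (z x y : R) : z != 0 -> x * z * x = z * y -> x ^+ 2 = y.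
  by move=> z0 h; apply: (mulfI z0); rewrite -h; ring.
split.
- have [zg0|zg0] := eqVneq zg 0; last by apply: (cancel zg) => //; rewrite a1; ring.
  have [zm0|zm0] := eqVneq zm 0; last by apply: (cancel zm) => //; rewrite b1; ring.
  have [[e2 e4] [_ e3]] := (hg zg0, hm zm0).
  apply: (unit_pair_relation zg0 zm0); first by move: e2; rewrite /x2 => ?; lra.
  by move: e3 e4; rewrite /x3 /x4 => ? ?; lra.
- have [za0|za0] := eqVneq za 0; last by apply: (cancel za) => //; rewrite a2; ring.
  have [zn0|zn0] := eqVneq zn 0; last by apply: (cancel zn) => //; rewrite b2; ring.
  have [[e1 e3] [_ e4]] := (ha za0, hn zn0).
  apply: (unit_pair_relation za0 zn0); first by move: e1; rewrite /x1 => ?; lra.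
  by move: e3 e4; rewrite /x3 /x4 => ? ?; lra.
- have [zg0|zg0] := eqVneq zg 0; last by apply: (cancel zg) => //; rewrite a3; ring.
  have [zn0|zn0] := eqVneq zn 0; last by apply: (cancel zn) => //; rewrite b3; ring.
  have [[e2 e4] [e1 _]] := (hg zg0, hn zn0).
  apply: (unit_pair_relation zg0 zn0); first by move: e4; rewrite /x4 => ?; lra.
  by move: e1 e2; rewrite /x1 /x2 => ? ?; lra.
- have [za0|za0] := eqVneq za 0; last by apply: (cancel za) => //; rewrite a4; ring.
  have [zm0|zm0] := eqVneq zm 0; last by apply: (cancel zm) => //; rewrite b4; ring.
  have [[e1 e3] [e2 _]] := (ha za0, hm zm0).
  apply: (unit_pair_relation za0 zm0); first by move: e3; rewrite /x3 => ?; lra.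
  by move: e1 e2; rewrite /x1 /x2 => ? ?; lra.
Qed.

(** The two ways of applying schur_rank, to (U, V) and to (V, U), and the fact that a
    zero diagonal entry of a Gram matrix means a zero row. *)
Lemma monomial_gram (a g m n p q : R) (U V : 'M[R]_(4, 8)) (A : 'M[R]_(4, 8)) :
  A *m A^T = 1%:M -> U *m A^T = 0 -> V *m A^T = 0 ->
  U *m U^T = diag4 (1 - a ^+ 2) (1 - g ^+ 2) (1 - a ^+ 2) (1 - g ^+ 2) ->
  V *m V^T = diag4 (1 - m ^+ 2) (1 - n ^+ 2) (1 - n ^+ 2) (1 - m ^+ 2) ->
  U *m V^T = degenerate_pairing a g m n p q ->
  [/\ (p - a * n) ^+ 2 = (1 - n ^+ 2) * (1 - a ^+ 2),
      (- p - g * m) ^+ 2 = (1 - m ^+ 2) * (1 - g ^+ 2),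
      (- q - a * m) ^+ 2 = (1 - m ^+ 2) * (1 - a ^+ 2) &
      (q - g * n) ^+ 2 = (1 - n ^+ 2) * (1 - g ^+ 2)].
Proof.
move=> AA UA VA UU VV; rewrite degenerate_pairingE => UV.
have VU : V *m U^T = (U *m V^T)^T by rewrite trmx_mul trmxK.
set za := 1 - a ^+ 2 in UU *; set zg := 1 - g ^+ 2 in UU *.
set zm := 1 - m ^+ 2 in VV *; set zn := 1 - n ^+ 2 in VV *.
have E1 : (V *m U^T) *m diag4 zg za zg za *m (U *m V^T) = (za * zg) *: (V *m V^T).
  apply: (schur_rank AA UA VA UU).
    by apply/matrixP; apply: all_ord4; apply: all_ord4; rewrite !mxE.
  by apply/matrixP; apply: all_ord4; apply: all_ord4; rewrite !mxE sum_ord4 !mxE /=; ring.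
have E2 : (U *m V^T) *m diag4 zn zm zm zn *m (V *m U^T) = (zm * zn) *: (U *m U^T).
  apply: (schur_rank AA VA UA VV).
    by apply/matrixP; apply: all_ord4; apply: all_ord4; rewrite !mxE.
  by apply/matrixP; apply: all_ord4; apply: all_ord4; rewrite !mxE sum_ord4 !mxE /=; ring.
have rU i : (U *m U^T) i i = 0 -> forall j, (U *m V^T) i j = 0.
  by move=> h j; case: (gram_row_eq0 V h j).
have rV j : (V *m V^T) j j = 0 -> forall i, (U *m V^T) i j = 0.
  by move=> h i; case: (gram_row_eq0 U h i).
rewrite UU in rU; rewrite VV in rV; rewrite VU UV in E1 E2.
rewrite VV in E1; rewrite UU in E2; rewrite UV in rU rV.
have e1 i j := congr1 (fun M : 'M[R]_4 => M i j) E1.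
have e2 i j := congr1 (fun M : 'M[R]_4 => M i j) E2.
apply: monomial_scalars; rewrite -/za -/zg -/zm -/zn.
- split; [have := e1 i4_1 i4_1|have := e1 i4_0 i4_0|have := e1 i4_3 i4_3|have := e1 i4_2 i4_2];
    rewrite !mxE !sum_ord4 !mxE !sum_ord4 !mxE /=; rewrite !(mul0r, mulr0, add0r, addr0) => ->; ring.
- split; [have := e2 i4_0 i4_0|have := e2 i4_1 i4_1|have := e2 i4_2 i4_2|have := e2 i4_3 i4_3];
    rewrite !mxE !sum_ord4 !mxE !sum_ord4 !mxE /=; rewrite !(mul0r, mulr0, add0r, addr0) => ->; ring.
have ru i z : diag4 za zg za zg i i = z -> z = 0 -> forall j, _ := fun e h => rU i (etrans e h).
have rv i z : diag4 zm zn zn zm i i = z -> z = 0 -> forall j, _ := fun e h => rV i (etrans e h).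
split=> z; split.
- by have := ru i4_0 za (mx4E _ _ _) z i4_1; rewrite mx4E.
- by have := ru i4_2 za (mx4E _ _ _) z i4_3; rewrite mx4E.
- by have := ru i4_1 zg (mx4E _ _ _) z i4_0; rewrite mx4E.
- by have := ru i4_3 zg (mx4E _ _ _) z i4_2; rewrite mx4E.
- by have := rv i4_0 zm (mx4E _ _ _) z i4_1; rewrite mx4E.
- by have := rv i4_3 zm (mx4E _ _ _) z i4_2; rewrite mx4E.
- by have := rv i4_1 zn (mx4E _ _ _) z i4_0; rewrite mx4E.
- by have := rv i4_2 zn (mx4E _ _ _) z i4_3; rewrite mx4E.
Qed.

Lemma acos_angle (x : R) : -1 <= x <= 1 -> angle (acos x) /\ x = cos (acos x).
Proof. by move=> h; rewrite /angle acos_ge0 // acos_lepi // acosK. Qed.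

Lemma sqr_le1_bounds (x : R) : 0 <= 1 - x ^+ 2 -> -1 <= x <= 1.
Proof. by move=> h; apply/andP; split; nra. Qed.

Lemma degenerate_angles F : degenerate F -> exists phi psi theta eta : R,
  angles F phi psi theta eta /\
  degenerate_equations phi psi theta eta (F1122 F) (F1423 F).
Proof.
move=> [oF nF [b0 d0 e0]]; have oT := orthogonal_map_triple oF.
have [h0 h1 h2] := normalized_wedges oF nF.
rewrite b0 in h1; rewrite d0 e0 in h2.
have [U2 V2 UU VV UV] := triple_complement oT.
move: UU VV UV U2 V2; set U := map_triple F i3_0 + _; set V := map_triple F i3_1 - _ => UU VV UV U2 V2.
rewrite h1 degenerate_wedge1_sqr in UU; rewrite h0 degenerate_wedge0_sqr in VV.
rewrite h0 h1 h2 -/(degenerate_pairing _ _ _ _ _ _) in UV.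
have [s1 s2 s3 s4] := monomial_gram (triple_unit _ oT) U2 V2 UU VV UV.
have gU i := gram_diag_ge0 U i; have gV i := gram_diag_ge0 V i.
have ra : -1 <= alpha F <= 1.
  by apply: sqr_le1_bounds; have := gU i4_0; rewrite UU mx4E.
have rg : -1 <= gamma F <= 1.
  by apply: sqr_le1_bounds; have := gU i4_1; rewrite UU mx4E.
have rm : -1 <= mu F <= 1.
  by apply: sqr_le1_bounds; have := gV i4_0; rewrite VV mx4E.
have rn : -1 <= nu F <= 1.
  by apply: sqr_le1_bounds; have := gV i4_1; rewrite VV mx4E.
exists (acos (alpha F)), (acos (gamma F)), (acos (mu F)), (acos (nu F)).
have [a1 a2] := acos_angle ra; have [g1 g2] := acos_angle rg.
have [m1 m2] := acos_angle rm; have [n1 n2] := acos_angle rn.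
split; first by split.
by split; apply/is_pm_sqr; rewrite exprMn !sin2cos2 -?a2 -?g2 -?m2 -?n2.
Qed.

End Degenerate.

(** * Every multiplication is equivalent to a degenerate one *)

Section Equiv.
Variable R : realType.
Implicit Types (F : bilinear_map R 3 4 8).

(** Diagonal P and Q become antidiagonal: the normalization attaches the first self-dual
    axis to the pair (e_1, e_2), whose cross product is e_3. *)
Definition antidiag : 'M[R]_3 := mx3 0 0 1 0 (-1) 0 1 0 0.

Lemma is_rot_antidiag : is_rot antidiag.
Proof.
have h2 : (2 : R) != 0 by rewrite pnatr_eq0.
have s2 : Num.sqrt 2 ^+ 2 = 2 :> R by rewrite sqr_sqrtr.
pose x : R := (Num.sqrt 2)^-1.
have x2 : 2 * x ^+ 2 = 1 by rewrite exprVn s2 divff.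
exists 0, x, 0, x; split; first by lra.
by apply/matrixP; apply: all_ord3; apply: all_ord3; rewrite !mxE /=; lra.
Qed.

Lemma equivalent_degenerate F : orthogonal_multiplication F ->
  exists2 G, equivalent F G & degenerate G.
Proof.
move=> oF; have oT := orthogonal_map_triple oF.
have [U [h [rU sh dP dQ]]] := diagonal_form oT.
have oT1 := orthogonal_fibre_change sh (orthogonal_source_change rU oT).
have [h' sh' hE] := rot_pair_lift is_rot_antidiag is_rot_antidiag.
have oT2 := orthogonal_fibre_change sh' oT1.
have [eP eQ] := sd_mx_fibre_change oT1 hE.
set T1 := fibre_change h _ in oT1 oT2 dP dQ eP eQ; set T2 := fibre_change h' T1 in oT2 eP eQ.
have oG := orthogonal_triple_map oT2.
exists (triple_map T2).
  have [hh dh] := special_mul sh' sh; have [UU dU] := special_rot rU.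
  exists U, (h' *m h), 1%:M; split; [by split|by split| |].
    by rewrite /orthogonal_mx trmx1 mulmx1.
  move=> x y; rewrite mulmx1 (map_tripleE F) /triple_map /= /triple_fun.
  transitivity
    (\sum_i \sum_j (x 0 i * U i j) *: (y *m (h' *m h) *m map_triple F j)).
    apply: eq_bigr => i _; rewrite /T2 /T1 /fibre_change /source_change !mulmx_sumr scaler_sumr.
    by apply: eq_bigr => j _; rewrite -!scalemxAr scalerA !mulmxA.
  rewrite exchange_big; apply: eq_bigr => j _ /=.
  by rewrite mxE -scaler_suml.
have wE k : wedge T2 k = skew6 (sd_mx T2 i3_0 k) (sd_mx T2 i3_1 k) (sd_mx T2 i3_2 k)
    (asd_mx T2 i3_0 k) (asd_mx T2 i3_1 k) (asd_mx T2 i3_2 k).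
  by rewrite {1}(skewE (wedge_skew k oT2)) /skew /skew6 /sd_mx /asd_mx ![(\matrix_(_, _) _) _ _]mxE.
have z (M : 'M[R]_3) : is_diag_mx M ->
    [/\ (antidiag *m M) i3_0 i3_0 = 0, (antidiag *m M) i3_1 i3_0 = 0 &
        (antidiag *m M) i3_0 i3_1 = 0] /\
    [/\ (antidiag *m M) i3_2 i3_1 = 0, (antidiag *m M) i3_1 i3_2 = 0 &
        (antidiag *m M) i3_2 i3_2 = 0].
  move=> /is_diag_mxP d; split; split;
    rewrite mxE sum_ord3 !mx3E /= ?(d i3_0 i3_1) ?(d i3_0 i3_2) ?(d i3_1 i3_0) ?(d i3_1 i3_2)
      ?(d i3_2 i3_0) ?(d i3_2 i3_1) //; ring.
have [[p1 p2 p3] [p4 p5 p6]] := z _ dP; have [[q1 q2 q3] [q4 q5 q6]] := z _ dQ.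
rewrite -eP in p1 p2 p3 p4 p5 p6; rewrite -eQ in q1 q2 q3 q4 q5 q6.
have [|nG [[_ b0 _] _ [d0 e0 _ _]]] := @wedges_normalized R (triple_map T2)
  (sd_mx T2 i3_1 i3_1 + asd_mx T2 i3_1 i3_1) 0 (asd_mx T2 i3_1 i3_1 - sd_mx T2 i3_1 i3_1)
  (- (sd_mx T2 i3_2 i3_0 + asd_mx T2 i3_2 i3_0)) (asd_mx T2 i3_2 i3_0 - sd_mx T2 i3_2 i3_0)
  0 0 (sd_mx T2 i3_0 i3_2 + asd_mx T2 i3_0 i3_2) (asd_mx T2 i3_0 i3_2 - sd_mx T2 i3_0 i3_2) oG.
  have wT k : wedge (map_triple (triple_map T2)) k = wedge T2 k.
    by rewrite /wedge !triple_mapK.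
  split; rewrite wT wE ?p1 ?p2 ?p3 ?p4 ?p5 ?p6 ?q1 ?q2 ?q3 ?q4 ?q5 ?q6.
  - by apply/matrixP; apply: all_ord4; apply: all_ord4; rewrite !mx4E /=; ring.
  - by apply/matrixP; apply: all_ord4; apply: all_ord4; rewrite !mx4E /=; ring.
  - by apply/matrixP; apply: all_ord4; apply: all_ord4; rewrite !mx4E /=; ring.
by split.
Qed.

End Equiv.

(** * Dimension of the grand moduli *)

Section Dimension.
Variable R : realType.

(** The coordinates in I range over a box around x while staying in S, the other
    coordinates being unspecified; x is also defined outside I for convenience. *)
Definition movable n (S : set 'rV[R]_n) (I : pred 'I_n) (x : 'I_n -> R) (r : R) :=
  0 < r /\ forall y : 'I_n -> R, (forall k, `|y k - x k| < r) ->
    exists2 v, S v & forall k, I k -> v 0 k = y k.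

Definition shift n (x : 'I_n -> R) i s : 'I_n -> R := fun k => x k + (k == i)%:R * s.

Lemma movable_interior n (S : set 'rV[R]_n) m (f : 'I_m -> 'I_n) :
  injective f -> interior (colsub f @` S) !=set0 ->
  exists x r, movable S (mem (codom f)) x r.
Proof.
move=> fI [z /nbhs_ballP[r /= r0 hr]].
(* The value 0 at coordinates outside the image of f is arbitrary. *)
exists (fun k => if [pick j | f j == k] is Some j then z 0 j else 0), r.
split=> // y hy; have [|v Sv ev] := hr (\row_j y (f j)).
  split=> // i j; rewrite ord1 !mxE; have := hy (f j).
  case: pickP => [j' /eqP/fI ->|/(_ j)]; last by rewrite eqxx.
  by rewrite -ball_normE /= distrC.
exists v => // k /codomP[j ->].
by have := congr1 (fun w : 'rV[R]_m => w 0 j) ev; rewrite !mxE.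
Qed.

Lemma card_codom_sum n m (f : 'I_m -> 'I_n) : injective f ->
  m = (\sum_(k < n) (k \in codom f))%N.
Proof.
by move=> fI; rewrite -[LHS]card_ord -(card_codom fI) -sum1_card big_mkcond.
Qed.

Lemma movable_shift n (S : set 'rV[R]_n) I x r i s : movable S I x r ->
  `|s| < r / 2 -> movable S I (shift x i s) (r / 2).
Proof.
move=> [r0 h] hs; split=> [|y hy]; first by rewrite divr_gt0.
apply: h => k; rewrite (splitr r).
have -> : y k - x k = (y k - shift x i s k) + (k == i)%:R * s by rewrite /shift; ring.
apply: (le_lt_trans (ler_normD _ _)); apply: ltrD => //.
by case: (k == i); rewrite ?mul1r ?mul0r ?normr0 // divr_gt0.
Qed.

Lemma movable_line n (S : set 'rV[R]_n) I x r i s : movable S I x r -> `|s| < r ->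
  exists2 v, S v & forall k, I k -> v 0 k = shift x i s k.
Proof.
move=> [r0 h] hs; apply: h => k; rewrite /shift addrC addKr.
by case: (k == i); rewrite ?mul1r ?mul0r ?normr0.
Qed.

Lemma movable_point n (S : set 'rV[R]_n) I x r : movable S I x r ->
  exists2 v, S v & forall k, I k -> v 0 k = x k.
Proof. by move=> [r0 h]; apply: h => k; rewrite subrr normr0. Qed.

Lemma shiftE n (x : 'I_n -> R) i s k :
  shift x i s k = if k == i then x k + s else x k.
Proof. by rewrite /shift; case: (k == i); rewrite ?mul1r ?mul0r ?addr0. Qed.

Lemma movable_neq n (S : set 'rV[R]_n) I x r i a : movable S I x r ->
  exists x' r', movable S I x' r' /\ x' i != a.
Proof.
move=> mS; have [e|ne] := eqVneq (x i) a; last by exists x, r.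
have r0 := mS.1.
exists (shift x i (r / 4)), (r / 2); split.
  apply: movable_shift => //; rewrite gtr0_norm ?divr_gt0 //.
  by rewrite ltr_pM2l // ltf_pV2 ?posrE // ltr_nat.
by rewrite shiftE eqxx e -subr_eq0 addrC addKr gt_eqF // divr_gt0.
Qed.

Lemma movable_sign n (S : set 'rV[R]_n) (I : pred 'I_n) x r i j s : movable S I x r ->
  (forall v, S v -> v 0 i = s * v 0 j) -> i != j -> I i -> I j -> False.
Proof.
move=> mS hS ij Ii Ij.
have r0 := mS.1; have [v Sv ev] := movable_point mS.
have [|w Sw ew] := @movable_line _ _ _ _ _ i (r / 2) mS.
  by rewrite gtr0_norm ?divr_gt0 // ltr_pdivrMr // ltr_pMr // ltr1n.
have := hS w Sw; rewrite !ew // !shiftE eqxx [j == i]eq_sym (negbTE ij).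
have := hS v Sv; rewrite !ev // => -> /eqP.
by rewrite -subr_eq0 addrC addKr mulf_eq0 (gt_eqF r0) invr_eq0 pnatr_eq0.
Qed.

Lemma movable_small n (S : set 'rV[R]_n) I x r : movable S I x r ->
  exists2 h : R, h != 0 & forall c : R, `|c| <= 4 -> `|c * h| < r.
Proof.
move=> [r0 _]; exists (r / 8); first by rewrite gt_eqF // divr_gt0.
move=> c c4; rewrite normrM [X in _ * X]gtr0_norm ?divr_gt0 //.
apply: (@le_lt_trans _ _ (4 * (r / 8))); first by rewrite ler_pM2r // divr_gt0.
by lra.
Qed.

(** The second difference of the relation with step h is 2 h^2. *)
Lemma movable_quadratic n (S : set 'rV[R]_n) (I : pred 'I_n) x r i (B C : R) :
  movable S I x r -> I i ->
  (forall v, S v -> (forall k, I k -> k != i -> v 0 k = x k) ->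
     v 0 i ^+ 2 + B * v 0 i + C = 0) -> False.
Proof.
move=> mS Ii hS; have [h h0 hr] := movable_small mS.
have pt c : `|c| <= 4 -> (x i + c * h) ^+ 2 + B * (x i + c * h) + C = 0.
  move=> /hr hc; have [v Sv ev] := @movable_line _ _ _ _ _ i (c * h) mS hc.
  have := hS v Sv; rewrite ev // shiftE eqxx; apply=> k Ik /negbTE ki.
  by rewrite ev // shiftE ki.
have e0 := pt 0; have e1 := pt 1; have e2 := pt (-1).
move: e0 e1 e2; rewrite normr0 normrN1 normr1 ler0n ler1n => e0 e1 e2.
have /eqP : 2 * h ^+ 2 = 0.
  transitivity (0 + 0 - 2 * 0 : R); last by ring.
  by rewrite -{1}(e1 isT) -{1}(e2 isT) -(e0 isT); ring.
by rewrite mulf_eq0 pnatr_eq0 /= sqrf_eq0 (negbTE h0).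
Qed.

(** The fourth difference of the relation with step h is 24 h^4. *)
Lemma movable_quartic n (S : set 'rV[R]_n) (I : pred 'I_n) x r i (A B C D : R) :
  movable S I x r -> I i ->
  (forall v, S v -> (forall k, I k -> k != i -> v 0 k = x k) ->
     v 0 i ^+ 4 + A * v 0 i ^+ 3 + B * v 0 i ^+ 2 + C * v 0 i + D = 0) -> False.
Proof.
move=> mS Ii hS; have [h h0 hr] := movable_small mS.
pose f y := y ^+ 4 + A * y ^+ 3 + B * y ^+ 2 + C * y + D.
have pt c : `|c| <= 4 -> f (x i + c * h) = 0.
  move=> /hr hc; have [v Sv ev] := @movable_line _ _ _ _ _ i (c * h) mS hc.
  have := hS v Sv; rewrite ev // shiftE eqxx; apply=> k Ik /negbTE ki.
  by rewrite ev // shiftE ki.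
have n4 (c : nat) : (c <= 4)%N -> f (x i + c%:R * h) = 0.
  by move=> c4; apply: pt; rewrite ger0_norm ?ler_nat.
have /eqP : 24 * h ^+ 4 = 0.
  transitivity (f (x i + 0 * h) - 4 * f (x i + 1 * h) + 6 * f (x i + 2 * h)
    - 4 * f (x i + 3 * h) + f (x i + 4 * h)); first by rewrite /f; ring.
  by rewrite (n4 0%N) // (n4 1%N) // (n4 2%N) // (n4 3%N) // (n4 4%N) //; ring.
by rewrite mulf_eq0 pnatr_eq0 /= expf_eq0 (negbTE h0).
Qed.

(** The relation says that v_i, v_j and v_k are, up to sign, the off-diagonal entries of
    a singular 3 x 3 correlation matrix; it is monic in each coordinate. *)
Lemma movable_triangle n (S : set 'rV[R]_n) (I : pred 'I_n) x r i j k (s : R) :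
  movable S I x r -> i != j -> i != k -> I i -> I j -> I k ->
  (forall v, S v -> v 0 i ^+ 2 + v 0 j ^+ 2 + v 0 k ^+ 2
     - 2 * s * v 0 i * v 0 j * v 0 k = 1) -> False.
Proof.
move=> mS ij ik Ii Ij Ik hS.
apply: (@movable_quadratic _ _ _ _ _ i (- 2 * s * x j * x k)
  (x j ^+ 2 + x k ^+ 2 - 1) mS Ii) => v Sv ev.
by have := hS v Sv; rewrite (ev j) 1?eq_sym // (ev k) 1?eq_sym // => e; lra.
Qed.

(** Eliminating v_l from two such relations leaves a polynomial which is monic of degree
    4 in v_i. *)
Lemma movable_square n (S : set 'rV[R]_n) (I : pred 'I_n) x r i j k m l (s t : R) :
  movable S I x r -> i != j -> i != k -> i != m -> I i -> I j -> I k -> I m ->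
  s ^+ 2 = 1 ->
  (forall v, S v -> v 0 l ^+ 2 + v 0 i ^+ 2 + v 0 j ^+ 2
     - 2 * s * v 0 l * v 0 i * v 0 j = 1) ->
  (forall v, S v -> v 0 l ^+ 2 + v 0 k ^+ 2 + v 0 m ^+ 2
     - 2 * t * v 0 l * v 0 k * v 0 m = 1) -> False.
Proof.
move=> mS ij ik im Ii Ij Ik Im s2 h1 h2.
pose b := x j; pose c := x k; pose d := x m.
pose w := b ^+ 2 - c ^+ 2 - d ^+ 2; pose e := t * c * d.
apply: (@movable_quartic _ _ _ _ _ i (- 4 * s * b * e)
  (2 * w + 4 * e ^+ 2 + 4 * (b ^+ 2 - 1) * b ^+ 2 - 4 * b ^+ 2 * w)
  (- 8 * s * b * e * (b ^+ 2 - 1) + 4 * s * b * e * w)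
  (w ^+ 2 + 4 * e ^+ 2 * (b ^+ 2 - 1)) mS Ii) => v Sv ev.
have := h1 v Sv; have := h2 v Sv.
rewrite (ev j) 1?eq_sym // (ev k) 1?eq_sym // (ev m) 1?eq_sym // -/b -/c -/d.
move: (v 0 i) (v 0 l) => a z e2 e1.
have hw : a ^+ 2 + w = 2 * z * (s * a * b - e) by rewrite /w /e; lra.
transitivity ((a ^+ 2 + w) ^+ 2 + 4 * (s * a * b - e) ^+ 2 * (a ^+ 2 + b ^+ 2 - 1)
  - 4 * s * a * b * (s * a * b - e) * (a ^+ 2 + w)).
  by move/eqP: s2; rewrite sqrf_eq1 => /orP[] /eqP ->; ring.
rewrite hw; transitivity (4 * (s * a * b - e) ^+ 2 *
  (z ^+ 2 + a ^+ 2 + b ^+ 2 - 2 * s * z * a * b - 1)); first by ring.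
by rewrite e1 subrr mulr0.
Qed.

Definition i9 (i : nat) : 'I_9 := inord i.

Lemma sum_ord9 (P : pred 'I_9) : (\sum_(k < 9) P k)%N =
  (P (i9 0) + P (i9 1) + P (i9 2) + P (i9 3) + P (i9 4) + P (i9 5) + P (i9 6)
   + P (i9 7) + P (i9 8))%N.
Proof.
rewrite 9!big_ord_recl big_ord0 addn0 !addnA.
by do 8?[congr addn]; congr (nat_of_bool (P _)); apply: val_inj; rewrite /i9 /= inordK.
Qed.

Lemma coords_entry (F : bilinear_map R 3 4 8) : let v := coords F in
  [/\ [/\ v 0 (i9 0) = alpha F, v 0 (i9 1) = beta F & v 0 (i9 2) = gamma F],
      [/\ v 0 (i9 3) = mu F, v 0 (i9 4) = nu F & v 0 (i9 5) = F1421 F] &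
      [/\ v 0 (i9 6) = F1422 F, v 0 (i9 7) = F1122 F & v 0 (i9 8) = F1423 F]].
Proof. by rewrite /coords; split; split; rewrite mxE /i9 inordK. Qed.

Lemma i9_eq i j : (i < 9)%N -> (j < 9)%N -> (i9 i == i9 j) = (i == j).
Proof. by move=> hi hj; rewrite -val_eqE /= !inordK. Qed.

Lemma interior_near0 n (S : set 'rV[R]_n) m (f : 'I_m -> 'I_n) r : 0 < r ->
  (forall w : 'rV[R]_m, (forall j, `|w 0 j| < r) -> exists2 v, S v & colsub f v = w) ->
  interior (colsub f @` S) !=set0.
Proof.
move=> r0 h; exists 0; apply/nbhs_ballP; exists r => //= w [_ bw].
have [|v Sv ev] := h w; last by exists v.
by move=> j; have := bw 0 j; rewrite -ball_normE /= mxE sub0r normrN.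
Qed.

Definition grand_coords : set 'rV[R]_9 :=
  [set coords F | F in [set F : bilinear_map R 3 4 8 | grand F]].

Lemma grand_coordsP v : grand_coords v ->
  [/\ v 0 (i9 0) = v 0 (i9 2), v 0 (i9 3) = - v 0 (i9 4),
      v 0 (i9 1) ^+ 2 = (1 - v 0 (i9 3) ^+ 2) * (1 - v 0 (i9 0) ^+ 2)
        - (v 0 (i9 7) + v 0 (i9 0) * v 0 (i9 3)) ^+ 2
        - v 0 (i9 5) ^+ 2 - v 0 (i9 6) ^+ 2 &
      v 0 (i9 7) = v 0 (i9 8) \/ (v 0 (i9 5) = 0 /\ v 0 (i9 6) = 0)].
Proof.
move=> [F /= gF <-]; have [[-> -> ->] [-> -> ->] [-> -> ->]] := coords_entry F.
have [eq alt] := grand_constraint gF; have [_ _ ag mn] := gF.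
by split=> //; case: alt => [->|[-> -> _]]; [left|right].
Qed.

Lemma movable_ne_coord n (S : set 'rV[R]_n) I x r i j : movable S I x r -> i != j ->
  exists x' r', movable S I x' r' /\ x' i != x' j.
Proof.
move=> mS ij; have [e|ne] := eqVneq (x i) (x j); last by exists x, r.
have r0 := mS.1.
exists (shift x i (r / 4)), (r / 2); split.
  apply: movable_shift => //; rewrite gtr0_norm ?divr_gt0 //.
  by rewrite ltr_pM2l // ltf_pV2 ?posrE // ltr_nat.
rewrite !shiftE eqxx [j == i]eq_sym (negbTE ij) e.
by rewrite -subr_eq0 addrC addKr gt_eqF // divr_gt0.
Qed.

(** Moving p makes it different from q, and this forces F_{14,21} = F_{14,22} = 0. *)
Lemma grand_no_pq_delta (I : pred 'I_9) x r i : movable grand_coords I x r ->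
  i = i9 5 \/ i = i9 6 -> I (i9 7) -> I (i9 8) -> I i -> False.
Proof.
move=> mS hi I7 I8 Ii.
have n78 : i9 7 != i9 8 by rewrite i9_eq.
have [{mS}x' [{}r [mS ne]]] := movable_ne_coord mS n78.
have zero v : grand_coords v -> v 0 (i9 7) != v 0 (i9 8) -> v 0 i = 0.
  by move=> /grand_coordsP[_ _ _ [->|[e5 e6]]]; rewrite ?eqxx //; case: hi => ->.
have r0 := mS.1; have [v Sv ev] := movable_point mS.
have [|w Sw ew] := @movable_line _ _ _ _ _ i (r / 2) mS.
  by rewrite gtr0_norm ?divr_gt0 // ltr_pdivrMr // ltr_pMr // ltr1n.
have [i7 i8] : i9 7 != i /\ i9 8 != i by case: hi => ->; rewrite !i9_eq.
have := zero w Sw; rewrite !ew // !shiftE (negbTE i7) (negbTE i8) eqxx => /(_ ne).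
have := zero v Sv; rewrite !ev // => /(_ ne) -> /eqP.
by rewrite add0r mulf_eq0 (gt_eqF r0) invr_eq0 pnatr_eq0.
Qed.

(** Near a point with F_{14,21} <> 0 one has p = q, and then the grand equation
    determines beta^2 from the other free coordinates. *)
Lemma grand_no_beta (I : pred 'I_9) x r : movable grand_coords I x r ->
  I (i9 1) -> I (i9 5) -> I (i9 6) -> I (i9 0) || I (i9 2) ->
  I (i9 3) || I (i9 4) -> I (i9 7) || I (i9 8) -> False.
Proof.
move=> mS I1 I5 I6 I02 I34 I78.
have [{mS}y [{}r [mS ne]]] := movable_neq (i9 5) 0 mS.
pose a := if I (i9 0) then y (i9 0) else y (i9 2).
pose m := if I (i9 3) then y (i9 3) else - y (i9 4).
pose p := if I (i9 7) then y (i9 7) else y (i9 8).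
apply: (@movable_quadratic _ _ _ _ _ (i9 1) 0
  (- ((1 - m ^+ 2) * (1 - a ^+ 2) - (p + a * m) ^+ 2 - y (i9 5) ^+ 2 - y (i9 6) ^+ 2))
  mS I1) => v /grand_coordsP[e02 e34 e1 e78] ev.
have ea : v 0 (i9 0) = a.
  rewrite /a; case: ifP I02 => [h _|_ /= h]; first by rewrite ev ?i9_eq.
  by rewrite e02 ev ?i9_eq.
have em : v 0 (i9 3) = m.
  rewrite /m; case: ifP I34 => [h _|_ /= h]; first by rewrite ev ?i9_eq.
  by rewrite e34 ev ?i9_eq.
have e5 : v 0 (i9 5) = y (i9 5) by rewrite ev ?i9_eq.
have e6 : v 0 (i9 6) = y (i9 6) by rewrite ev ?i9_eq.
have ep : v 0 (i9 7) = p.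
  rewrite /p; case: ifP I78 => [h _|_ /= h]; first by rewrite ev ?i9_eq.
  case: e78 => [->|[h5 _]]; first by rewrite ev ?i9_eq.
  by move: ne; rewrite -e5 h5 eqxx.
by rewrite e1 ea em ep e5 e6 mul0r addr0 subrr.
Qed.

(** At most one coordinate of each of the pairs (alpha, gamma) and (mu, nu) is free. If
    both p and q are free, then F_{14,21} and F_{14,22} are not; otherwise grand_no_beta
    excludes one more coordinate. *)
Lemma grand_dim_le m (f : 'I_m -> 'I_9) : injective f ->
  interior (colsub f @` grand_coords) !=set0 -> (m <= 5)%N.
Proof.
move=> fI /(movable_interior fI)[x [r mS]].
rewrite (card_codom_sum fI) (sum_ord9 (fun k => k \in codom f)).
have n02 : (i9 0 \in codom f) && (i9 2 \in codom f) = false.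
  apply/negP => /andP[h h'].
  apply: (@movable_sign _ _ _ _ _ (i9 0) (i9 2) 1 mS _ _ h h'); last by rewrite i9_eq.
  by move=> v /grand_coordsP[-> _ _ _]; rewrite mul1r.
have n34 : (i9 3 \in codom f) && (i9 4 \in codom f) = false.
  apply/negP => /andP[h h'].
  apply: (@movable_sign _ _ _ _ _ (i9 3) (i9 4) (-1) mS _ _ h h'); last by rewrite i9_eq.
  by move=> v /grand_coordsP[_ -> _ _]; rewrite mulN1r.
have n785 : [&& i9 7 \in codom f, i9 8 \in codom f & i9 5 \in codom f] = false.
  apply/negP => /and3P[h h' h''].
  by apply: (grand_no_pq_delta mS _ h h' h''); left.
have n786 : [&& i9 7 \in codom f, i9 8 \in codom f & i9 6 \in codom f] = false.
  apply/negP => /and3P[h h' h''].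
  by apply: (grand_no_pq_delta mS _ h h' h''); right.
have nb : [&& i9 1 \in codom f, i9 5 \in codom f, i9 6 \in codom f,
    (i9 0 \in codom f) || (i9 2 \in codom f), (i9 3 \in codom f) || (i9 4 \in codom f)
    & (i9 7 \in codom f) || (i9 8 \in codom f)] = false.
  apply/negP => /and5P[i1 i5 i6 i02 /andP[i34 i78]].
  exact: (grand_no_beta mS i1 i5 i6 i02 i34 i78).
move: n02 n34 n785 n786 nb.
case: (i9 0 \in _); case: (i9 2 \in _) => //; case: (i9 3 \in _); case: (i9 4 \in _) => //;
by case: (i9 7 \in _); case: (i9 8 \in _); case: (i9 5 \in _); case: (i9 6 \in _);
   case: (i9 1 \in _).
Qed.

Lemma grand_dim_ge : exists2 f : 'I_5 -> 'I_9, injective f &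
  interior (colsub f @` [set coords F | F in
    [set F : bilinear_map R 3 4 8 | grand F /\ F1122 F = F1423 F]]) !=set0.
Proof.
pose f (i : 'I_5) : 'I_9 := i9 (nth 0%N [:: 0; 3; 5; 6; 7]%N i).
exists f.
  move=> i j /eqP; rewrite /f.
  by case: i => [[|[|[|[|[|i]]]]] hi] //; case: j => [[|[|[|[|[|j]]]]] hj] //;
    rewrite i9_eq //= => _; apply: val_inj.
apply: (@interior_near0 _ _ _ _ (1 / 4)) => // w hw.
pose x k := w 0 (inord k).
have hx k : `|x k| < 1 / 4 by exact: hw.
have sq k : x k ^+ 2 < 1 / 16.
  rewrite -real_normK ?num_real //; have := hx k; have := normr_ge0 (x k).
  by move: `|x k| => t t0 t1; nra.
have bd k : -1 <= x k <= 1.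
  by have := hx k; rewrite ltr_norml => /andP[h1 h2]; apply/andP; split; lra.
pose a := x 0%N; pose m := x 1%N; pose c := x 2%N; pose d := x 3%N; pose p := x 4%N.
have pos : 0 <= (1 - m ^+ 2) * (1 - a ^+ 2) - (p + a * m) ^+ 2 - c ^+ 2 - d ^+ 2.
  have := (sq 0%N, sq 1%N, sq 2%N, sq 3%N, sq 4%N); rewrite -/a -/m -/c -/d -/p.
  move=> [[[[ha hm] hc] hd] hp].
  have := (sqr_ge0 a, sqr_ge0 m, sqr_ge0 (p - a * m)).
  have am : a ^+ 2 * m ^+ 2 <= 1 / 16.
    by have := (sqr_ge0 a, sqr_ge0 m) => -[? ?]; nra.
  move=> [[a0 m0] pam].
  have h1 : (p + a * m) ^+ 2 <= 2 * p ^+ 2 + 2 * (a ^+ 2 * m ^+ 2) by lra.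
  have : (1 - m ^+ 2) * (1 - a ^+ 2) = 1 - m ^+ 2 - a ^+ 2 + a ^+ 2 * m ^+ 2 by ring.
  by have := mulr_ge0 a0 m0; lra.
have [F gF [[ea eb em] [ec ed ep eq]]] :=
  @grand_realize R a (Num.sqrt _) m c d p (bd _) (bd _) (sqr_sqrtr pos).
exists (coords F); first by exists F => //=; rewrite ep eq.
apply/rowP => i; rewrite mxE /f.
have [[h0 h1 h2] [h3 h4 h5] [h6 h7 h8]] := coords_entry F.
case: i => [[|[|[|[|[|i]]]]] hi] //=; rewrite ?h0 ?h3 ?h5 ?h6 ?h7 ?ea ?em ?ec ?ed ?ep;
  by congr (w 0 _); apply: val_inj; rewrite /= inordK.
Qed.

End Dimension.

(** * Dimension of the degenerate moduli *)

Section Final.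
Variable R : realType.

Definition degenerate_coords : set 'rV[R]_9 :=
  [set coords F | F in [set F : bilinear_map R 3 4 8 | degenerate F]].

(** The four relations are supported on four faces of the octahedron with opposite
    vertices alpha, gamma; mu, nu; and p, q. *)
Lemma degenerate_coordsP v : degenerate_coords v ->
  [/\ v 0 (i9 1) = 0, v 0 (i9 5) = 0 & v 0 (i9 6) = 0] /\
  [/\ v 0 (i9 7) ^+ 2 + v 0 (i9 0) ^+ 2 + v 0 (i9 4) ^+ 2
        - 2 * 1 * v 0 (i9 7) * v 0 (i9 0) * v 0 (i9 4) = 1,
      v 0 (i9 7) ^+ 2 + v 0 (i9 2) ^+ 2 + v 0 (i9 3) ^+ 2
        - 2 * (-1) * v 0 (i9 7) * v 0 (i9 2) * v 0 (i9 3) = 1,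
      v 0 (i9 8) ^+ 2 + v 0 (i9 0) ^+ 2 + v 0 (i9 3) ^+ 2
        - 2 * (-1) * v 0 (i9 8) * v 0 (i9 0) * v 0 (i9 3) = 1 &
      v 0 (i9 8) ^+ 2 + v 0 (i9 2) ^+ 2 + v 0 (i9 4) ^+ 2
        - 2 * 1 * v 0 (i9 8) * v 0 (i9 2) * v 0 (i9 4) = 1].
Proof.
move=> [F /= dF <-]; have [[-> -> ->] [-> -> ->] [-> -> ->]] := coords_entry F.
have [_ _ [b0 d0 e0]] := dF.
have [phi [psi [theta [eta [[_ [-> -> -> ->]] [q1 q2 q3 q4]]]]]] := degenerate_angles dF.
move: q1 q2 q3 q4 => /is_pm_sqr q1 /is_pm_sqr q2 /is_pm_sqr q3 /is_pm_sqr q4.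
rewrite !exprMn !sin2cos2 in q1 q2 q3 q4.
by split=> //; split; lra.
Qed.

(** Four vertices of the octahedron contain one of the four faces, or they form one of
    the three equatorial squares. *)
Lemma degenerate_dim_le m (f : 'I_m -> 'I_9) : injective f ->
  interior (colsub f @` degenerate_coords) !=set0 -> (m <= 3)%N.
Proof.
move=> fI /(movable_interior fI)[x [r mS]].
rewrite (card_codom_sum fI) (sum_ord9 (fun k => k \in codom f)).
have zero i : (forall v, degenerate_coords v -> v 0 i = 0) -> (i \in codom f) = false.
  move=> h; apply/negP => hi; have r0 := mS.1; have [v Sv ev] := movable_point mS.
  have [|w Sw ew] := @movable_line _ _ _ _ _ _ i (r / 2) mS.
    by rewrite gtr0_norm ?divr_gt0 // ltr_pdivrMr // ltr_pMr // ltr1n.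
  have := h w Sw; rewrite ew // shiftE eqxx -ev // (h v Sv) => /eqP.
  by rewrite add0r mulf_eq0 (gt_eqF r0) invr_eq0 pnatr_eq0.
have z1 : (i9 1 \in codom f) = false.
  by apply: zero => v /degenerate_coordsP[[-> _ _] _].
have z5 : (i9 5 \in codom f) = false.
  by apply: zero => v /degenerate_coordsP[[_ -> _] _].
have z6 : (i9 6 \in codom f) = false.
  by apply: zero => v /degenerate_coordsP[[_ _ ->] _].
have t1 : [&& i9 7 \in codom f, i9 0 \in codom f & i9 4 \in codom f] = false.
  apply/negP => /and3P[i7 i0 i4].
  apply: (movable_triangle mS _ _ i7 i0 i4); rewrite ?i9_eq //.
  by move=> v /degenerate_coordsP[_ [e _ _ _]]; exact: e.
have t2 : [&& i9 7 \in codom f, i9 2 \in codom f & i9 3 \in codom f] = false.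
  apply/negP => /and3P[i7 i0 i4].
  apply: (movable_triangle mS _ _ i7 i0 i4); rewrite ?i9_eq //.
  by move=> v /degenerate_coordsP[_ [_ e _ _]]; exact: e.
have t3 : [&& i9 8 \in codom f, i9 0 \in codom f & i9 3 \in codom f] = false.
  apply/negP => /and3P[i7 i0 i4].
  apply: (movable_triangle mS _ _ i7 i0 i4); rewrite ?i9_eq //.
  by move=> v /degenerate_coordsP[_ [_ _ e _]]; exact: e.
have t4 : [&& i9 8 \in codom f, i9 2 \in codom f & i9 4 \in codom f] = false.
  apply/negP => /and3P[i7 i0 i4].
  apply: (movable_triangle mS _ _ i7 i0 i4); rewrite ?i9_eq //.
  by move=> v /degenerate_coordsP[_ [_ _ _ e]]; exact: e.
have s1 : [&& i9 0 \in codom f, i9 4 \in codom f, i9 2 \in codom f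
    & i9 3 \in codom f] = false.
  apply/negP => /and4P[i0 i4 i2 i3].
  apply: (@movable_square _ _ _ _ _ _ _ _ _ _ (i9 7) 1 (-1) mS _ _ _ i0 i4 i2 i3);
    rewrite ?i9_eq ?expr1n //.
  + by move=> v /degenerate_coordsP[_ [e _ _ _]]; exact: e.
  + by move=> v /degenerate_coordsP[_ [_ e _ _]]; exact: e.
have s2 : [&& i9 7 \in codom f, i9 0 \in codom f, i9 8 \in codom f
    & i9 2 \in codom f] = false.
  apply/negP => /and4P[i7 i0 i8 i2].
  apply: (@movable_square _ _ _ _ _ _ _ _ _ _ (i9 4) 1 1 mS _ _ _ i7 i0 i8 i2);
    rewrite ?i9_eq ?expr1n //.
  + by move=> v /degenerate_coordsP[_ [e _ _ _]]; rewrite -[RHS]e; ring.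
  + by move=> v /degenerate_coordsP[_ [_ _ _ e]]; rewrite -[RHS]e; ring.
have s3 : [&& i9 7 \in codom f, i9 4 \in codom f, i9 8 \in codom f
    & i9 3 \in codom f] = false.
  apply/negP => /and4P[i7 i0 i8 i2].
  apply: (@movable_square _ _ _ _ _ _ _ _ _ _ (i9 0) 1 (-1) mS _ _ _ i7 i0 i8 i2);
    rewrite ?i9_eq ?expr1n //.
  + by move=> v /degenerate_coordsP[_ [e _ _ _]]; rewrite -[RHS]e; ring.
  + by move=> v /degenerate_coordsP[_ [_ _ e _]]; rewrite -[RHS]e; ring.
rewrite z1 z5 z6; move: t1 t2 t3 t4 s1 s2 s3 {zero z1 z5 z6}.
by case: (i9 0 \in _); case: (i9 2 \in _); case: (i9 3 \in _); case: (i9 4 \in _);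
   case: (i9 7 \in _); case: (i9 8 \in _).
Qed.

(** The angles phi, psi, eta are free; the equations then hold for theta = pi - phi -
    psi - eta up to sign and period, with p = cos(phi + eta) and q = cos(psi + eta). *)
Lemma degenerate_dim_ge : exists2 f : 'I_3 -> 'I_9, injective f &
  interior (colsub f @` degenerate_coords) !=set0.
Proof.
pose f (i : 'I_3) : 'I_9 := i9 (nth 0%N [:: 0; 2; 4]%N i).
exists f.
  move=> i j /eqP; rewrite /f.
  by case: i => [[|[|[|i]]] hi] //; case: j => [[|[|[|j]]] hj] //;
    rewrite i9_eq //= => _; apply: val_inj.
apply: (@interior_near0 _ _ _ _ _ 1) => // w hw.
pose x k := w 0 (inord k).
have bd k : -1 <= x k <= 1.
  by have := hw (inord k); rewrite ltr_norml -/(x k) => /andP[h1 h2]; rewrite !ltW.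
have [a1 a2] := acos_angle (bd 0%N); have [g1 g2] := acos_angle (bd 1%N).
have [n1 n2] := acos_angle (bd 2%N).
set phi := acos _ in a1 a2; set psi := acos _ in g1 g2; set eta := acos _ in n1 n2.
(* theta is only known through its cosine; the sign of its sine is absorbed by is_pm. *)
pose sigma := phi + psi + eta.
have [|m1 m2] := @acos_angle R (- cos sigma).
  by rewrite lerN2 cos_le1 lerNl cos_geN1.
set theta := acos _ in m1 m2.
have c1 : cos (phi + eta) = cos sigma * cos psi + sin sigma * sin psi.
  by rewrite -cosB; congr cos; rewrite /sigma; ring.
have c2 : cos (psi + eta) = cos sigma * cos phi + sin sigma * sin phi.
  by rewrite -cosB; congr cos; rewrite /sigma; ring.
have st : sin theta ^+ 2 = sin sigma ^+ 2.
  by rewrite !sin2cos2 -m2 sqrrN.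
have [|F [dF [_ [ea eg em en]] ep eq]] :=
  @degenerate_realize R phi psi theta eta (cos (phi + eta)) (cos (psi + eta))
    (And4 a1 g1 m1 n1).
  split; apply/is_pm_sqr.
  - by rewrite cosD; ring.
  - rewrite exprMn st -exprMn c1 -m2; ring.
  - rewrite exprMn st -exprMn c2 -m2; ring.
  - by rewrite cosD; ring.
exists (coords F); first by exists F.
apply/rowP => i; rewrite mxE /f.
have [[h0 h1 h2] [h3 h4 h5] [h6 h7 h8]] := coords_entry F.
by case: i => [[|[|[|i]]] hi] //=; rewrite ?h0 ?h2 ?h4 ?ea ?eg ?en -?a2 -?g2 -?n2;
  congr (w 0 _); apply: val_inj; rewrite /= inordK.
Qed.

End Final.

(** The common points can be taken with p = q = cos(phi + eta). *)
Lemma degenerate_grand_exists (R : realType) (phi psi theta eta : R) :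
  [/\ angle phi, angle psi, angle theta & angle eta] ->
  cos phi = cos psi -> cos theta = - cos eta ->
  exists F : bilinear_map R 3 4 8,
    [/\ degenerate F, angles F phi psi theta eta, grand F & F1122 F = F1423 F].
Proof.
move=> ha e1 e2.
have s1 : sin psi ^+ 2 = sin phi ^+ 2 by rewrite !sin2cos2 e1.
have s2 : sin theta ^+ 2 = sin eta ^+ 2 by rewrite !sin2cos2 e2 sqrrN.
have [|F [dF aF ep eq]] :=
  @degenerate_realize R phi psi theta eta (cos (phi + eta)) (cos (phi + eta)) ha.
  by split; apply/is_pm_sqr; rewrite exprMn ?s1 ?s2 -exprMn cosD ?e2 -?e1; ring.
exists F; split=> //; last by rewrite ep eq.
have [oF nF _] := dF; have [_ [a1 a2 a3 a4]] := aF.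
by split=> //; rewrite ?a1 ?a2 ?a3 ?a4.
Qed.

Theorem corollary2 (R : realType) :
  (* the moduli space is the union of the two components *)
  (forall F : bilinear_map R 3 4 8, orthogonal_multiplication F ->
     exists2 G : bilinear_map R 3 4 8, equivalent F G &
       (grand G /\ F1122 G = F1423 G /\ grand_equation G) \/ degenerate G) /\
  (* (i) the grand moduli *)
  [/\ has_dim [set coords F | F in [set F : bilinear_map R 3 4 8 | grand F]] 5,
      has_dim [set coords F | F in [set F : bilinear_map R 3 4 8 |
                                     grand F /\ F1122 F = F1423 F]] 5,
      forall F : bilinear_map R 3 4 8, grand F ->
        grand_equation F /\
        (F1122 F = F1423 F \/
         [/\ F1421 F = 0, F1422 F = 0 &
             F1423 F + alpha F * mu F = - (F1122 F + alpha F * mu F)]) &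
      forall a b m c d f : R, -1 <= a <= 1 -> -1 <= m <= 1 ->
        b ^+ 2 = (1 - m ^+ 2) * (1 - a ^+ 2) - (f + a * m) ^+ 2
                 - c ^+ 2 - d ^+ 2 ->
        exists2 F : bilinear_map R 3 4 8, grand F &
          [/\ alpha F = a, beta F = b & mu F = m] /\
          [/\ F1421 F = c, F1422 F = d, F1122 F = f & F1423 F = f]] /\
  (* (ii) the degenerate moduli *)
  [/\ has_dim
        [set coords F | F in [set F : bilinear_map R 3 4 8 | degenerate F]] 3,
      forall F : bilinear_map R 3 4 8, degenerate F ->
        exists phi psi theta eta : R,
          [/\ angles F phi psi theta eta,
              degenerate_equations phi psi theta eta (F1122 F) (F1423 F) &
              degenerate_constraint phi psi theta eta (F1122 F) (F1423 F)] &
      forall phi psi theta eta p q : R,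
        [/\ angle phi, angle psi, angle theta & angle eta] ->
        degenerate_equations phi psi theta eta p q ->
        degenerate_constraint phi psi theta eta p q ->
        exists F : bilinear_map R 3 4 8,
          [/\ degenerate F, angles F phi psi theta eta,
              F1122 F = p & F1423 F = q]] /\
  (* the intersection *)
  (forall (F : bilinear_map R 3 4 8) (phi psi theta eta : R),
     degenerate F -> angles F phi psi theta eta ->
     (grand F <-> cos phi = cos psi /\ cos theta = - cos eta)) /\
  (forall phi psi theta eta : R,
     [/\ angle phi, angle psi, angle theta & angle eta] ->
     cos phi = cos psi -> cos theta = - cos eta ->
     exists F : bilinear_map R 3 4 8,
       [/\ degenerate F, angles F phi psi theta eta,
           grand F & F1122 F = F1423 F]).
Proof.
split=> [F oF|]; first by have [G eG dG] := equivalent_degenerate oF; exists G => //; right.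
split; [split|split; [split|split]].
- split.
    have [f fI [w hw]] := grand_dim_ge R; exists f => //; exists w.
    by apply: interiorS hw => _ [v [F [gF _] <-] <-]; exists (coords F) => //; exists F.
  by move=> m f; exact: grand_dim_le.
- split; first exact: grand_dim_ge.
  move=> m f fI [w hw]; apply: (grand_dim_le fI); exists w.
  by apply: interiorS hw => _ [v [F [gF _] <-] <-]; exists (coords F) => //; exists F.
- exact: grand_constraint.
- by move=> a b m c d f ha hm hb; exact: grand_realize.
- by split; [exact: degenerate_dim_ge|move=> m f; exact: degenerate_dim_le].
- move=> F dF; have [phi [psi [theta [eta [aF eF]]]]] := degenerate_angles dF.
  exists phi, psi, theta, eta; split=> //.
  exact: degenerate_equations_constraint.
- by move=> phi psi theta eta p q ha hE _; exact: degenerate_realize.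
- move=> F phi psi theta eta [oF nF _] [_ [a1 a2 a3 a4]].
  split=> [[_ _]|[e1 e2]]; first by rewrite a1 a2 a3 a4.
  by split=> //; rewrite ?a1 ?a2 ?a3 ?a4.
- exact: degenerate_grand_exists.
Qed.
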